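(* Let $\mathcal{X},\mathcal{Z},\mathcal{Y}$ be finite sets, $\mathcal{B}$ a finite-dimensional Hilbert space, $(z,y)\mapsto\rho_{zy}$ a classical-quantum channel with density matrices on $\mathcal{B}$, and $p_X,p_{Z|X},p_Y$ distributions; let $\rho^{XZYB}=\sum_{x,z,y}p_X(x)p_{Z|X}(z|x)p_Y(y)|x,z,y\rangle\langle x,z,y|\otimes\rho_{zy}$. Consider three senders with message sets $[M_i]$, $M_i=\lfloor2^{nR_i}\rfloor$, using the random encoding: $x^n(m_1)$ chosen independently from $p_X^{\otimes n}$; for each $m_1$ and $m_2$, $z^n(m_1,m_2)$ chosen independently from $\prod_ip_{Z|X}(\cdot|x_i(m_1))$; $y^n(m_3)$ chosen independently from $p_Y^{\otimes n}$; the channel input is $(z^n(m_1,m_2),y^n(m_3))$, giving output $\rho_{z^n y^n}$. The receiver must decode $(m_1,m_2)$. Then every rate triple $(R_1,R_2,R_3)$ in the region \[ \begin{array}{c} R_3<I(Y:B|Z)_\rho,\ R_2<I(Z:B|XY)_\rho,\ R_1+R_2<I(Z:B|Y)_\rho,\ R_2+R_3<I(ZY:B|X)_\rho,\ R_1+R_2+R_3<I(ZY:B)_\rho\\ \text{OR}\\ R_3\ge I(Y:B|Z)_\rho,\ R_2<I(Z:B|X)_\rho,\ R_1+R_2<I(Z:B)_\rho \end{array} \] is achievable in the following sense: for every $\eta>0$ there exist $\delta,\epsilon\in(0,1/64)$ and a positive integer $n$ such that, with the decoder below, the expected (over the random codebook) average error probability of decoding $(m_1,m_2)$ is at most $\eta$.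 Decoder for the first region: for $x^nz^ny^n\in T^{(XZY)^n}_\delta$, apply the following construction $\mathcal{C}_\epsilon(A',B')$ (for subspaces $A',B'$: let $A$ be the span of eigenvectors of $\Pi_{A'}\Pi_{B'}\Pi_{A'}$ with eigenvalue $\ge1-\sqrt{\epsilon}$ and output the projector onto $\operatorname{span}\{\Pi_{B'}v:v\in A\}$) first to $A'=\operatorname{supp}\Pi^{\rho_{z^ny^n}}_\delta$, $B'=\operatorname{supp}\Pi^{\rho_{x^ny^n}}_{6\delta}$, obtaining $\tilde\Pi'_{x^nz^ny^n}$, and then to $A'=\operatorname{supp}\tilde\Pi'_{x^nz^ny^n}$, $B'=\operatorname{supp}\Pi^{\rho_{y^n}}_{6\delta}$, obtaining $\tilde\Pi_{x^nz^ny^n}$; set $\tilde\Pi_{x^nz^ny^n}:=0$ for atypical triples. Loop over $(m_1,m_2,m_3)$ lexicographically ($m_1$ outermost, $m_3$ innermost), sequentially measuring $\{\tilde\Pi_{x^n(m_1)z^n(m_1,m_2)y^n(m_3)},I-\tilde\Pi_{x^n(m_1)z^n(m_1,m_2)y^n(m_3)}\}$ on the current post-measurement state, outputting $(m_1,m_2)$ at the first success and aborting if none succeeds. Decoder for the second region: let $\tilde\Pi_{x^nz^n}:=\Pi^{\rho_{z^n}}_\delta$ if $x^nz^n\in T^{(XZ)^n}_\delta$ and $0$ otherwise; loop over $(m_1,m_2)$ lexicographically, sequentially measuring $\{\tilde\Pi_{x^n(m_1)z^n(m_1,m_2)},I-\tilde\Pi_{x^n(m_1)z^n(m_1,m_2)}\}$,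 outputting $(m_1,m_2)$ at the first success and aborting otherwise.
   Context: Logarithms base 2; mutual informations are those of $\rho^{XZYB}$. Averaged states: $\rho_z:=\sum_yp_Y(y)\rho_{zy}$, $\rho_{xy}:=\sum_zp_{Z|X}(z|x)\rho_{zy}$, $\rho_y:=\sum_zp_Z(z)\rho_{zy}$ with $p_Z$ the marginal of $Z$; for sequences these are tensor products, e.g. $\rho_{z^ny^n}=\bigotimes_i\rho_{z_iy_i}$. Typical set $T^{W^n}_\delta:=\{w^n:\forall w,\ |N(w|w^n)/n-p_W(w)|\le\delta p_W(w)\}$ for the relevant joint distribution. For a density matrix $\sigma=\sum_sq(s)|s\rangle\langle s|$ in a fixed eigenbasis, $\Pi^{\sigma^N}_\delta$ projects onto the span of $|s^N\rangle$ with $|N(s|s^N)/N-q(s)|\le\delta q(s)$ for all $s$; for an ensemble $\{\sigma_w\}$ and a sequence $w^n$, $\Pi^{\sigma_{w^n}}_\delta:=\bigotimes_w\Pi^{\sigma_w^{\otimes N(w|w^n)}}_\delta$ acting on positions with $w_i=w$ (applied with $w=(z,y)$, $(x,y)$, $y$, $z$). $\Pi_S$ is the orthogonal projector onto $S$. *)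

(* Defs.v *)
(* mathcomp + mathcomp-analysis (realType, ln, powR) +
   real-closed (complex numbers R[i]).  Finite-dimensional quantum mechanics is
   developed with operators as functions on a finite basis index type. *)
From HB Require Import structures.
From mathcomp Require Import all_boot all_order all_algebra.
From mathcomp Require Import complex.
From mathcomp Require Import reals exp.
From Stdlib Require Import ClassicalEpsilon.
Set Implicit Arguments.
Unset Strict Implicit.
Unset Printing Implicit Defensive.
Import Order.TTheory GRing.Theory Num.Theory.
Local Open Scope ring_scope.
Local Open Scope complex_scope.

Notation wseq n W := {ffun 'I_n -> W}.

Section Quantum.
Variable R : realType.
Local Notation C := (R[i]).

(** ** Linear algebra on C^T, T a finite basis index set *)
Definition vec (T : finType) := T -> C.
Definition op (T : finType) := T -> T -> C.

Definition apply (T : finType) (A : op T) (v : vec T) : vec T :=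
  fun a => \sum_b A a b * v b.
Definition mulop (T : finType) (A B : op T) : op T :=
  fun a c => \sum_b A a b * B b c.
Definition adj (T : finType) (A : op T) : op T := fun a b => (A b a)^*.
Definition idop (T : finType) : op T := fun a b => (a == b)%:R.
Definition zeroop (T : finType) : op T := fun _ _ => 0.
Arguments idop : clear implicits.
Arguments zeroop : clear implicits.
Definition subop (T : finType) (A B : op T) : op T := fun a b => A a b - B a b.
Definition trace (T : finType) (A : op T) : C := \sum_a A a a.
Definition inner (T : finType) (u v : vec T) : C := \sum_a (u a)^* * v a.
Definition diagop (T : finType) (l : T -> R) : op T :=
  fun a b => (a == b)%:R * (l a)%:C.

(** density matrix: positive semidefinite with unit trace *)
Definition density (T : finType) (rho : op T) : Prop :=
  (forall v : vec T, 0 <= inner v (apply rho v)) /\ trace rho = 1.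

(** probability distribution on a finite set *)
Definition distr (T : finType) (p : T -> R) : Prop :=
  (forall t, 0 <= p t) /\ \sum_t p t = 1.

(** ** Spectral decomposition (a fixed, chosen one) *)
Definition unitary (T : finType) (U : op T) : Prop := mulop U (adj U) = idop T.
Definition is_eigdec (T : finType) (rho : op T) (d : op T * (T -> R)) : Prop :=
  unitary d.1 /\ rho = mulop d.1 (mulop (diagop d.2) (adj d.1)).
(** a fixed eigen-decomposition rho = U diag(q) U^*: the eigenbasis vectors
    are the columns U(.,s), s : T, with eigenvalues q s *)
Definition eigdec (T : finType) (rho : op T) : op T * (T -> R) :=
  epsilon (inhabits (idop T, fun _ => 0)) (is_eigdec rho).
Definition eigbasis (T : finType) (rho : op T) : op T := (eigdec rho).1.
Definition eigval (T : finType) (rho : op T) : T -> R := (eigdec rho).2.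

(** ** Entropies, logarithms base 2 *)
Definition log2 (x : R) : R := ln x / ln 2.
Definition xlog2 (x : R) : R := if x == 0 then 0 else x * log2 x.
Definition vN_entropy (T : finType) (rho : op T) : R :=
  - \sum_t xlog2 (eigval rho t).

(** partial trace over the second factor, and relabelling of the basis *)
Definition ptr (U V : finType) (rho : op (U * V)%type) : op U :=
  fun u u' => \sum_v rho (u, v) (u', v).
Definition relabel (T T' : finType) (f : T' -> T) (rho : op T) : op T' :=
  fun a b => rho (f a) (f b).

(** quantum conditional mutual information I(A:B|C) of a state on A B C *)
Definition qcmi (A B Cs : finType) (rho : op (A * B * Cs)%type) : R :=
  let rAC := ptr (relabel (fun t : A * Cs * B => let '(a, c, b) := t in (a, b, c)) rho) in
  let rBC := ptr (relabel (fun t : B * Cs * A => let '(b, c, a) := t in (a, b, c)) rho) in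
  let rC := ptr (relabel (fun t : Cs * (A * B) => let '(c, (a, b)) := t in (a, b, c)) rho) in
  vN_entropy rAC + vN_entropy rBC - vN_entropy rho - vN_entropy rC.

(** ** Subspaces and orthogonal projectors *)
Definition span (T : finType) (S : vec T -> Prop) (v : vec T) : Prop :=
  exists (k : nat) (c : 'I_k -> C) (u : 'I_k -> vec T),
    (forall i, S (u i)) /\ v = (fun a => \sum_i c i * u i a).
Definition range (T : finType) (P : op T) (v : vec T) : Prop :=
  exists u, v = apply P u.
Definition is_orth_proj (T : finType) (V : vec T -> Prop) (P : op T) : Prop :=
  (forall v, V (apply P v)) /\
  (forall v u, V u -> inner u (fun a => v a - apply P v a) = 0).
(** Pi_V : the orthogonal projector onto the subspace V *)
Definition proj (T : finType) (V : vec T -> Prop) : op T :=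
  epsilon (inhabits (zeroop T)) (is_orth_proj V).

(** the construction C_eps(A', B') *)
Definition Ceps (T : finType) (eps : R) (A' B' : vec T -> Prop) : op T :=
  let PA := proj A' in
  let PB := proj B' in
  let M := mulop PA (mulop PB PA) in
  let A := span (fun v => exists lam : C,
                   apply M v = (fun a => lam * v a) /\ (1 - Num.sqrt eps)%:C <= lam) in
  proj (span (fun w => exists v, A v /\ w = apply PB v)).

(** ** Sequences, types and typicality *)

Definition Ncount (n : nat) (W : finType) (w : 'I_n -> W) (a : W) : nat :=
  #|[pred i | w i == a]|.

(** T^{W^n}_delta *)
Definition typical (W : finType) (p : W -> R) (n : nat) (w : 'I_n -> W) (delta : R) : bool :=
  [forall a, `|(Ncount w a)%:R / n%:R - p a| <= delta * p a].

(** tensor product state rho_{w^n} = (x)_i sigma_{w_i} *)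
Definition tensor (W B : finType) (sigma : W -> op B) (n : nat) (w : 'I_n -> W)
  : op (wseq n B) :=
  fun a b => \prod_i sigma (w i) (a i) (b i).

(** Pi^{sigma_{w^n}}_delta : tensor product over w of the delta-typical
    projectors of sigma_w^{(x) N(w|w^n)} (in the fixed eigenbasis of sigma_w),
    acting on the positions i with w_i = w.  An empty tensor factor
    (N(w|w^n) = 0) is the identity. *)
Definition typ_cond (W B : finType) (sigma : W -> op B) (n : nat) (w : 'I_n -> W)
  (delta : R) (s : wseq n B) : bool :=
  [forall w0, (0 < Ncount w w0)%N ==>
     [forall s0, `| (#|[pred i | (w i == w0) && (s i == s0)]|)%:R / (Ncount w w0)%:R
                    - eigval (sigma w0) s0 | <= delta * eigval (sigma w0) s0]].

Definition typproj (W B : finType) (sigma : W -> op B) (n : nat) (w : 'I_n -> W)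
  (delta : R) : op (wseq n B) :=
  fun a b => \sum_(s : wseq n B | typ_cond sigma w delta s)
     \prod_i (eigbasis (sigma (w i)) (a i) (s i) * (eigbasis (sigma (w i)) (b i) (s i))^*).

(** ** Sequential decoding *)
(** success probability: measuring {P_k, I - P_k} in order, summing the
    probabilities of first success at the positions flagged as correct *)
Fixpoint seq_success (T : finType) (rho : op T) (K : op T) (l : seq (op T * bool)) : C :=
  match l with
  | [::] => 0
  | (P, g) :: l' =>
      (if g then trace (mulop (mulop P K) (mulop rho (adj (mulop P K)))) else 0)
      + seq_success rho (mulop (subop (idop T) P) K) l'
  end.

Definition seq_error (T : finType) (rho : op T) (l : seq (op T * bool)) : R :=
  1 - complex.Re (seq_success rho (idop T) l).

End Quantum.

(** ** The setting of the theorem *)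
Section Setting.
Variable R : realType.
Variables (X Z Y B : finType).
Variable rho : Z -> Y -> op R B.
Variables (pX : X -> R) (pZX : X -> Z -> R) (pY : Y -> R).

(** rho^{XZYB} *)
Definition cq_state : op R (X * Z * Y * B)%type :=
  fun t t' =>
    let '(x, z, y, b) := t in let '(x', z', y', b') := t' in
    ((x == x') && (z == z') && (y == y'))%:R * (pX x * pZX x z * pY y)%:C * rho z y b b'.

Definition I_Y_B_gZ : R :=
  qcmi (ptr (relabel (fun t : Y * B * Z * X => let '(y, b, z, x) := t in (x, z, y, b)) cq_state)).
Definition I_Z_B_gXY : R :=
  qcmi (relabel (fun t : Z * B * (X * Y) => let '(z, b, (x, y)) := t in (x, z, y, b)) cq_state).
Definition I_Z_B_gY : R :=
  qcmi (ptr (relabel (fun t : Z * B * Y * X => let '(z, b, y, x) := t in (x, z, y, b)) cq_state)).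
Definition I_ZY_B_gX : R :=
  qcmi (relabel (fun t : (Z * Y) * B * X => let '((z, y), b, x) := t in (x, z, y, b)) cq_state).
Definition I_ZY_B : R :=
  qcmi (ptr (relabel (fun t : (Z * Y) * B * unit * X => let '((z, y), b, _, x) := t in (x, z, y, b)) cq_state)).
Definition I_Z_B_gX : R :=
  qcmi (ptr (relabel (fun t : Z * B * X * Y => let '(z, b, x, y) := t in (x, z, y, b)) cq_state)).
Definition I_Z_B : R :=
  qcmi (ptr (relabel (fun t : Z * B * unit * (X * Y) => let '(z, b, _, (x, y)) := t in (x, z, y, b)) cq_state)).

(** marginal of Z and averaged states *)
Definition pZ (z : Z) : R := \sum_x pX x * pZX x z.
Definition rho_z (z : Z) : op R B := fun b b' => \sum_y (pY y)%:C * rho z y b b'.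
Definition rho_xy (xy : X * Y) : op R B :=
  fun b b' => \sum_z (pZX xy.1 z)%:C * rho z xy.2 b b'.
Definition rho_y (y : Y) : op R B := fun b b' => \sum_z (pZ z)%:C * rho z y b b'.
Definition rho_zy (zy : Z * Y) : op R B := rho zy.1 zy.2.

Definition pXZY (t : X * Z * Y) : R := let '(x, z, y) := t in pX x * pZX x z * pY y.
Definition pXZ (t : X * Z) : R := let '(x, z) := t in pX x * pZX x z.

(** number of messages M = floor(2^{n r}) *)
Definition nmsg (n : nat) (r : R) : nat := Num.truncn (2 `^ (n%:R * r)).

(** probability of a random codebook *)
Definition codebook_prob (n M1 M2 M3 : nat)
  (cx : {ffun 'I_M1 -> wseq n X}) (cz : {ffun 'I_M1 -> {ffun 'I_M2 -> wseq n Z}})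
  (cy : {ffun 'I_M3 -> wseq n Y}) : R :=
  (\prod_m1 \prod_i pX (cx m1 i)) *
  (\prod_m1 \prod_m2 \prod_i pZX (cx m1 i) (cz m1 m2 i)) *
  (\prod_m3 \prod_i pY (cy m3 i)).

(** decoder for the first region *)
Definition dec1_proj (n : nat) (delta eps : R) (x : wseq n X) (z : wseq n Z) (y : wseq n Y)
  : op R (wseq n B) :=
  if typical pXZY (fun i => (x i, z i, y i)) delta then
    let Pt' := Ceps eps (range (typproj rho_zy (fun i => (z i, y i)) delta))
                        (range (typproj rho_xy (fun i => (x i, y i)) (6 * delta))) in
    Ceps eps (range Pt') (range (typproj rho_y y (6 * delta)))
  else @zeroop R _.

(** decoder for the second region *)
Definition dec2_proj (n : nat) (delta : R) (x : wseq n X) (z : wseq n Z) : op R (wseq n B) :=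
  if typical pXZ (fun i => (x i, z i)) delta then typproj rho_z z delta
  else @zeroop R _.

(** received state rho_{z^n y^n} *)
Definition received (n : nat) (z : wseq n Z) (y : wseq n Y) : op R (wseq n B) :=
  tensor rho_zy (fun i => (z i, y i)).

(** expected average error probability, first decoder *)
Definition exp_err1 (n M1 M2 M3 : nat) (delta eps : R) : R :=
  \sum_(cx : {ffun 'I_M1 -> wseq n X})
  \sum_(cz : {ffun 'I_M1 -> {ffun 'I_M2 -> wseq n Z}})
  \sum_(cy : {ffun 'I_M3 -> wseq n Y})
    codebook_prob cx cz cy *
    ((M1 * M2 * M3)%:R^-1 *
     \sum_(m1 < M1) \sum_(m2 < M2) \sum_(m3 < M3)
       seq_error (received (cz m1 m2) (cy m3))
         [seq (dec1_proj delta eps (cx k.1.1) (cz k.1.1 k.1.2) (cy k.2),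
               (k.1.1 == m1) && (k.1.2 == m2))
         | k <- [seq (k12, k3) | k12 <- [seq (k1, k2) | k1 <- enum 'I_M1, k2 <- enum 'I_M2], k3 <- enum 'I_M3]]).

(** expected average error probability, second decoder *)
Definition exp_err2 (n M1 M2 M3 : nat) (delta : R) : R :=
  \sum_(cx : {ffun 'I_M1 -> wseq n X})
  \sum_(cz : {ffun 'I_M1 -> {ffun 'I_M2 -> wseq n Z}})
  \sum_(cy : {ffun 'I_M3 -> wseq n Y})
    codebook_prob cx cz cy *
    ((M1 * M2 * M3)%:R^-1 *
     \sum_(m1 < M1) \sum_(m2 < M2) \sum_(m3 < M3)
       seq_error (received (cz m1 m2) (cy m3))
         [seq (dec2_proj delta (cx k.1) (cz k.1 k.2), (k.1 == m1) && (k.2 == m2))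
         | k <- [seq (k1, k2) | k1 <- enum 'I_M1, k2 <- enum 'I_M2]]).

End Setting.

(* Main.v *)
Require Import Defs.
From HB Require Import structures.
From mathcomp Require Import all_boot all_order all_algebra.
From mathcomp Require Import complex boolp.
From mathcomp Require Import reals sequences exp.
From mathcomp Require Import ring lra.
From Stdlib Require Import ClassicalEpsilon.
Import Order.TTheory GRing.Theory Num.Theory.
Set Implicit Arguments.
Unset Strict Implicit.
Unset Printing Implicit Defensive.
Local Open Scope ring_scope.
Local Open Scope complex_scope.

(** Conditioned on the transmitted codewords, the successive projective
    measurements satisfy a non-commutative union bound: if [K] is the product of
    the failures before, and the success at, the right triple, then
    [A - P * B = (1 - P) * A + P * (A - B)] is an orthogonal decomposition, so
    [|S - K S|^2] is at most the sum of the individual squared errors, where the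
    state is [S S^*].  Since this is linear in the squared errors it may be
    averaged over the codebook.

    The projector produced by [Ceps] on [A'], [B'] is at most
    [(1 - sqrt eps)^-1 Pi_B' Pi_A' Pi_B'], and it keeps every state that has
    little weight outside [A'] and [B'].  Averaging the wrong codewords therefore
    bounds the first decoder when only [m2], or [m1] but not [m3], is wrong: the
    two outer projectors of [rho_xy] and [rho_y] meet the averaged states.  For
    the remaining error events the transmitted state is first sandwiched by the
    typical projectors of [rho_z], [rho_x] and the overall average state; by
    gentle measurement this costs little, and averaging this smoothed state over
    the right codewords makes it exponentially small in operator norm.  Typical
    projectors only fail with probability O(1/n) by Chebyshev's inequality, and
    [eps] can be kept constant. *)

(** * Operators as a ring with involution *)

(** Everything is carried by a square root [S] of the received state. Both gentle measurement and
    the sequential measurements become estimates of [nrm2 (S - ...)], with no square root of a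
    probability, and the only loss is Young's inequality with a free parameter [t], later half the
    target error. The obstacle is that the decoder contains projectors for [rho_zy], [rho_xy] and
    [rho_y] only. When [y] is wrong, averaging the decoder over the wrong codewords would need
    projectors for [rho_z], [rho_x] or the overall average, which it lacks. Since the state may be
    altered in the analysis, those projectors are put on its side, and the wrong decoder projector
    enters through its trace alone. The second decoder is handled by the same smoothed state. A
    constant [eps] suffices because the deficit of [Ceps] is linear in the deficits of its two
    projectors once [eps] is fixed. As typicality fails with probability O(1/n), the exponential
    bounds are weakened to O(1/n) as well, so that a single constant over n governs the total error.
    Entropies are measured in nats. *)

Section OpRing.
Variables (R : realType) (T : finType).
Local Notation C := (R[i]).
Implicit Types A B D : op R T.

(** Operators are functions, so equality and choice come from the classical axioms; this opens the
    algebraic hierarchy to them. *)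
HB.instance Definition _ := gen_eqMixin (op R T).
HB.instance Definition _ := gen_choiceMixin (op R T).

Lemma op_ext A B : (forall a b, A a b = B a b) -> A = B.
Proof. by move=> h; apply: functional_extensionality_dep => a;
  apply: functional_extensionality_dep => b. Qed.

Definition oppop A : op R T := fun a b => - A a b.
Definition addop A B : op R T := fun a b => A a b + B a b.
Definition scaleop (x : R) A : op R T := fun a b => x%:C * A a b.

Lemma addopA : associative addop.
Proof. by move=> A B D; apply: op_ext => a b; rewrite /addop addrA. Qed.
Lemma addopC : commutative addop.
Proof. by move=> A B; apply: op_ext => a b; rewrite /addop addrC. Qed.
Lemma add0op : left_id (@zeroop R T) addop.
Proof. by move=> A; apply: op_ext => a b; rewrite /addop add0r. Qed.
Lemma addNop : left_inverse (@zeroop R T) oppop addop.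
Proof. by move=> A; apply: op_ext => a b; rewrite /addop /oppop addNr. Qed.

HB.instance Definition _ := GRing.isZmodule.Build (op R T) addopA addopC add0op addNop.

Lemma addE A B a b : (A + B) a b = A a b + B a b. Proof. by []. Qed.

Lemma mulopA : associative (@mulop R T).
Proof.
move=> A B D; apply: op_ext => a d; rewrite /mulop.
under eq_bigr do rewrite mulr_sumr.
rewrite exchange_big /=; apply: eq_bigr => b _.
by rewrite mulr_suml; apply: eq_bigr => c _; rewrite mulrA.
Qed.
Lemma mul1op : left_id (@idop R T) (@mulop R T).
Proof.
move=> A; apply: op_ext => a c; rewrite /mulop /idop (bigD1 a) //= eqxx mul1r.
by rewrite big1 ?addr0 // => b ba; rewrite eq_sym (negPf ba) mul0r.
Qed.
Lemma mulop1 : right_id (@idop R T) (@mulop R T).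
Proof.
move=> A; apply: op_ext => a c; rewrite /mulop /idop (bigD1 c) //= eqxx mulr1.
by rewrite big1 ?addr0 // => b ba; rewrite (negPf ba) mulr0.
Qed.
Lemma mulopDl : left_distributive (@mulop R T) +%R.
Proof.
move=> A B D; apply: op_ext => a c; rewrite [RHS]addE /mulop -big_split.
by apply: eq_bigr => b _; rewrite mulrDl.
Qed.
Lemma mulopDr : right_distributive (@mulop R T) +%R.
Proof.
move=> A B D; apply: op_ext => a c; rewrite [RHS]addE /mulop -big_split.
by apply: eq_bigr => b _; rewrite mulrDr.
Qed.
HB.instance Definition _ := GRing.Zmodule_isPzRing.Build (op R T)
  mulopA mul1op mulop1 mulopDl mulopDr.

Lemma scaleopA x y A : scaleop x (scaleop y A) = scaleop (x * y) A.
Proof. by apply: op_ext => a b; rewrite /scaleop mulrA rmorphM. Qed.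
Lemma scale1op : left_id 1 scaleop.
Proof. by move=> A; apply: op_ext => a b; rewrite /scaleop mul1r. Qed.
Lemma scaleopDr : right_distributive scaleop +%R.
Proof. by move=> x A B; apply: op_ext => a b; rewrite /scaleop mulrDr. Qed.
Lemma scaleopDl A : {morph scaleop^~ A : x y / x + y}.
Proof. by move=> x y; apply: op_ext => a b; rewrite /scaleop rmorphD mulrDl. Qed.
HB.instance Definition _ := GRing.Zmodule_isLmodule.Build R (op R T)
  scaleopA scale1op scaleopDr scaleopDl.

Lemma mulopE A B : mulop A B = A * B. Proof. by []. Qed.
Lemma idopE : @idop R T = 1. Proof. by []. Qed.
Lemma oppE A a b : (- A) a b = - A a b. Proof. by []. Qed.
Lemma scaleE x A a b : (x *: A) a b = x%:C * A a b. Proof. by []. Qed.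
Lemma mulE A B a b : (A * B) a b = \sum_c A a c * B c b. Proof. by []. Qed.
Lemma oneE a b : (1 : op R T) a b = (a == b)%:R. Proof. by []. Qed.
Lemma sumE (I : Type) (r : seq I) (P : pred I) (F : I -> op R T) a b :
  (\sum_(i <- r | P i) F i) a b = \sum_(i <- r | P i) F i a b.
Proof. by elim/big_rec2: _ => // i y1 y2 _ <-. Qed.

Lemma op_scalerAl x A B : x *: (A * B) = (x *: A) * B.
Proof.
apply: op_ext => a b; rewrite scaleE !mulE mulr_sumr.
by apply: eq_bigr => c _; rewrite scaleE mulrA.
Qed.
Lemma op_scalerAr x A B : x *: (A * B) = A * (x *: B).
Proof.
apply: op_ext => a b; rewrite scaleE !mulE mulr_sumr.
by apply: eq_bigr => c _; rewrite scaleE mulrCA.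
Qed.

Lemma adjK A : adj (adj A) = A.
Proof. by apply: op_ext => a b; rewrite /adj conjcK. Qed.
Lemma adjD A B : adj (A + B) = adj A + adj B.
Proof. by apply: op_ext => a b; rewrite addE /adj -rmorphD. Qed.
Lemma adjN A : adj (- A) = - adj A.
Proof. by apply: op_ext => a b; rewrite oppE /adj -rmorphN. Qed.
Lemma adjB A B : adj (A - B) = adj A - adj B.
Proof. by rewrite adjD adjN. Qed.
Lemma adjZ x A : adj (x *: A) = x *: adj A.
Proof. by apply: op_ext => a b; rewrite scaleE /adj scaleE rmorphM /= oppr0. Qed.
Lemma adjM A B : adj (A * B) = adj B * adj A.
Proof.
apply: op_ext => a b; rewrite mulE /adj mulE rmorph_sum.
by apply: eq_bigr => c _; rewrite rmorphM mulrC.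
Qed.
Lemma adj1 : adj (1 : op R T) = 1.
Proof. by apply: op_ext => a b; rewrite /adj !oneE conjc_nat eq_sym. Qed.
Lemma adj0 : adj (0 : op R T) = 0.
Proof. by apply: op_ext => a b; rewrite /adj conjc0. Qed.

(** Taking the real part keeps all estimates in the ordered field [R], while cyclicity and linearity
    over [R] survive. *)
Definition rtr A : R := complex.Re (trace A).

Lemma rtrE A : rtr A = \sum_a complex.Re (A a a).
Proof. by rewrite /rtr /trace raddf_sum. Qed.
Lemma rtrD A B : rtr (A + B) = rtr A + rtr B.
Proof. by rewrite !rtrE -big_split /=; apply: eq_bigr => a _; rewrite addE raddfD. Qed.
Lemma rtrN A : rtr (- A) = - rtr A.
Proof. by rewrite !rtrE -sumrN; apply: eq_bigr => a _; rewrite oppE raddfN. Qed.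
Lemma rtrB A B : rtr (A - B) = rtr A - rtr B.
Proof. by rewrite rtrD rtrN. Qed.
Lemma rtrZ x A : rtr (x *: A) = x * rtr A.
Proof.
rewrite !rtrE mulr_sumr; apply: eq_bigr => a _; rewrite scaleE.
by case: (A a a) => u v /=; rewrite mul0r subr0.
Qed.
Lemma rtr0 : rtr 0 = 0. Proof. by rewrite rtrE big1. Qed.
Lemma rtr_sum (I : Type) (r : seq I) (P : pred I) (F : I -> op R T) :
  rtr (\sum_(i <- r | P i) F i) = \sum_(i <- r | P i) rtr (F i).
Proof. by apply: (big_morph _ rtrD rtr0). Qed.
Lemma rtrC A B : rtr (A * B) = rtr (B * A).
Proof.
rewrite /rtr /trace; congr complex.Re; under eq_bigr do rewrite mulE.
rewrite exchange_big /=; apply: eq_bigr => a _; rewrite mulE.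
by apply: eq_bigr => b _; rewrite mulrC.
Qed.
Lemma rtr_adj A : rtr (adj A) = rtr A.
Proof. by rewrite !rtrE; apply: eq_bigr => a _; rewrite /adj; case: (A a a). Qed.

(* In [ring_scope] positions [z^*] denotes [Num.conj z], elsewhere [conjc z]. *)
Lemma conjE (z : C) : Num.conj z = conjc z. Proof. by []. Qed.
Lemma conjcD (x y : C) : conjc (x + y) = conjc x + conjc y.
Proof. exact: (rmorphD (@conjc R)). Qed.
Lemma conjcM (x y : C) : conjc (x * y) = conjc x * conjc y.
Proof. exact: (rmorphM (@conjc R)). Qed.
Lemma conjcB (x y : C) : conjc (x - y) = conjc x - conjc y.
Proof. exact: (raddfB (@conjc R)). Qed.
Lemma conjc_sum (I : Type) (r : seq I) (P : pred I) (F : I -> C) :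
  conjc (\sum_(i <- r | P i) F i) = \sum_(i <- r | P i) conjc (F i).
Proof. exact: (raddf_sum (@conjc R)). Qed.
Lemma ReD (x y : C) : complex.Re (x + y) = complex.Re x + complex.Re y.
Proof. exact: (raddfD (@complex.Re R)). Qed.
Lemma Re_sum (I : Type) (r : seq I) (P : pred I) (F : I -> C) :
  complex.Re (\sum_(i <- r | P i) F i) = \sum_(i <- r | P i) complex.Re (F i).
Proof. exact: (raddf_sum (@complex.Re R)). Qed.

Lemma Re_conjM (z : C) : complex.Re (conjc z * z) = complex.Re z ^+ 2 + complex.Im z ^+ 2.
Proof. by case: z => u v /=; ring. Qed.

(** Squared Hilbert-Schmidt norm. For a state [S * adj S] and a projector [P], [nrm2 (P * S)] is the
    probability of the outcome [P]. *)
Definition nrm2 A : R := rtr (adj A * A).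
Lemma nrm2E A : nrm2 A = \sum_a \sum_b (complex.Re (A b a) ^+ 2 + complex.Im (A b a) ^+ 2).
Proof.
rewrite /nrm2 rtrE; apply: eq_bigr => a _; rewrite mulE raddf_sum.
by apply: eq_bigr => b _; rewrite /adj -Re_conjM.
Qed.
Lemma nrm2_ge0 A : 0 <= nrm2 A.
Proof. by rewrite nrm2E; do 2!apply: sumr_ge0 => ? _; rewrite addr_ge0 // sqr_ge0. Qed.
Lemma nrm20 : nrm2 0 = 0. Proof. by rewrite /nrm2 mulr0 rtr0. Qed.
Lemma nrm2N A : nrm2 (- A) = nrm2 A. Proof. by rewrite /nrm2 adjN mulrNN. Qed.
Definition dot A B : R := rtr (adj A * B).
Lemma dotC A B : dot A B = dot B A.
Proof. by rewrite /dot -rtr_adj adjM adjK. Qed.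
Lemma nrm2D A B : nrm2 (A + B) = nrm2 A + nrm2 B + 2 * dot A B.
Proof.
rewrite /nrm2 adjD mulrDl !mulrDr !rtrD -/(dot A B) -/(dot B A) (dotC B A) -!/(nrm2 _).
by rewrite /nrm2; ring.
Qed.
Lemma nrm2B A B : nrm2 (A - B) = nrm2 A + nrm2 B - 2 * dot A B.
Proof. by rewrite nrm2D nrm2N /dot mulrN rtrN; ring. Qed.
Lemma nrm2Z x A : nrm2 (x *: A) = x ^+ 2 * nrm2 A.
Proof. by rewrite /nrm2 adjZ -op_scalerAl -op_scalerAr !rtrZ; ring. Qed.
Lemma dotZr x A B : dot A (x *: B) = x * dot A B.
Proof. by rewrite /dot -op_scalerAr rtrZ. Qed.

Lemma nrm2D_le A B : nrm2 (A + B) <= 2 * nrm2 A + 2 * nrm2 B.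
Proof. by have := nrm2_ge0 (A - B); rewrite nrm2B nrm2D; lra. Qed.
Lemma nrm2D3_le A B D : nrm2 (A + B + D) <= 3 * nrm2 A + 3 * nrm2 B + 3 * nrm2 D.
Proof.
have := nrm2_ge0 (A - B); have := nrm2_ge0 (A - D); have := nrm2_ge0 (B - D).
rewrite !nrm2B !nrm2D.
have -> : dot (A + B) D = dot A D + dot B D by rewrite /dot adjD mulrDl rtrD.
by lra.
Qed.

(** Young's inequality, from the square of [t *: A - B]. Unlike Cauchy-Schwarz it is linear in
    [nrm2 B], so it commutes with averaging over codebooks. *)
Lemma nrm2B_ge A B t : 0 < t -> nrm2 A - t * nrm2 A - t^-1 * nrm2 B <= nrm2 (A - B).
Proof.
move=> t0; have := nrm2_ge0 (t *: A - B); rewrite !nrm2B nrm2Z.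
have -> : dot (t *: A) B = t * dot A B by rewrite dotC dotZr dotC.
move=> h; have h2 : 0 <= t * nrm2 A + t^-1 * nrm2 B - 2 * dot A B.
  have -> : t * nrm2 A + t^-1 * nrm2 B - 2 * dot A B =
     t^-1 * (t ^+ 2 * nrm2 A + nrm2 B - 2 * (t * dot A B)).
    by field; rewrite gt_eqF.
  by rewrite mulr_ge0 // invr_ge0 ltW.
have := nrm2_ge0 B; lra.
Qed.

(* The quadratic form is tested on operators (families of columns), so that no
   vectors are needed. *)
Definition lea A B := forall S, rtr (adj S * A * S) <= rtr (adj S * B * S).
Local Notation "A ⪯ B" := (lea A B) (at level 70).

Lemma lea_refl A : A ⪯ A. Proof. by move=> S. Qed.
Lemma lea_trans B A D : A ⪯ B -> B ⪯ D -> A ⪯ D.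
Proof. by move=> h1 h2 S; apply: le_trans (h1 S) (h2 S). Qed.
Lemma leaD A B A' B' : A ⪯ B -> A' ⪯ B' -> A + A' ⪯ B + B'.
Proof. by move=> h1 h2 S; rewrite !mulrDr !mulrDl !rtrD lerD. Qed.
Lemma lea_conj G A B : A ⪯ B -> adj G * A * G ⪯ adj G * B * G.
Proof. by move=> h S; have := h (G * S); rewrite adjM !mulrA. Qed.
Lemma leaZ x A B : 0 <= x -> A ⪯ B -> x *: A ⪯ x *: B.
Proof.
by move=> x0 h S; rewrite -!op_scalerAr -!op_scalerAl !rtrZ ler_wpM2l.
Qed.
Lemma leaZr x y A : x <= y -> 0 ⪯ A -> x *: A ⪯ y *: A.
Proof.
move=> xy h S; rewrite -!op_scalerAr -!op_scalerAl !rtrZ ler_wpM2r //.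
by have := h S; rewrite mulr0 mul0r rtr0.
Qed.
Lemma lea_sum (I : Type) (r : seq I) (P : pred I) (F G : I -> op R T) :
  (forall i, P i -> F i ⪯ G i) ->
  \sum_(i <- r | P i) F i ⪯ \sum_(i <- r | P i) G i.
Proof.
by move=> h; elim/big_rec2: _ => [|i A B Pi hAB]; [exact: lea_refl | exact: leaD (h i Pi) hAB].
Qed.
Lemma lea_rtr A B : A ⪯ B -> rtr A <= rtr B.
Proof. by move=> /(_ 1); rewrite adj1 !mul1r !mulr1. Qed.
Lemma lea_subP A B : (0 ⪯ B - A) <-> (A ⪯ B).
Proof.
by split=> h S; have := h S; rewrite mulr0 mul0r rtr0 mulrDr mulrDl mulrN mulNr rtrB subr_ge0.
Qed.
Lemma lea0_sqr G : 0 ⪯ adj G * G.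
Proof.
move=> S; rewrite mulr0 mul0r rtr0.
by have := nrm2_ge0 (G * S); rewrite /nrm2 adjM !mulrA.
Qed.
Lemma lea0_conj G A : 0 ⪯ A -> 0 ⪯ adj G * A * G.
Proof. by move=> h; have := lea_conj G h; rewrite mulr0 mul0r. Qed.
Lemma lea0Z x A : 0 <= x -> 0 ⪯ A -> 0 ⪯ x *: A.
Proof. by move=> x0 h; have := leaZ x0 h; rewrite scaler0. Qed.
Lemma lea0_rtr A : 0 ⪯ A -> 0 <= rtr A.
Proof. by move=> /lea_rtr; rewrite rtr0. Qed.

Definition projector P := adj P = P /\ P * P = P.

Lemma projector_compl P : projector P -> projector (1 - P).
Proof.
by case=> h1 h2; split; rewrite ?adjB ?adj1 ?h1 // mulrBl !mulrBr !mulr1 !mul1r h2 subrr subr0.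
Qed.
Lemma projector0 : projector 0.
Proof. by split; rewrite ?adj0 ?mulr0. Qed.
Lemma projector_ge0 P : projector P -> 0 ⪯ P.
Proof. by case=> h1 h2; have := lea0_sqr P; rewrite h1 h2. Qed.
Lemma projector_le1 P : projector P -> P ⪯ 1.
Proof. by move=> /projector_compl/projector_ge0/lea_subP. Qed.
Lemma nrm2_proj P A : projector P -> nrm2 (P * A) = rtr (adj A * P * A).
Proof. by case=> h1 h2; rewrite /nrm2 adjM h1 !mulrA -(mulrA _ P P) h2. Qed.
Lemma nrm2_proj_split P A : projector P -> nrm2 A = nrm2 (P * A) + nrm2 ((1 - P) * A).
Proof.
move=> hP; rewrite !nrm2_proj //; last exact: projector_compl.
by rewrite -rtrD -mulrDl -mulrDr addrC subrK mulr1.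
Qed.
Lemma nrm2_proj_le P A : projector P -> nrm2 (P * A) <= nrm2 A.
Proof. by move=> hP; rewrite (nrm2_proj_split A hP) lerDl nrm2_ge0. Qed.
Lemma proj_conj_le P A : projector P -> 0 ⪯ A -> rtr (P * A * P) <= rtr A.
Proof.
move=> hP h; have [h1 h2] := hP; rewrite rtrC mulrA h2.
have : 0 <= rtr ((1 - P) * A * (1 - P)).
  have [h3 h4] := projector_compl hP.
  by have := lea0_rtr (lea0_conj (1 - P) h); rewrite h3.
rewrite (rtrC _ (1 - P)) mulrA (projector_compl hP).2 mulrBl mul1r rtrB; lra.
Qed.
End OpRing.
Notation "A ⪯ B" := (lea A B) (at level 70).

(** * Spectral theorem *)

Section Spectral.
Variables (R : realType) (T : finType).
Local Notation C := (R[i]).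
Implicit Types A B U : op R T.

Definition mx_of A : 'M[C]_#|T| := \matrix_(i, j) A (enum_val i) (enum_val j).
Definition of_mx (M : 'M[C]_#|T|) : op R T := fun a b => M (enum_rank a) (enum_rank b).

Lemma mx_ofK A : of_mx (mx_of A) = A.
Proof. by apply: op_ext => a b; rewrite /of_mx mxE !enum_rankK. Qed.
Lemma of_mxM M N : of_mx (M *m N) = of_mx M * of_mx N.
Proof.
apply: op_ext => a b; rewrite mulE /of_mx mxE (reindex (@enum_rank T)) //=.
by exists enum_val => i _; [exact: enum_rankK | exact: enum_valK].
Qed.
Lemma of_mx1 : of_mx 1%:M = 1.
Proof. by apply: op_ext => a b; rewrite /of_mx mxE oneE (inj_eq enum_rank_inj). Qed.
Lemma of_mx_adj M : of_mx (M^T ^ Num.conj)%sesqui = adj (of_mx M).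
Proof. by apply: op_ext => a b; rewrite /of_mx /adj !mxE. Qed.

Lemma mx_ofM A B : mx_of (A * B) = mx_of A *m mx_of B.
Proof.
apply/matrixP => i j; rewrite !mxE mulE (reindex (@enum_val T predT)) /=.
  by apply: eq_bigr => k _; rewrite !mxE.
by exists enum_rank => k _; [exact: enum_valK | exact: enum_rankK].
Qed.
Lemma mx_of1 : mx_of 1 = 1%:M.
Proof. by apply/matrixP => i j; rewrite !mxE oneE (inj_eq enum_val_inj). Qed.

Lemma mul1_op_comm A B : A * B = 1 -> B * A = 1.
Proof.
move=> /(congr1 mx_of); rewrite mx_ofM mx_of1 => /mulmx1C.
by rewrite -mx_ofM => /(congr1 of_mx); rewrite mx_ofK of_mx1.
Qed.

Lemma unitary_adjl U : unitary U -> adj U * U = 1.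
Proof. exact: mul1_op_comm. Qed.

(** Transported from the spectral theorem for normal matrices. The real part in the witness loses
    nothing because a Hermitian matrix has a real spectrum. *)
Lemma hermitian_eigdec A : adj A = A -> exists d, is_eigdec A d.
Proof.
move=> hA; have hm : mx_of A \is hermsymmx.
  apply/is_hermitianmxP; rewrite expr0 scale1r; apply/matrixP => i j.
  by rewrite !mxE -[in LHS]hA.
have /orthomx_spectralP e := hermitian_normalmx hm.
set P := spectralmx _ in e; set D := spectral_diag _ in e.
have Pu : P \is unitarymx by exact: spectral_unitarymx.
exists (adj (of_mx P), fun a => complex.Re (D 0 (enum_rank a))); split=> /=.
  rewrite /unitary adjK mulopE -of_mx_adj -of_mxM.
  by rewrite -(invmx_unitary Pu) mulVmx ?of_mx1 // unitarymx_unit.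
rewrite adjK !mulopE mulrA -{1}(mx_ofK A) e !of_mxM (invmx_unitary Pu) of_mx_adj.
congr (_ * _ * _); apply: op_ext => a b; rewrite /of_mx /diagop !mxE (inj_eq enum_rank_inj).
case: (a == b); rewrite ?mulr0n ?mulr1n ?mul0r ?mul1r //.
have /mxOverP /(_ 0 (enum_rank a)) := hermitian_spectral_diag_real hm.
rewrite -/D; case: (D 0 _) => u v /=.
by rewrite realE => /orP[]; rewrite lecE /= ?[_ == v]eq_sym => /andP[/eqP h _]; rewrite -?h // h.
Qed.

(** Functional calculus in the basis [U]: for unitary [U], products, order and trace of such
    operators reduce to pointwise facts about [q]. *)
Definition cdiag U (q : T -> R) : op R T := U * diagop q * adj U.

Lemma diagopM (q r : T -> R) : diagop q * diagop r = diagop (fun s => q s * r s).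
Proof.
apply: op_ext => a b; rewrite mulE /diagop (bigD1 a) //= eqxx mul1r.
rewrite big1 ?addr0 => [|c ca]; last by rewrite eq_sym (negPf ca) !mul0r.
by case: (a == b); rewrite ?mul0r ?mulr0 // !mul1r -rmorphM.
Qed.
Lemma diagopD (q r : T -> R) : diagop q + diagop r = diagop (fun s => q s + r s).
Proof. by apply: op_ext => a b; rewrite addE /diagop -mulrDr -rmorphD. Qed.
Lemma diagopZ x (q : T -> R) : x *: diagop q = diagop (fun s => x * q s).
Proof. by apply: op_ext => a b; rewrite scaleE /diagop mulrCA -rmorphM. Qed.
Lemma diagop1 : diagop (fun _ : T => 1 : R) = 1.
Proof. by apply: op_ext => a b; rewrite oneE /diagop mulr1. Qed.
Lemma diagop_adj (q : T -> R) : adj (diagop q) = diagop q.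
Proof.
apply: op_ext => a b; rewrite /adj /diagop eq_sym; case: eqP => [->|_].
  by rewrite !mul1r conjc_real.
by rewrite !mul0r conjc0.
Qed.
Lemma diagop_ge0 (q : T -> R) : (forall s, 0 <= q s) -> 0 ⪯ diagop q.
Proof.
move=> h; have := lea0_sqr (diagop (fun s => Num.sqrt (q s))).
rewrite diagop_adj diagopM (_ : (fun s => _) = q) //.
by apply/funext => s; rewrite -expr2 sqr_sqrtr.
Qed.
Lemma rtr_diagop (q : T -> R) : rtr (diagop q) = \sum_s q s.
Proof. by rewrite rtrE; apply: eq_bigr => a _; rewrite /diagop eqxx mul1r. Qed.

Section Cdiag.
Variables (U : op R T) (hU : unitary U).

Lemma cdiagM q r : cdiag U q * cdiag U r = cdiag U (fun s => q s * r s).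
Proof.
by rewrite /cdiag !mulrA -(mulrA _ (adj U) U) unitary_adjl // mulr1 -(mulrA U) diagopM.
Qed.
Lemma cdiagD q r : cdiag U q + cdiag U r = cdiag U (fun s => q s + r s).
Proof. by rewrite /cdiag -mulrDl -mulrDr diagopD. Qed.
Lemma cdiagZ x q : x *: cdiag U q = cdiag U (fun s => x * q s).
Proof. by rewrite /cdiag op_scalerAl op_scalerAr diagopZ. Qed.
Lemma cdiag1 : cdiag U (fun _ => 1) = 1.
Proof. by rewrite /cdiag diagop1 mulr1. Qed.
Lemma cdiag_adj q : adj (cdiag U q) = cdiag U q.
Proof. by rewrite /cdiag !adjM adjK diagop_adj mulrA. Qed.
Lemma rtr_cdiag q : rtr (cdiag U q) = \sum_s q s.
Proof. by rewrite /cdiag rtrC mulrA unitary_adjl // mul1r rtr_diagop. Qed.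
Lemma cdiag_ge0 q : (forall s, 0 <= q s) -> 0 ⪯ cdiag U q.
Proof. by move=> h; have := lea0_conj (adj U) (diagop_ge0 h); rewrite adjK. Qed.
Lemma cdiag_le q r : (forall s, q s <= r s) -> cdiag U q ⪯ cdiag U r.
Proof.
move=> h; apply/lea_subP; rewrite -scaleN1r cdiagZ cdiagD.
by apply: cdiag_ge0 => s; rewrite mulN1r subr_ge0.
Qed.
Lemma cdiag_ge0_inv q : 0 ⪯ cdiag U q -> forall s, 0 <= q s.
Proof.
move=> h s; have := lea0_rtr (lea0_conj (U * diagop (fun t => (t == s)%:R)) h).
rewrite /cdiag adjM diagop_adj !mulrA -(mulrA _ (adj U) U) unitary_adjl // mulr1.
rewrite -(mulrA _ (adj U) U) unitary_adjl // mulr1 !diagopM rtr_diagop.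
rewrite (bigD1 s) //= big1 ?addr0 ?eqxx ?mulr1 ?mul1r // => t ts.
by rewrite (negPf ts) !mul0r.
Qed.
Lemma cdiag_projector (P : pred T) : projector (cdiag U (fun s => (P s)%:R)).
Proof.
split; first exact: cdiag_adj.
by rewrite cdiagM; congr cdiag; apply/funext => s; case: (P s); rewrite ?mulr0 ?mulr1.
Qed.
Lemma cdiag_entry q a b : cdiag U q a b = \sum_s (q s)%:C * (U a s * conjc (U b s)).
Proof.
rewrite /cdiag mulE; apply: eq_bigr => s _; rewrite mulE /diagop (bigD1 s) //= big1 ?addr0.
  by rewrite eqxx mul1r /adj; ring.
by move=> c cs; rewrite (negPf cs) mul0r mulr0.
Qed.
End Cdiag.

Lemma is_eigdecE A d : is_eigdec A d <-> unitary d.1 /\ A = cdiag d.1 d.2.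
Proof. by rewrite /is_eigdec /cdiag !mulopE mulrA. Qed.

Lemma eigdecP A : adj A = A -> unitary (eigbasis A) /\ A = cdiag (eigbasis A) (eigval A).
Proof.
by move=> /hermitian_eigdec h; apply/(is_eigdecE A (eigdec A));
  exact: (epsilon_spec _ (is_eigdec A) h).
Qed.

(** Polarization: the quadratic form is real at e_a, e_b, e_a + e_b and e_a + i e_b, and these four
    imaginary parts fix the entries at (a, b) and (b, a) as conjugates. *)
Lemma density_herm A : density A -> adj A = A.
Proof.
case=> h _; apply: op_ext => a b; rewrite /adj.
have hR (v : vec R T) : complex.Im (inner v (apply A v)) = 0.
  by have := h v; rewrite lecE /= => /andP[/eqP].
have dv (x y : T) (c : C) : inner (fun t => (t == x)%:R + c * (t == y)%:R)
    (apply A (fun t => (t == x)%:R + c * (t == y)%:R)) =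
    A x x + c * A x y + conjc c * A y x + conjc c * c * A y y.
  have ap t : apply A (fun t => (t == x)%:R + c * (t == y)%:R) t = A t x + c * A t y.
    rewrite /apply; under eq_bigr do rewrite mulrDr.
    rewrite big_split /= (bigD1 x) //= big1 ?addr0 => [|u ux]; last by rewrite (negPf ux) mulr0.
    rewrite eqxx mulr1 (bigD1 y) //= big1 ?addr0 => [|u uy]; last by rewrite (negPf uy) !mulr0.
    by rewrite eqxx mulr1 mulrC.
  transitivity (\sum_t ((t == x)%:R + conjc c * (t == y)%:R) * (A t x + c * A t y)).
    apply: eq_bigr => t _; rewrite ap; congr (_ * _); apply: (etrans (conjcD _ _)).
    by rewrite conjcM !conjc_nat.
  under eq_bigr do rewrite mulrDl.
  rewrite big_split /= (bigD1 x) //= big1 ?addr0 => [|u ux]; last by rewrite (negPf ux) mul0r.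
  rewrite eqxx mul1r (bigD1 y) //= big1 ?addr0 => [|u uy]; last by rewrite (negPf uy) mulr0 mul0r.
  by rewrite eqxx mulr1; ring.
have := hR (fun t => (t == a)%:R + 1 * (t == b)%:R).
have := hR (fun t => (t == a)%:R + 'i * (t == b)%:R).
have := hR (fun t => (t == a)%:R + 0 * (t == b)%:R).
have := hR (fun t => (t == b)%:R + 0 * (t == b)%:R).
rewrite !dv; case: (A a a) => aa aa'; case: (A b b) => bb bb'.
case: (A a b) => ab ab'; case: (A b a) => ba ba' /=.
by move=> h1 h2 h3 h4; congr (_ +i* _); nra.
Qed.

Lemma inner_rtr A (S : op R T) :
  rtr (adj S * A * S) = \sum_a complex.Re (inner (S^~ a) (apply A (S^~ a))).
Proof.
rewrite rtrE; apply: eq_bigr => a _; congr complex.Re; rewrite -mulrA mulE /inner.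
by apply: eq_bigr => b _; rewrite mulE.
Qed.

Lemma density_ge0 A : density A -> 0 ⪯ A.
Proof.
move=> [h _] S; rewrite mulr0 mul0r rtr0 inner_rtr; apply: sumr_ge0 => a _.
by have := h (S^~ a); rewrite lecE => /andP[].
Qed.

Lemma density_rtr A : density A -> rtr A = 1.
Proof. by case=> _ h; rewrite /rtr h. Qed.

Lemma density_eigval A : density A ->
  (forall s, 0 <= eigval A s) /\ \sum_s eigval A s = 1.
Proof.
move=> hA; have [hU e] := eigdecP (density_herm hA); split.
  by apply: (cdiag_ge0_inv hU); rewrite -e; exact: density_ge0.
by rewrite -(rtr_cdiag hU) -e density_rtr.
Qed.

(* The squared overlaps of two eigenbases form a doubly stochastic matrix that
   vanishes between different eigenvalues. *)
Lemma vN_entropyE A d : is_eigdec A d -> vN_entropy A = - \sum_t xlog2 (d.2 t).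
Proof.
move=> hd; have h0 : is_eigdec A (eigdec A) by apply: (epsilon_spec _ (is_eigdec A)); exists d.
have [hU eU] := (is_eigdecE _ _).1 hd; have [hV eV] := (is_eigdecE _ _).1 h0.
rewrite /vN_entropy /eigval; congr (- _).
move: hU eU hV eV; move: (eigdec A) d {hd h0} => [V r] [U q] /= hU eU hV eV.
pose W := adj V * U.
have WU : W * adj W = 1.
  rewrite /W adjM adjK !mulrA -(mulrA (adj V)).
  by have -> : U * adj U = 1 by []; rewrite mulr1 unitary_adjl.
have UW := mul1_op_comm WU.
have eW : W * diagop q = diagop r * W.
  have : adj V * (cdiag U q) * U = adj V * (cdiag V r) * U by rewrite -eU -eV.
  rewrite /cdiag !mulrA -(mulrA _ (adj U) U) unitary_adjl // mulr1.
  by rewrite (unitary_adjl hV) mul1r -mulrA.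
have ew s t : xlog2 (q t) * complex.Re (conjc (W s t) * W s t) =
   xlog2 (r s) * complex.Re (conjc (W s t) * W s t).
  have : (W * diagop q) s t = (diagop r * W) s t by rewrite eW.
  rewrite !mulE (bigD1 t) //= big1 => [|u ut]; last by rewrite /diagop (negPf ut) mul0r mulr0.
  rewrite (bigD1 s) //= big1 => [|u us]; last by rewrite /diagop eq_sym (negPf us) !mul0r.
  rewrite /diagop !eqxx !mul1r !addr0 mulrC.
  case: (eqVneq (q t) (r s)) => [-> //|qr] h.
  suff -> : W s t = 0 by rewrite mulr0 /= !mulr0.
  apply/eqP; have : ((q t)%:C - (r s)%:C) * W s t == 0 by rewrite mulrBl h subrr.
  by rewrite mulf_eq0 -rmorphB /= (inj_eq (@complexI R) _ 0) subr_eq0 (negPf qr).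
have c1 t : \sum_s complex.Re (conjc (W s t) * W s t) = 1.
  have : (adj W * W) t t = 1 by rewrite UW oneE eqxx.
  by rewrite mulE => /(congr1 (@complex.Re R)); rewrite raddf_sum.
have r1 s : \sum_t complex.Re (conjc (W s t) * W s t) = 1.
  have : (W * adj W) s s = 1 by rewrite WU oneE eqxx.
  rewrite mulE => /(congr1 (@complex.Re R)); rewrite raddf_sum => h; apply: etrans h.
  by apply: eq_bigr => t _; rewrite mulrC.
transitivity (\sum_s \sum_t xlog2 (r s) * complex.Re (conjc (W s t) * W s t)).
  by apply: eq_bigr => s _; rewrite -mulr_sumr r1 mulr1.
rewrite exchange_big /=; apply: eq_bigr => t _.
by under eq_bigr do rewrite -ew; rewrite -mulr_sumr c1 mulr1.
Qed.
End Spectral.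


(** * Orthogonal projectors and almost-intersections *)

Section Projection.
Variables (R : realType) (T : finType).
Local Notation C := (R[i]).
Implicit Types (A B P : op R T) (v : vec R T).

Lemma vec_ext (u v : vec R T) : (forall a, u a = v a) -> u = v.
Proof. by move=> h; apply: functional_extensionality_dep. Qed.
Lemma applyM A B v : apply (A * B) v = apply A (apply B v).
Proof.
apply: vec_ext => a; rewrite /apply; under [in RHS]eq_bigr do rewrite mulr_sumr.
rewrite [RHS]exchange_big; apply: eq_bigr => b _ /=.
by rewrite mulE mulr_suml; apply: eq_bigr => c _; rewrite mulrA.
Qed.
Lemma apply1 v : apply 1 v = v.
Proof.
apply: vec_ext => a; rewrite /apply (bigD1 a) //= big1 ?addr0 => [|b ba].
  by rewrite oneE eqxx mul1r.
by rewrite oneE eq_sym (negPf ba) mul0r.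
Qed.
Lemma apply_sum A (I : finType) (c : I -> C) (u : I -> vec R T) :
  apply A (fun a => \sum_i c i * u i a) = (fun a => \sum_i c i * apply A (u i) a).
Proof.
apply: vec_ext => a; rewrite /apply; under eq_bigr do rewrite mulr_sumr.
rewrite exchange_big; apply: eq_bigr => i _ /=.
by rewrite mulr_sumr; apply: eq_bigr => b _; rewrite mulrCA.
Qed.
Lemma innerE (u v : vec R T) : inner u v = \sum_a conjc (u a) * v a. Proof. by []. Qed.
Lemma inner_apply A (u v : vec R T) : inner u (apply A v) = inner (apply (adj A) u) v.
Proof.
rewrite !innerE /apply; under eq_bigr do rewrite mulr_sumr.
rewrite exchange_big; apply: eq_bigr => b _ /=.
rewrite conjc_sum mulr_suml; apply: eq_bigr => a _.
by rewrite conjcM /adj conjcK; ring.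
Qed.
Lemma innerBr (u v w : vec R T) : inner u (fun a => v a - w a) = inner u v - inner u w.
Proof. by rewrite /inner -sumrB; apply: eq_bigr => a _; rewrite mulrBr. Qed.
Lemma innerBl (u v w : vec R T) : inner (fun a => v a - w a) u = inner v u - inner w u.
Proof.
by rewrite !innerE -sumrB; apply: eq_bigr => a _; rewrite conjcB mulrBl.
Qed.
Lemma inner_eq0 (u : vec R T) : inner u u = 0 -> forall a, u a = 0.
Proof.
move=> /(congr1 (@complex.Re R)); rewrite innerE Re_sum.
under eq_bigr do rewrite Re_conjM.
move=> /eqP; rewrite psumr_eq0 => [/allP h a|a _]; last by rewrite addr_ge0 // sqr_ge0.
have := h a (mem_index_enum _).
rewrite /= paddr_eq0 ?sqr_ge0 // !sqrf_eq0 => /andP[/eqP h1 /eqP h2].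
by apply/eqP; rewrite eq_complex h1 h2 !eqxx.
Qed.
Lemma op_of_apply A B : (forall v, apply A v = apply B v) -> A = B.
Proof.
move=> h; apply: op_ext => a b.
have e D : apply D (fun t => (t == b)%:R) a = D a b.
  rewrite /apply (bigD1 b) //= big1 ?addr0 ?eqxx ?mulr1 // => c cb.
  by rewrite (negPf cb) mulr0.
by rewrite -!e h.
Qed.

Lemma is_orth_proj_uniq (V : vec R T -> Prop) P Q :
  is_orth_proj V P -> is_orth_proj V Q -> P = Q.
Proof.
move=> [p1 p2] [q1 q2]; apply: op_of_apply => v.
have e u : V u -> inner u (fun a => apply P v a - apply Q v a) = 0.
  move=> Vu; have := p2 v u Vu; have := q2 v u Vu; rewrite !innerBr.
  by move=> /eqP; rewrite subr_eq0 => /eqP ->; move=> /eqP; rewrite subr_eq0 => /eqP ->;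
    rewrite subrr.
have := inner_eq0 (u := fun a => apply P v a - apply Q v a).
rewrite innerBl !e ?subrr // => /(_ erefl) h.
by apply: vec_ext => a; apply/eqP; rewrite -subr_eq0 h.
Qed.

(** Uniqueness lets the chosen projector be replaced by any explicit witness, so existence is shown
    only for the subspaces that occur. *)
Lemma projE (V : vec R T -> Prop) P : is_orth_proj V P -> proj V = P.
Proof.
move=> h; apply: is_orth_proj_uniq (h).
by apply: (epsilon_spec _ (is_orth_proj V)); exists P.
Qed.

Lemma orth_proj_crit (V : vec R T -> Prop) P : projector P ->
  (forall v, V (apply P v)) -> (forall u, V u -> apply P u = u) -> is_orth_proj V P.
Proof.
case=> h1 h2 h3 h4; split=> // v u Vu.
by rewrite innerBr inner_apply h1 h4 // subrr.
Qed.

Lemma proj_range P : projector P -> proj (range P) = P.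
Proof.
move=> hP; apply/projE/orth_proj_crit => // [v|u [v ->]]; first by exists v.
by rewrite -applyM hP.2.
Qed.

Lemma span1 (V : vec R T -> Prop) v : V v -> Defs.span V v.
Proof.
move=> h; exists 1%N, (fun=> 1), (fun=> v); split=> //.
by apply: vec_ext => a; rewrite big_ord1 mul1r.
Qed.

Lemma span_finType (V : vec R T -> Prop) (I : finType) (c : I -> C) (u : I -> vec R T) :
  (forall i, V (u i)) -> Defs.span V (fun a => \sum_i c i * u i a).
Proof.
move=> h; exists #|I|, (fun i => c (enum_val i)), (fun i => u (enum_val i)); split=> [i|];
  first exact: h.
apply: vec_ext => a; rewrite (reindex (@enum_val I predT)) //=.
by exists enum_rank => k _; [exact: enum_valK | exact: enum_rankK].
Qed.

Section Ceps.
Variables (eps : R) (PA PB : op R T).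
Hypotheses (hA : projector PA) (hB : projector PB).
Let th : R := Num.sqrt eps.
Hypotheses (th0 : 0 < th) (th1 : th < 1).

Let M := PA * PB * PA.
Let U := eigbasis M.
Let mu := eigval M.
Let good s := 1 - th <= mu s.
(* [G] projects onto the subspace [A] of the construction; [D] inverts [M] there,
   which makes [P] idempotent. *)
Let G := cdiag U (fun s => (good s)%:R).
Let D := cdiag U (fun s => (good s)%:R * (mu s)^-1).
Let P := PB * D * PB.

Let hM : adj M = M.
Proof. by rewrite /M !adjM hA.1 hB.1 mulrA. Qed.
Let hU : unitary U. Proof. by case: (eigdecP hM). Qed.
Let eM : M = cdiag U mu. Proof. by case: (eigdecP hM). Qed.
Let mu_neq0 s : good s -> mu s != 0.
Proof. by rewrite /good => h; apply: lt0r_neq0; move: th1; lra. Qed.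
Let DM : D * M = G.
Proof.
rewrite eM cdiagM //; congr cdiag; apply/funext => s.
by have := @mu_neq0 s; case: (good s) => h; rewrite ?mul0r // mul1r mulVf // h.
Qed.
Let MD : M * D = G.
Proof. by rewrite -DM eM !cdiagM //; congr cdiag; apply/funext => s; rewrite mulrC. Qed.
Let DG : D * G = D.
Proof. by rewrite cdiagM //; congr cdiag; apply/funext => s; case: (good s);
  rewrite ?mulr1 // !mul0r. Qed.
Let GD : G * D = D.
Proof. by rewrite cdiagM //; congr cdiag; apply/funext => s; case: (good s);
  rewrite ?mul1r // !mul0r. Qed.
Let hG : projector G. Proof. exact: cdiag_projector. Qed.
Let PAM : PA * M = M. Proof. by rewrite /M !mulrA hA.2. Qed.
Let PAG : PA * G = G. Proof. by rewrite -MD mulrA PAM. Qed.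
Let GPA : G * PA = G.
Proof. by rewrite -[LHS]adjK adjM hA.1 hG.1 PAG hG.1. Qed.
Let PAD : PA * D = D. Proof. by rewrite -GD mulrA PAG. Qed.
Let DPA : D * PA = D. Proof. by rewrite -DG -mulrA GPA. Qed.
(** [D] lives under [PA], so between two copies of [D] the factor [PB] may be replaced by [M], and
    [D * M = G] acts as the identity on [D]. *)
Let DPBD : D * PB * D = D.
Proof.
have -> : D * PB * D = (D * PA) * PB * (PA * D) by rewrite DPA PAD.
by rewrite -[RHS]GD -DM /M !mulrA.
Qed.

Let hP : projector P.
Proof.
split; first by rewrite /P 2!adjM hB.1 cdiag_adj mulrA.
have -> : P * P = PB * (D * (PB * PB) * D) * PB by rewrite /P !mulrA.
by rewrite hB.2 DPBD.
Qed.
Let PPBG : P * (PB * G) = PB * G.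
Proof.
have -> : P * (PB * G) = PB * (D * (PB * PB) * G) by rewrite /P !mulrA.
have -> : D * (PB * PB) * G = (D * PA) * PB * (PA * G) by rewrite hB.2 DPA PAG.
have -> : (D * PA) * PB * (PA * G) = D * M * G by rewrite /M !mulrA.
by rewrite DM hG.2.
Qed.

(** In eigenbasis coordinates [(mu s - lam) * f s = 0]. If [s] is not good then [mu s] differs from
    [lam], so [f s] vanishes and [G] leaves [e] alone. *)
Let G_eigvec (e : vec R T) (lam : C) : (1 - th)%:C <= lam ->
  apply M e = (fun a => lam * e a) -> apply G e = e.
Proof.
move=> hl he; pose f := apply (adj U) e.
have hf : apply (diagop (fun s => (good s)%:R)) f = f.
  apply: vec_ext => s; rewrite /apply (bigD1 s) //= big1 ?addr0 => [|t ts]; last first.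
    by rewrite /diagop eq_sym (negPf ts) !mul0r.
  rewrite /diagop eqxx mul1r; case gs : (good s); first by rewrite mul1r.
  rewrite mul0r; apply/esym/eqP.
  have : apply (diagop mu) f s = lam * f s.
    rewrite /f -applyM; have -> : diagop mu * adj U = adj U * M.
      by rewrite eM /cdiag !mulrA unitary_adjl // mul1r.
    rewrite applyM he /apply mulr_sumr; apply: eq_bigr => t _; by rewrite mulrCA.
  rewrite /apply (bigD1 s) //= big1 ?addr0 => [|t ts]; last first.
    by rewrite /diagop eq_sym (negPf ts) !mul0r.
  rewrite /diagop eqxx mul1r => /eqP; rewrite -subr_eq0 -mulrBl mulf_eq0 => /orP[|//].
  rewrite subr_eq0 => /eqP ee; move: hl; rewrite -ee lecR => h.
  by rewrite /good h in gs.
by rewrite /G /cdiag applyM applyM hf /f -applyM (_ : U * adj U = 1) ?apply1.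
Qed.

(** Two facts suffice: [P v] is [PB] applied to [D * PB] of [v], a vector in the range of [G], and
    by [PPBG] the operator [P] fixes [PB v] whenever [G] fixes [v]. *)
Lemma CepsE : Ceps eps (range PA) (range PB) = P.
Proof.
rewrite /Ceps !proj_range // !mulopE mulrA -/M; apply/projE/orth_proj_crit => // [v|u].
  apply: span1; exists (apply (D * PB) v); split; last by rewrite -applyM mulrA.
  pose W := U * diagop (fun s => (good s)%:R);
    pose w := apply (diagop (fun s => (mu s)^-1) * adj U * PB) v.
  have -> : apply (D * PB) v = (fun a => \sum_s w s * W a s).
    have -> : D = W * (diagop (fun s => (mu s)^-1) * adj U).
      by rewrite /W /D /cdiag -diagopM !mulrA.
    rewrite -mulrA applyM -/w; apply: vec_ext => a; rewrite /apply.
    by apply: eq_bigr => s _; rewrite mulrC.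
  (* The columns of [W] at bad indices are zero, hence eigenvectors for any value; 1 is taken
     because it exceeds the threshold [1 - th]. *)
  apply: span_finType => s; pose lam s := if good s then mu s else 1.
  have hW : M * W = W * diagop lam.
    rewrite eM /cdiag /W !mulrA -(mulrA _ (adj U) U) unitary_adjl // mulr1 -!(mulrA U) !diagopM.
    congr (_ * diagop _); apply/funext => t; rewrite /lam; case: (good t); first by rewrite mulrC.
    by rewrite mulr0 mul0r.
  exists (lam s)%:C; split.
    apply: vec_ext => a; have : (M * W) a s = (W * diagop lam) a s by rewrite hW.
    rewrite !mulE /apply => ->; rewrite (bigD1 s) //= big1 ?addr0 => [|t ts].
      by rewrite /diagop eqxx mul1r mulrC.
    by rewrite /diagop (negPf ts) mul0r mulr0.
  rewrite lecR /lam -/th; case gs: (good s); [exact: gs | by move: th0; lra].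
case=> k [c [w [hw ->]]]; rewrite apply_sum; apply: vec_ext => a.
apply: eq_bigr => i _; congr (_ * _); have [x [hx ->]] := hw i.
suff -> : x = apply G x by rewrite -(applyM PB) -(applyM P) PPBG.
case: hx => l [d [y [hy ->]]]; rewrite apply_sum; apply: vec_ext => b.
apply: eq_bigr => j _; congr (_ * _); have [lam [h1 h2]] := hy j.
by rewrite (G_eigvec h2 h1).
Qed.

Lemma Ceps_projector : projector (Ceps eps (range PA) (range PB)).
Proof. by rewrite CepsE. Qed.

(** The eigenvalues of [D] are zero or at most [(1 - th)^-1], and [G] lies below [PA]; conjugating
    the resulting bound on [D] by [PB] gives the claim. *)
Lemma Ceps_le : Ceps eps (range PA) (range PB) ⪯ (1 - th)^-1 *: (PB * PA * PB).
Proof.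
have hD : D ⪯ (1 - th)^-1 *: PA.
  apply: (lea_trans (B := (1 - th)^-1 *: G)).
    rewrite cdiagZ; apply: cdiag_le => s; case gs: (good s); rewrite ?mul0r ?mulr0 // mul1r mulr1.
    have gs1 : 1 - th <= mu s by exact: gs.
    by rewrite lef_pV2 ?posrE //; move: gs1 th1; lra.
  apply: leaZ; first by rewrite invr_ge0; move: th1; lra.
  apply/lea_subP; have <- : adj (PA - G) * (PA - G) = PA - G; last exact: lea0_sqr.
  by rewrite adjB hA.1 hG.1 mulrBr !mulrBl hA.2 hG.2 PAG GPA subrr subr0.
have := lea_conj PB hD; rewrite hB.1 -op_scalerAr -op_scalerAl.
by rewrite CepsE.
Qed.

(* The part of [PA] cut off by the spectral truncation at [1 - th] has
   [1 - M >= th], so Markov's inequality bounds its weight by that of [1 - PB]. *)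
Lemma Ceps_deficit S : nrm2 ((1 - Ceps eps (range PA) (range PB)) * S) <=
  3 * (1 + 2 / th) * (nrm2 ((1 - PA) * S) + nrm2 ((1 - PB) * S)).
Proof.
rewrite CepsE; set a := nrm2 ((1 - PA) * S); set b := nrm2 ((1 - PB) * S).
have hPB1 := projector_compl hB; have hP1 := projector_compl hP; have hG1 := projector_compl hG.
(* The three terms sum to [S - PB * G * S], and [1 - P] annihilates [PB * G]. *)
have e1 : (1 - P) * S = (1 - P) * ((1 - PB) * S + PB * ((1 - PA) * S) + PB * ((PA - G) * S)).
  have -> : (1 - PB) * S + PB * ((1 - PA) * S) + PB * ((PA - G) * S) = S - PB * G * S.
    by rewrite !(mulrBl, mulrBr, mul1r) !mulrA !addrA !subrK.
  have z : (1 - P) * (PB * G * S) = 0 by rewrite mulrBl mul1r (mulrA P) PPBG subrr.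
  by rewrite mulrBr z subr0.
have h1 : nrm2 ((1 - P) * S) <= 3 * b + 3 * a + 3 * nrm2 ((PA - G) * S).
  rewrite e1; apply: le_trans (nrm2_proj_le _ hP1) _; apply: le_trans (nrm2D3_le _ _ _) _.
  have := nrm2_proj_le ((1 - PA) * S) hB; have := nrm2_proj_le ((PA - G) * S) hB.
  by rewrite -/a -/b; lra.
have h2 : nrm2 ((1 - PB) * (PA * S)) <= 2 * a + 2 * b.
  have -> : (1 - PB) * (PA * S) = (1 - PB) * S - (1 - PB) * ((1 - PA) * S).
    by rewrite -mulrBr; congr (_ * _); rewrite mulrBl mul1r subKr.
  apply: le_trans (nrm2D_le _ _) _; rewrite nrm2N.
  by have := nrm2_proj_le ((1 - PA) * S) hPB1; rewrite -/a -/b; lra.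
have h3 : th * nrm2 ((PA - G) * S) <= nrm2 ((1 - PB) * (PA * S)).
  have -> : (PA - G) * S = (1 - G) * (PA * S) by rewrite mulrA; congr (_ * S);
    rewrite mulrBl GPA mul1r.
  have c1 : th *: (1 - G) ⪯ (1 - G) * (1 - M) * (1 - G).
    have e : 1 - G = cdiag U (fun s => (~~ good s)%:R).
      rewrite -(cdiag1 hU) /G -scaleN1r cdiagZ cdiagD; congr cdiag; apply/funext => s.
      by case: (good s); rewrite ?mulr0 ?addr0 // mulr1 subrr.
    have e2 : 1 - M = cdiag U (fun s => 1 - mu s).
      rewrite eM -[in LHS](cdiag1 hU) -[X in _ + X]scaleN1r cdiagZ cdiagD.
      by congr cdiag; apply/funext => s; rewrite mulN1r.
    rewrite e2 e cdiagZ !cdiagM //; apply: cdiag_le => s.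
    case gs: (good s); rewrite ?mulr0 ?mul0r // !mulr1 mul1r.
    have gs1 : mu s < 1 - th by rewrite ltNge; exact: negbT gs.
    by move: gs1; lra.
  (* [G] commutes with [M], so the left side is [(1 - M) * (1 - G)]; the missing part [(1 - M) * G]
     is positive, being the square of [(1 - PB) * G]. *)
  have c2 : (1 - G) * (1 - M) * (1 - G) ⪯ 1 - M.
    have GM : G * M = M * G by rewrite -{1}MD -mulrA DM.
    have GMG : G * PB * G = M * G.
      have -> : G * PB * G = (G * PA) * PB * (PA * G) by rewrite GPA PAG.
      have -> : M * G = M * (G * G) by rewrite hG.2.
      by rewrite (mulrA M) -GM /M !mulrA.
    have -> : (1 - G) * (1 - M) * (1 - G) = (1 - M) * (1 - G).
      have -> : (1 - G) * (1 - M) = (1 - M) * (1 - G).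
        by rewrite !mulrBr !mulrBl !mulr1 !mul1r GM !opprB !addrA [LHS]addrAC [RHS]addrAC (addrAC
          1).
      by rewrite -mulrA hG1.2.
    have e : adj ((1 - PB) * G) * ((1 - PB) * G) = (1 - M) * G.
      rewrite adjM hPB1.1 hG.1 mulrA -(mulrA G) hPB1.2 mulrBr mulr1 mulrBl hG.2 GMG.
      by rewrite mulrBl mul1r.
    apply/lea_subP; rewrite [X in _ - X]mulrBr mulr1 subKr -e.
    exact: lea0_sqr.
  have := lea_trans c1 c2 (PA * S).
  rewrite -op_scalerAr -op_scalerAl rtrZ -(nrm2_proj (PA * S) hG1) (nrm2_proj _ hPB1) =>
    /le_trans -> //.
  have e X : adj (PA * S) * X * (PA * S) = adj S * (PA * X * PA) * S by rewrite adjM hA.1 !mulrA.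
  by rewrite !e !mulrBr !mulr1 !mulrBl hA.2 PAM /M -!mulrA hA.2.
have h4 : nrm2 ((PA - G) * S) <= (2 * a + 2 * b) / th.
  by rewrite ler_pdivlMr // mulrC; apply: le_trans h3 h2.
apply: le_trans h1 _; rewrite -subr_ge0.
have -> : 3 * (1 + 2 / th) * (a + b) - (3 * b + 3 * a + 3 * nrm2 ((PA - G) * S)) =
   3 * ((2 * a + 2 * b) / th - nrm2 ((PA - G) * S)) by ring.
by rewrite mulr_ge0 // subr_ge0.
Qed.
End Ceps.
End Projection.


(** * Sequential measurements *)

Section Sequential.
Variables (R : realType) (T : finType).
Implicit Types (S A K P : op R T) (l : seq (op R T * bool)).

Definition fails (K : op R T) (l : seq (op R T * bool)) : op R T :=
  foldl (fun K p => (1 - p.1) * K) K l.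

Lemma fails_le l A : (forall p, p \in l -> projector p.1) -> nrm2 (fails 1 l * A) <= nrm2 A.
Proof.
elim/last_ind: l => [|l p IH] h; first by rewrite mul1r.
rewrite /fails foldl_rcons -/(fails _ _) -mulrA.
apply: le_trans (nrm2_proj_le _ (projector_compl _)) (IH _); first by apply: h;
  rewrite mem_rcons inE eqxx.
by move=> q ql; apply: h; rewrite mem_rcons inE ql orbT.
Qed.

(* [A - P * B = (1 - P) * A + P * (A - B)] is an orthogonal decomposition, so
   the squared errors of successive projections add up. *)
Lemma nrm2_proj_step P A B : projector P ->
  nrm2 (A - P * B) <= nrm2 ((1 - P) * A) + nrm2 (A - B).
Proof.
move=> hP; rewrite (nrm2_proj_split (A - P * B) hP) addrC lerD //.
  have z : (1 - P) * (P * B) = 0 by rewrite mulrA mulrBl mul1r hP.2 subrr mul0r.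
  by rewrite mulrBr z subr0.
by rewrite mulrBr mulrA hP.2 -mulrBr nrm2_proj_le.
Qed.

(** Induction peels off the last measurement, the outermost factor, to which [nrm2_proj_step]
    applies with the projector [1 - p.1]. *)
Lemma fails_union l A : (forall p, p \in l -> projector p.1) ->
  nrm2 (A - fails 1 l * A) <= \sum_(p <- l) nrm2 (p.1 * A).
Proof.
elim/last_ind: l => [|l p IH] h; first by rewrite mul1r subrr nrm20 big_nil.
rewrite /fails foldl_rcons -/(fails _ _) -mulrA big_rcons /= addrC.
apply: le_trans (nrm2_proj_step _ _ (projector_compl _)) _; first by apply: h;
  rewrite mem_rcons inE eqxx.
by rewrite subKr lerD // IH // => q ql; apply: h; rewrite mem_rcons inE ql orbT.
Qed.

Lemma seq_success_cat rho K l1 l2 :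
  seq_success rho K (l1 ++ l2) = seq_success rho K l1 + seq_success rho (fails K l1) l2.
Proof.
elim: l1 K => [|[P g] l1 IH] K /=; first by rewrite add0r.
by rewrite IH addrA.
Qed.

Lemma Re_success_term S P K :
  complex.Re (trace (mulop (mulop P K) (mulop (S * adj S) (adj (mulop P K))))) = nrm2 (P * K * S).
Proof. by rewrite -/(rtr _) !mulopE /nrm2 [RHS]rtrC !adjM !mulrA. Qed.

Lemma seq_success_ge0 S K l : 0 <= complex.Re (seq_success (S * adj S) K l).
Proof.
elim: l K => [|[P g] l IH] K //=; rewrite ReD addr_ge0 ?IH //.
by case: g => //=; rewrite Re_success_term nrm2_ge0.
Qed.

(** Only one flagged success is kept. Others, such as the right pair found with a wrong third
    message, are nonnegative and may be dropped. *)
Lemma seq_success_ge S l1 P l2 :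
  nrm2 (P * (fails 1 l1) * S) <=
  complex.Re (seq_success (S * adj S) (@idop R T) (l1 ++ (P, true) :: l2)).
Proof.
rewrite seq_success_cat ReD /= ReD. rewrite Re_success_term.
by have := seq_success_ge0 S 1 l1; have := seq_success_ge0 S (subop (@idop R T) P * fails 1 l1)
  l2; lra.
Qed.

(** [S'] is a smoothed square root on which only the wrong projectors are evaluated. Passing from
    [S] to [S'] costs 6 times their squared distance and a factor 3 on the error of [S']; moving the
    deficit of [P k0] back to [S] doubles it and adds 3 * 2 more distances, whence 12, 6 and 3. *)
Lemma seq_error_le (I : eqType) (ks : seq I) (k0 : I) (P : I -> op R T) (g : I -> bool)
    S S' (t : R) : uniq ks -> k0 \in ks -> g k0 -> (forall k, projector (P k)) ->
  nrm2 S = 1 -> 0 < t ->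
  seq_error (S * adj S) [seq (P k, g k) | k <- ks] <=
    t + t^-1 * (12 * nrm2 (S - S') + 6 * nrm2 ((1 - P k0) * S) +
                3 * \sum_(k <- ks | k != k0) nrm2 (P k * S')).
Proof.
move=> uks k0ks gk0 hP S1 t0; case/splitPr: k0ks uks => l1 l2 uks.
have k0l1 : k0 \notin l1 by move: uks; rewrite cat_uniq /= negb_or => /and3P[_ /andP[]].
have hl1 p : p \in [seq (P k, g k) | k <- l1] -> projector p.1.
  by case/mapP => k _ ->; exact: hP.
set F := fails 1 [seq (P k, g k) | k <- l1]; set d := nrm2 (S - S').
have hS : nrm2 (S' - P k0 * (F * S')) <= nrm2 ((1 - P k0) * S') + \sum_(k <- l1) nrm2 (P k * S').
  apply: le_trans (nrm2_proj_step _ _ (hP k0)) _; rewrite lerD //.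
  by apply: le_trans (fails_union _ hl1) _; rewrite big_map.
(* Adding the measurements that come after [k0] makes the bound independent of the position of
   [k0]. *)
have hsum : \sum_(k <- l1) nrm2 (P k * S') <= \sum_(k <- l1 ++ k0 :: l2 | k != k0) nrm2 (P k * S').
  rewrite big_cat /= (eq_big_seq (fun k => nrm2 (P k * S'))) //.
  rewrite [X in X + _ >= _]big_mkcond /=.
  rewrite (eq_big_seq (fun k => if k != k0 then nrm2 (P k * S') else 0)); last first.
    by move=> k kl; case: eqP => // kk; rewrite kk (negPf k0l1) in kl.
  by rewrite lerDl sumr_ge0 // => k _; exact: nrm2_ge0.
have hd : nrm2 ((1 - P k0) * S') <= 2 * nrm2 ((1 - P k0) * S) + 2 * d.
  have -> : (1 - P k0) * S' = (1 - P k0) * S - (1 - P k0) * (S - S') by rewrite -mulrBr subKr.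
  apply: le_trans (nrm2D_le _ _) _; rewrite nrm2N.
  by have := nrm2_proj_le (S - S') (projector_compl (hP k0)); rewrite -/d; lra.
have hK A : nrm2 (P k0 * (F * A)) <= nrm2 A.
  by apply: le_trans (nrm2_proj_le _ (hP k0)) _; exact: fails_le.
have hD : nrm2 (S - P k0 * (F * S)) <= 6 * d + 3 * nrm2 (S' - P k0 * (F * S')).
  have -> : S - P k0 * (F * S) = (S - S') + (S' - P k0 * (F * S')) + P k0 * (F * (S' - S)).
    by rewrite !mulrBr !addrA !subrK.
  apply: le_trans (nrm2D3_le _ _ _) _; have := hK (S' - S); rewrite -(opprB S S') nrm2N -/d.
  by lra.
have hge := seq_success_ge S [seq (P k, g k) | k <- l1] (P k0) [seq (P k, g k) | k <- l2].
rewrite /seq_error map_cat /= gk0.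
have h1 := nrm2B_ge S (S - P k0 * (F * S)) t0.
rewrite subKr S1 in h1; rewrite -mulrA -/F in hge.
have h2 : t^-1 * nrm2 (S - P k0 * (F * S)) <=
  t^-1 * (12 * d + 6 * nrm2 ((1 - P k0) * S) +
      3 * \sum_(k <- l1 ++ k0 :: l2 | k != k0) nrm2 (P k * S')).
  rewrite ler_wpM2l //; first by rewrite invr_ge0 ltW.
  by move: hD hS hsum hd; lra.
by move: hge h1 h2; rewrite mulr1; lra.
Qed.
End Sequential.


(** * Typicality *)

Section ProductMeasure.
Variables (R : realType).

Lemma prod_distr_sum1 (I T : finType) (p : I -> T -> R) :
  (forall i, \sum_t p i t = 1) -> \sum_(f : {ffun I -> T}) \prod_i p i (f i) = 1.
Proof. by move=> h; rewrite -bigA_distr_bigA big1. Qed.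

Lemma sum_indic (T : finType) (G : T -> R) (t : T) : G t = \sum_s (t == s)%:R * G s.
Proof.
rewrite (bigD1 t) //= eqxx mul1r big1 ?addr0 // => s st.
by rewrite eq_sym (negPf st) mul0r.
Qed.

Lemma prod_distr_marg1 (I T : finType) (p : I -> T -> R) (i0 : I) (G : T -> R) :
  (forall i, \sum_t p i t = 1) ->
  \sum_(f : {ffun I -> T}) (\prod_i p i (f i)) * G (f i0) = \sum_t p i0 t * G t.
Proof.
move=> h; pose F i t := p i t * (if i == i0 then G t else 1).
transitivity (\prod_i \sum_t F i t).
  rewrite bigA_distr_bigA; apply: eq_bigr => f _; rewrite /F big_split /=.
  by congr (_ * _); rewrite -big_mkcond /= big_pred1_eq.
rewrite (bigD1 i0) //= [X in _ * X]big1 ?mulr1 => [|i /negPf ii0].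
  by apply: eq_bigr => t _; rewrite /F eqxx.
by rewrite -[RHS](h i); apply: eq_bigr => t _; rewrite /F ii0 mulr1.
Qed.

(** An indicator pins the value of [f i0] to [t]; for fixed [t] the integrand then factors over the
    coordinates. *)
Lemma prod_distr_marg2 (I T : finType) (p : I -> T -> R) (i0 i1 : I) (G : T -> T -> R) :
  (forall i, \sum_t p i t = 1) -> i0 != i1 ->
  \sum_(f : {ffun I -> T}) (\prod_i p i (f i)) * G (f i0) (f i1) =
  \sum_t \sum_u p i0 t * p i1 u * G t u.
Proof.
move=> h i01.
pose F t i u := p i u * (if i == i0 then (u == t)%:R else if i == i1 then G t u else 1).
transitivity (\sum_t \prod_i \sum_u F t i u).
  rewrite [RHS](eq_bigr (fun t => \sum_(f : {ffun I -> T}) \prod_i F t i (f i))); last first.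
    by move=> t _; rewrite bigA_distr_bigA.
  rewrite [RHS]exchange_big; apply: eq_bigr => f _ /=.
  rewrite [in LHS](sum_indic (fun t => G t (f i1)) (f i0)) mulr_sumr; apply: eq_bigr => t _.
  rewrite /F big_split /=; congr (_ * _).
  have i10 : i1 != i0 by rewrite eq_sym.
  rewrite (bigD1 i0) //= eqxx (bigD1 i1) //= (negPf i10) eqxx.
  rewrite big1 ?mulr1 // => i /andP[/negPf h0 /negPf h1]; by rewrite h0 h1.
apply: eq_bigr => t _; rewrite (bigD1 i0) //= (bigD1 i1) 1?eq_sym //=.
rewrite [X in _ * (_ * X)]big1 ?mulr1 => [|i /andP[/negPf h0 /negPf h1]]; last first.
  by rewrite -[RHS](h i); apply: eq_bigr => u _; rewrite /F h0 h1 mulr1.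
have -> : \sum_u F t i0 u = p i0 t.
  rewrite /F (bigD1 t) //= !eqxx mulr1 big1 ?addr0 // => u /negPf ut.
  by rewrite ut mulr0.
rewrite mulr_sumr; apply: eq_bigr => u _.
by rewrite /F [i1 == i0]eq_sym (negPf i01) eqxx mulrA.
Qed.

Definition ffun_pair (I U V : finType) (u : {ffun I -> U}) (v : {ffun I -> V}) :
  {ffun I -> U * V} := [ffun i => (u i, v i)].

Lemma ffun_pairE (I U V : finType) (u : {ffun I -> U}) (v : {ffun I -> V}) :
  (fun i => (u i, v i)) = ffun_pair u v.
Proof. by apply/funext => i; rewrite ffunE. Qed.

Lemma sum_ffun_pair (M : nmodType) (I U V : finType) (G : {ffun I -> U * V} -> M) :
  \sum_w G w = \sum_u \sum_v G (ffun_pair u v).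
Proof.
rewrite pair_big /= (reindex (fun p : {ffun I -> U} * {ffun I -> V} => ffun_pair p.1 p.2)) //=.
exists (fun w : {ffun I -> U * V} => ([ffun i => (w i).1], [ffun i => (w i).2])) => [[u v] _|w _]
  /=.
  by congr pair; apply/ffunP => i; rewrite !ffunE.
by apply/ffunP => i; rewrite !ffunE; case: (w i).
Qed.

End ProductMeasure.

(** * Weak law of large numbers for letter counts *)

Section LLN.
Variables (R : realType) (W : finType) (p : W -> R).
Hypothesis (hp : distr p).

Lemma distr_le1 (a : W) : p a <= 1.
Proof. by rewrite -hp.2 (bigD1 a) //= lerDl sumr_ge0 // => b _; exact: hp.1. Qed.

Lemma NcountE n (w : 'I_n -> W) a : (Ncount w a)%:R = \sum_i (w i == a)%:R :> R.
Proof.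
rewrite /Ncount -sum1_card natr_sum big_mkcond /=.
by apply: eq_bigr => i _; rewrite inE; case: (w i == a).
Qed.

(** Zero mean and independence kill the mixed terms, and each of the n diagonal terms is at most
    1. *)
Lemma variance_iid n (g : W -> R) : \sum_a p a * g a = 0 -> (forall a, `|g a| <= 1) ->
  \sum_(w : {ffun 'I_n -> W}) (\prod_i p (w i)) * (\sum_i g (w i)) ^+ 2 <= n%:R.
Proof.
move=> g0 g1; have sp i : \sum_t (fun _ : 'I_n => p) i t = 1 by exact: hp.2.
rewrite (eq_bigr (fun w : {ffun 'I_n -> W} =>
   \sum_i \sum_j (\prod_k p (w k)) * (g (w i) * g (w j)))); last first.
  move=> w _; rewrite expr2 mulr_suml mulr_sumr; apply: eq_bigr => i _.
  by rewrite !mulr_sumr; apply: eq_bigr => j _.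
rewrite exchange_big /=.
rewrite (_ : n%:R = \sum_(i < n) (1 : R)); last by rewrite sumr_const card_ord.
apply: ler_sum => i _; rewrite exchange_big (bigD1 i) //= [X in _ + X]big1 => [|j ji].
  rewrite addr0 (prod_distr_marg1 i (fun t => g t * g t) sp) -[leRHS]hp.2.
  apply: ler_sum => a _; rewrite ler_piMr ?hp.1 // -expr2 -real_normK ?num_real //.
  by rewrite expr_le1.
rewrite (prod_distr_marg2 (fun t u => g t * g u) sp (i0 := i) (i1 := j)) 1?eq_sym //.
rewrite big1 // => t _; rewrite (eq_bigr (fun u => p t * g t * (p u * g u))); last by move=> u _;
  ring.
by rewrite -mulr_sumr g0 mulr0.
Qed.

Lemma typical_LLN (delta : R) : 0 < delta -> exists2 C : R, 0 <= C &
  forall n, (0 < n)%N ->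
  \sum_(w : {ffun 'I_n -> W}) (\prod_i p (w i)) * (~~ typical p w delta)%:R <= C / n%:R.
Proof.
(* Chebyshev gives [n / (delta * p a * n)^2]. A letter of probability zero must not occur at all,
   which fails with probability zero, so it contributes the constant 0. *)
move=> d0; pose Ca a := if p a == 0 then 0 else (delta * p a) ^- 2.
exists (\sum_a Ca a) => [|n n0].
  apply: sumr_ge0 => a _; rewrite /Ca; case: eqP => // _.
  by rewrite invr_ge0 exprn_ge0 // mulr_ge0 ?hp.1 ?ltW.
have nR : 0 < n%:R :> R by rewrite ltr0n.
have sp (i : 'I_n) : \sum_t (fun _ : 'I_n => p) i t = 1 by exact: hp.2.
pose bad a (w : {ffun 'I_n -> W}) := ~~ (`|(Ncount w a)%:R / n%:R - p a| <= delta * p a).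
apply: (@le_trans _ _ (\sum_a \sum_(w : {ffun 'I_n -> W}) (\prod_i p (w i)) * (bad a w)%:R)).
  rewrite exchange_big; apply: ler_sum => w _ /=; rewrite -mulr_sumr ler_wpM2l //.
    by apply: prodr_ge0 => i _; exact: hp.1.
  case ht: (typical p w delta) => /=; first by apply: sumr_ge0.
  move/negbT: ht; rewrite /typical negb_forall => /existsP[a ha].
  by rewrite (bigD1 a) //= /bad ha lerDl sumr_ge0.
rewrite mulr_suml; apply: ler_sum => a _; rewrite /Ca; case: eqP => [pa0|/eqP pa0].
  rewrite mul0r; apply: (@le_trans _ _ (\sum_(w : {ffun 'I_n -> W}) (\prod_i p (w i)) * (Ncount w
    a)%:R)).
    apply: ler_sum => w _; rewrite ler_wpM2l //; first by apply: prodr_ge0 => i _; exact: hp.1.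
    rewrite /bad pa0 mulr0 subr0 ler_nat; case: (Ncount w a) => [|k];
      first by rewrite mul0r normr0 lexx.
    by case: (_ <= _).
  rewrite (eq_bigr (fun w : {ffun 'I_n -> W} => \sum_i (\prod_k p (w k)) * (w i == a)%:R));
    last first.
    by move=> w _; rewrite NcountE mulr_sumr.
  rewrite exchange_big big1 //= => i _.
  rewrite (prod_distr_marg1 i (fun t => (t == a)%:R) sp) big1 // => t _.
  by case: eqP => [->|_]; rewrite ?pa0 ?mul0r ?mulr0.
have pa : 0 < p a by rewrite lt_def pa0 hp.1.
pose g t : R := (t == a)%:R - p a.
have g0 : \sum_t p t * g t = 0.
  rewrite /g (eq_bigr (fun t => p t * (t == a)%:R - p t * p a)) => [|t _]; last by rewrite mulrBr.
  rewrite sumrB -mulr_suml hp.2 mul1r (bigD1 a) //= eqxx mulr1 big1 ?addr0 ?subrr // => t /negPf ta.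
  by rewrite ta mulr0.
have g1 t : `|g t| <= 1.
  have h1 := distr_le1 a; have h0 := ltW pa.
  rewrite ler_norml /g; clear sp.
  by case: (t == a); rewrite /= ?mulr1n ?mulr0n; move: h0 h1; clear; set q := p a;
    move: q => q *; apply/andP; split; lra.
apply: (@le_trans _ _ ((delta * p a * n%:R) ^- 2 *
   (\sum_(w : {ffun 'I_n -> W}) (\prod_i p (w i)) * (\sum_i g (w i)) ^+ 2))).
  rewrite mulr_sumr; apply: ler_sum => w _; rewrite mulrCA ler_wpM2l //.
    by apply: prodr_ge0 => i _; exact: hp.1.
  have c0 : 0 < delta * p a * n%:R by rewrite !mulr_gt0.
  rewrite /bad; case: (lerP `|_ - p a| (delta * p a)) => /= h; rewrite ?mulr0n ?mulr1n;
    first by rewrite mulr_ge0 ?sqr_ge0 // invr_ge0 exprn_ge0 // ltW.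
  rewrite mulrC ler_pdivlMr ?exprn_gt0 // mul1r -[leRHS]real_normK ?num_real //.
  rewrite ler_sqr ?nnegrE ?normr_ge0 ?(ltW c0) //.
  have -> : \sum_i g (w i) = ((Ncount w a)%:R / n%:R - p a) * n%:R.
    rewrite /g sumrB -NcountE sumr_const card_ord mulrBl mulfVK ?gt_eqF //.
    by rewrite mulr_natr.
  by rewrite normrM (ger0_norm (ltW nR)) ler_wpM2r ?(ltW nR) // ltW.
apply: (@le_trans _ _ ((delta * p a * n%:R) ^- 2 * n%:R)).
  by rewrite ler_wpM2l ?variance_iid // invr_ge0 exprn_ge0 // !mulr_ge0 ?ltW.
rewrite le_eqVlt; apply/orP; left; apply/eqP; field.
by rewrite !gt_eqF.
Qed.
End LLN.


(** * Tensor products of one-letter operators *)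

Section Tensor.
Variables (R : realType) (B : finType) (n : nat).
Local Notation C := (R[i]).

Definition tens (A : 'I_n -> op R B) : op R (wseq n B) :=
  fun a b => \prod_i A i (a i) (b i).

Lemma tensM (A A' : 'I_n -> op R B) : tens A * tens A' = tens (fun i => A i * A' i).
Proof.
apply: op_ext => a b; rewrite mulE /tens.
rewrite [RHS](eq_bigr (fun i => \sum_c A i (a i) c * A' i c (b i))) => [|i _]; last by rewrite mulE.
by rewrite bigA_distr_bigA; apply: eq_bigr => c _; rewrite big_split.
Qed.

Lemma tens_adj (A : 'I_n -> op R B) : adj (tens A) = tens (fun i => adj (A i)).
Proof.
by apply: op_ext => a b; rewrite /adj /tens (rmorph_prod (@conjc R)).
Qed.

Lemma tens_diagop (q : 'I_n -> B -> R) :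
  tens (fun i => diagop (q i)) = diagop (fun s : wseq n B => \prod_i q i (s i)).
Proof.
apply: op_ext => a b; rewrite /tens /diagop; case: eqP => [->|/eqP ab].
  rewrite mul1r (rmorph_prod (real_complex R)); apply: eq_bigr => i _.
  by rewrite eqxx mul1r.
rewrite mul0r; have [i hi] : exists i, a i != b i.
  apply/existsP; rewrite -negb_forall; apply: contra ab => /forallP h.
  by apply/eqP/ffunP => i; apply/eqP.
by rewrite (bigD1 i) //= (negPf hi) !mul0r.
Qed.

Lemma tens1 : tens (fun _ => 1) = 1.
Proof.
rewrite -[RHS]diagop1 -(diagop1 R B) tens_diagop; congr diagop.
by apply/funext => s; rewrite big1.
Qed.

Lemma tens_unitary (U : 'I_n -> op R B) : (forall i, unitary (U i)) -> unitary (tens U).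
Proof.
move=> h; rewrite /unitary !mulopE tens_adj tensM idopE -tens1; congr tens.
by apply/funext => i; exact: h.
Qed.

Lemma tens_cdiag (U : 'I_n -> op R B) (q : 'I_n -> B -> R) :
  tens (fun i => cdiag (U i) (q i)) = cdiag (tens U) (fun s : wseq n B => \prod_i q i (s i)).
Proof. by rewrite /cdiag tens_adj -tens_diagop !tensM. Qed.
End Tensor.

Section Marginal.
Variables (R : realType) (T W : finType) (f : T -> W) (p : T -> R).

Lemma Ncount_marg n (t : 'I_n -> T) (a : W) :
  Ncount (fun i => f (t i)) a = (\sum_(u | f u == a) Ncount t u)%N.
Proof.
rewrite /Ncount -sum1_card (partition_big t (fun u => f u == a)) //=.
apply: eq_bigr => u /eqP fu; rewrite -sum1_card; apply: eq_bigl => i; rewrite !inE.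
by case: (t i =P u) => [->|_]; rewrite ?fu ?eqxx ?andbF.
Qed.

(** The tolerance is proportional to the probability, so the deviations within a fibre of [f] add up
    to the marginal tolerance with the same [delta]. *)
Lemma typical_marg n (t : 'I_n -> T) (delta : R) (pW : W -> R) :
  (forall a, pW a = \sum_(u | f u == a) p u) ->
  typical p t delta -> typical pW (fun i => f (t i)) delta.
Proof.
move=> hW /forallP h; apply/forallP => a; rewrite Ncount_marg hW natr_sum mulr_suml -sumrB
  mulr_sumr.
by apply: le_trans (ler_norm_sum _ _ _) _; apply: ler_sum => u _; exact: h.
Qed.
End Marginal.

(** * Typical projectors of an ensemble of states *)

Section TypicalProjector.
Variables (R : realType) (W B : finType) (p : W -> R) (sigma : W -> op R B).
Hypotheses (hp : distr p) (hs : forall w, density (sigma w)).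

Section Basis.
Variables (n : nat) (w : 'I_n -> W).

(** The tensor state and its typical projectors are all diagonal in this product basis, so the
    estimates become estimates of the numbers [teigval w s]. *)
Definition tbasis : op R (wseq n B) := tens (fun i => eigbasis (sigma (w i))).
Definition teigval (s : wseq n B) : R := \prod_i eigval (sigma (w i)) (s i).

Lemma tbasis_unitary : unitary tbasis.
Proof. by apply: tens_unitary => i; case: (eigdecP (density_herm (hs (w i)))). Qed.

Lemma tensorE : tensor sigma w = cdiag tbasis teigval.
Proof.
transitivity (tens (fun i => cdiag (eigbasis (sigma (w i))) (eigval (sigma (w i))))); last first.
  exact: tens_cdiag.
apply: op_ext => a b; apply: eq_bigr => i _.
by case: (eigdecP (density_herm (hs (w i)))) => _ <-.
Qed.

Lemma typprojE delta :
  typproj sigma w delta = cdiag tbasis (fun s => (typ_cond sigma w delta s)%:R).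
Proof.
apply: op_ext => a b; rewrite cdiag_entry /typproj big_mkcond; apply: eq_bigr => s _.
case: (typ_cond _ _ _ _); last by rewrite mul0r.
rewrite mul1r /tbasis /tens (rmorph_prod (@conjc R)) -big_split.
by apply: eq_bigr => i _; rewrite conjE.
Qed.

Lemma teigval_ge0 s : 0 <= teigval s.
Proof. by apply: prodr_ge0 => i _; exact: (density_eigval (hs (w i))).1. Qed.

Lemma sum_teigval : \sum_s teigval s = 1.
Proof.
rewrite (prod_distr_sum1 (p := fun i => eigval (sigma (w i)))) // => i.
exact: (density_eigval (hs (w i))).2.
Qed.

Lemma tensor_ge0 : 0 ⪯ tensor sigma w.
Proof. by rewrite tensorE; apply: cdiag_ge0; exact: teigval_ge0. Qed.

Lemma rtr_tensor : rtr (tensor sigma w) = 1.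
Proof. by rewrite tensorE rtr_cdiag ?sum_teigval //; exact: tbasis_unitary. Qed.

Lemma tensor_sqrt : exists2 S, tensor sigma w = S * adj S & nrm2 S = 1.
Proof.
exists (tbasis * diagop (fun s => Num.sqrt (teigval s))).
  rewrite tensorE adjM diagop_adj !mulrA -(mulrA tbasis) diagopM; congr (_ * diagop _ * _).
  by apply/funext => s; rewrite -expr2 sqr_sqrtr ?teigval_ge0.
rewrite /nrm2 adjM diagop_adj !mulrA -(mulrA _ (adj tbasis)) unitary_adjl ?mulr1;
  last exact: tbasis_unitary.
rewrite diagopM rtr_diagop -[RHS]sum_teigval; apply: eq_bigr => s _.
by rewrite -expr2 sqr_sqrtr ?teigval_ge0.
Qed.

Lemma typproj_projector delta : projector (typproj sigma w delta).
Proof. by rewrite typprojE; apply: cdiag_projector; exact: tbasis_unitary. Qed.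

Lemma typproj_deficit delta :
  rtr ((1 - typproj sigma w delta) * tensor sigma w) =
  \sum_s teigval s * (~~ typ_cond sigma w delta s)%:R.
Proof.
have hU := tbasis_unitary.
rewrite typprojE tensorE -(cdiag1 hU) -scaleN1r cdiagZ cdiagD cdiagM // rtr_cdiag //.
by apply: eq_bigr => s _; rewrite mulrC; case: (typ_cond _ _ _ _);
  rewrite /= ?mulN1r ?oppr0 ?addr0 ?subrr.
Qed.

Lemma typproj_sandwich_le delta :
  typproj sigma w delta * tensor sigma w * typproj sigma w delta ⪯ tensor sigma w.
Proof.
have hU := tbasis_unitary; rewrite typprojE tensorE !cdiagM //; apply: cdiag_le => s.
by case: (typ_cond _ _ _ _); rewrite ?mul1r ?mulr1 ?mul0r ?teigval_ge0.
Qed.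

(** The pair count and [q] times the letter count each miss [n p(a) q] by a relative [delta / 4], so
    they differ by a relative [delta / 2]; dividing by the letter count costs at most the factor
    4/3. *)
Lemma typical_joint_cond (delta : R) (s : wseq n B) : (0 < n)%N -> 0 < delta < 1 ->
  typical (fun u : W * B => p u.1 * eigval (sigma u.1) u.2) (fun i => (w i, s i)) (delta / 4) ->
  typ_cond sigma w delta s.
Proof.
move=> n0 /andP[d0 d1] h; have nR : 0 < n%:R :> R by rewrite ltr0n.
have hm : typical p w (delta / 4).
  apply: (typical_marg (f := fst) _ h) => a.
  rewrite (eq_bigl (fun u : W * B => (u.1 == a) && true)) => [|u]; last by rewrite andbT.
  rewrite -(pair_big (pred1 a) predT (fun a b => p a * eigval (sigma a) b)) /=.
  by rewrite big_pred1_eq -mulr_sumr (density_eigval (hs a)).2 mulr1.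
apply/forallP => a; apply/implyP => Na; apply/forallP => b.
set q := eigval _ _; have q0 : 0 <= q by exact: (density_eigval (hs a)).1.
have /forallP /(_ (a, b)) := h; have /forallP /(_ a) := hm.
rewrite (_ : Ncount (fun i => (w i, s i)) (a, b) = #|[pred i | (w i == a) && (s i == b)]|);
  last first.
  by apply: eq_card => i; rewrite !inE xpair_eqE.
rewrite /= -/q; set N := Ncount w a in Na *; set M := #|_|.
have NR : 0 < N%:R :> R by rewrite ltr0n.
have p0 : 0 <= p a by exact: hp.1.
have -> : N%:R / n%:R - p a = (N%:R - n%:R * p a) / n%:R by field; rewrite gt_eqF.
have -> : M%:R / n%:R - p a * q = (M%:R - n%:R * (p a * q)) / n%:R by field; rewrite gt_eqF.
have -> : M%:R / N%:R - q = (M%:R - N%:R * q) / N%:R by field; rewrite gt_eqF.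
rewrite !normrM !normfV !(gtr0_norm nR) (gtr0_norm NR) !ler_pdivrMr //.
move: N%:R M%:R n%:R NR nR => {Na h hm} N' M' n' NR nR; rewrite !ler_norml.
move=> /andP[h1 h2] /andP[h3 h4].
have h5 : 0 <= n' * p a by rewrite mulr_ge0 // ltW.
have h6 : 0 <= n' * (p a * q) by rewrite !mulr_ge0 // ltW.
have h7 : N' * q <= (1 + delta / 4) * (n' * (p a * q)).
  have -> : (1 + delta / 4) * (n' * (p a * q)) = ((1 + delta / 4) * (n' * p a)) * q by ring.
  by rewrite ler_wpM2r //; lra.
have h8 : (1 - delta / 4) * (n' * (p a * q)) <= N' * q.
  have -> : (1 - delta / 4) * (n' * (p a * q)) = ((1 - delta / 4) * (n' * p a)) * q by ring.
  by rewrite ler_wpM2r //; lra.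
have -> : delta * q * N' = delta * (N' * q) by ring.
have h9 : delta * (3 / 4 * (n' * (p a * q))) <= delta * (N' * q).
  by rewrite ler_wpM2l ?(ltW d0) //; apply: le_trans h8; rewrite ler_wpM2r //; lra.
move: h3 h4; have -> : delta / 4 * (p a * q) * n' = delta / 4 * (n' * (p a * q)) by ring.
move=> h3 h4; apply/andP; split; nra.
Qed.
End Basis.

Definition pjoint (u : W * B) : R := p u.1 * eigval (sigma u.1) u.2.

Lemma pjoint_distr : distr pjoint.
Proof.
split=> [u|]; first by rewrite mulr_ge0 ?hp.1 //; exact: (density_eigval (hs _)).1.
rewrite -(pair_big predT predT (fun a b => p a * eigval (sigma a) b)) /= -[RHS]hp.2.
by apply: eq_bigr => a _; rewrite -mulr_sumr (density_eigval (hs a)).2 mulr1.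
Qed.

(** Measuring the random state in its eigenbasis makes the pairs of letter and eigenindex i.i.d.
    with law [pjoint], so the classical law of large numbers applies. *)
Lemma typproj_deficit_avg (delta : R) : 0 < delta < 1 -> exists2 C : R, 0 <= C &
  forall n, (0 < n)%N -> \sum_(w : {ffun 'I_n -> W}) (\prod_i p (w i)) *
    rtr ((1 - typproj sigma w delta) * tensor sigma w) <= C / n%:R.
Proof.
move=> d01; have [d0 d1] := andP d01.
have [|C C0 hC] := typical_LLN pjoint_distr (delta := delta / 4); first by rewrite divr_gt0.
exists C => // n n0; apply: le_trans (hC n n0); rewrite sum_ffun_pair.
apply: ler_sum => w _; rewrite typproj_deficit mulr_sumr; apply: ler_sum => s _.
have -> : \prod_i pjoint (ffun_pair w s i) = (\prod_i p (w i)) * teigval w s.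
  by rewrite -big_split; apply: eq_bigr => i _; rewrite ffunE.
rewrite -mulrA ler_wpM2l //; first by apply: prodr_ge0 => i _; exact: hp.1.
rewrite ler_wpM2l ?teigval_ge0 // ler_nat.
case ht: (typical _ _ _) => /=; last by case: (typ_cond _ _ _ _).
by rewrite (typical_joint_cond n0 d01) // ffun_pairE.
Qed.

(** Entropy in nats, matching the [expR] bounds; [lnH_vN] converts it from bits. *)
Definition lnH (s : op R B) : R := - \sum_b eigval s b * ln (eigval s b).
Definition condH : R := \sum_a p a * lnH (sigma a).

Lemma sum_count (n : nat) (V : finType) (u : 'I_n -> V) (g : V -> R) :
  \sum_i g (u i) = \sum_a (Ncount u a)%:R * g a.
Proof.
rewrite (eq_bigr (fun i => \sum_a (u i == a)%:R * g a)) => [|i _]; last exact: sum_indic.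
by rewrite exchange_big; apply: eq_bigr => a _; rewrite NcountE mulr_suml.
Qed.

Lemma eigval_le1 a b : eigval (sigma a) b <= 1.
Proof.
have [h0 h1] := density_eigval (hs a).
by rewrite -h1 (bigD1 b) //= lerDl sumr_ge0.
Qed.

Lemma lnH_ge0 a : 0 <= lnH (sigma a).
Proof.
rewrite oppr_ge0; apply: sumr_le0 => b _; rewrite mulr_ge0_le0 ?ln_le0 ?eigval_le1 //.
exact: (density_eigval (hs a)).1.
Qed.

Lemma condH_ge0 : 0 <= condH.
Proof. by apply: sumr_ge0 => a _; rewrite mulr_ge0 ?lnH_ge0 ?hp.1. Qed.

(** * Asymptotic equipartition for conditionally typical projectors *)

Section AEP.
Variables (delta delta' : R) (n : nat) (w : 'I_n -> W).
Hypotheses (d0 : 0 < delta) (d1 : delta < 1/64) (d'0 : 0 <= delta') (d'6 : delta' <= 6 * delta).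
Hypotheses (n0 : (0 < n)%N) (hw : typical p w delta).

(** The relative errors [delta] of [w] and at most [6 * delta] of [s] given [w] combine to
    [7 * delta + 6 * delta^2], which stays below [8 * delta] because [delta < 1/64]. *)
Lemma count_bounds (s : wseq n B) (u : W * B) : typ_cond sigma w delta' s ->
  (1 - 8 * delta) * (n%:R * pjoint u) <= (Ncount (fun i => (w i, s i)) u)%:R <=
  (1 + 8 * delta) * (n%:R * pjoint u).
Proof.
case: u => a b hc; have nR : 0 < n%:R :> R by rewrite ltr0n.
have -> : Ncount (fun i => (w i, s i)) (a, b) = #|[pred i | (w i == a) && (s i == b)]|.
  by apply: eq_card => i; rewrite !inE xpair_eqE.
rewrite /pjoint /=; set q := eigval _ _; have q0 : 0 <= q by exact: (density_eigval (hs a)).1.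
have p0 : 0 <= p a by exact: hp.1.
have /forallP /(_ a) := hw; have /forallP /(_ a) := hc.
set N := Ncount w a; set M := #|_|.
have -> : N%:R / n%:R - p a = (N%:R - n%:R * p a) / n%:R by field; rewrite gt_eqF.
rewrite normrM normfV (gtr0_norm nR) ler_pdivrMr // => h1 h2.
have npa0 : 0 <= n%:R * p a by rewrite mulr_ge0 // ltW.
have npaq0 : 0 <= n%:R * (p a * q) by rewrite !mulr_ge0 // ltW.
(* A letter absent from [w] puts no constraint on [s]; but typicality of [w] with [delta < 1] then
   forces its probability to be zero. *)
have [N0|Npos] := posnP N.
  have M0 : M = 0%N.
    apply/eqP; rewrite -leqn0 -N0; apply: subset_leq_card; apply/subsetP => i.
    by rewrite !inE => /andP[].
  move: h2; rewrite N0 sub0r normrN ger0_norm // => h2.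
  have e : n%:R * (p a * q) = 0.
    suff e : n%:R * p a = 0 by rewrite mulrA e mul0r.
    have h3 : delta * (n%:R * p a) <= 1 / 64 * (n%:R * p a) by rewrite ler_wpM2r // ltW.
    by apply/eqP; rewrite eq_le npa0 andbT; lra.
  by rewrite M0 e !mulr0 lexx.
move: h1; rewrite Npos /= => /forallP /(_ b).
rewrite (_ : #|_| = M) // -/q.
have NR : 0 < N%:R :> R by rewrite ltr0n.
have -> : M%:R / N%:R - q = (M%:R - N%:R * q) / N%:R by field; rewrite gt_eqF.
rewrite normrM normfV (gtr0_norm NR) ler_pdivrMr //; move: h2.
rewrite !ler_norml => /andP[h3 h4] /andP[h5 h6].
have h7 : N%:R * q <= (1 + delta) * (n%:R * (p a * q)).
  have -> : (1 + delta) * (n%:R * (p a * q)) = ((1 + delta) * (n%:R * p a)) * q by ring.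
  by rewrite ler_wpM2r //; lra.
have h8 : (1 - delta) * (n%:R * (p a * q)) <= N%:R * q.
  have -> : (1 - delta) * (n%:R * (p a * q)) = ((1 - delta) * (n%:R * p a)) * q by ring.
  by rewrite ler_wpM2r //; lra.
have Nq0 : 0 <= N%:R * q by rewrite mulr_ge0.
have h9 : delta' * q * N%:R <= 6 * delta * (N%:R * q).
  by rewrite -mulrA [q * _]mulrC ler_wpM2r.
move: (n%:R * (p a * q)) (N%:R * q) npaq0 h7 h8 h9 h5 h6 Nq0 => c e c0 h7 h8 h9 h5 h6 Nq0.
have h13 : delta * c <= 1 / 64 * c by rewrite ler_wpM2r // ltW.
have h10 : delta * e <= delta * (2 * c) by rewrite ler_wpM2l ?(ltW d0) //; lra.
have h11 : delta * e <= delta * ((1 + delta) * c) by rewrite ler_wpM2l ?(ltW d0).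
have h12 : delta * (delta * c) <= delta * (1 / 64 * c).
  by rewrite ler_wpM2l ?(ltW d0) // ler_wpM2r // ltW.
by apply/andP; split; lra.
Qed.

Lemma teigval_bounds (s : wseq n B) : typ_cond sigma w delta' s ->
  expR (- (n%:R * ((1 + 8 * delta) * condH))) <= teigval w s <=
  expR (- (n%:R * ((1 - 8 * delta) * condH))).
Proof.
move=> hc; have nR : 0 < n%:R :> R by rewrite ltr0n.
(* The logarithm of a zero eigenvalue would be a meaningless default. It cannot arise: the count of
   such a pair is at most 0, yet position [i] is counted. *)
have qpos i : 0 < eigval (sigma (w i)) (s i).
  rewrite lt_def (density_eigval (hs _)).1 andbT; apply/eqP => q0.
  have /andP[_] := count_bounds (w i, s i) hc; rewrite /pjoint /= q0 !mulr0.
  rewrite (ler_nat _ _ 0) leqNgt => /negP; apply; apply/card_gt0P.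
  by exists i; rewrite inE.
have -> : teigval w s = expR (\sum_i ln (eigval (sigma (w i)) (s i))).
  rewrite expR_sum; apply: eq_bigr => i _; by rewrite lnK // posrE.
rewrite !ler_expR.
rewrite (sum_count (fun i => (w i, s i)) (fun u => ln (eigval (sigma u.1) u.2))).
have eH : condH = \sum_u pjoint u * - ln (eigval (sigma u.1) u.2).
  rewrite -(pair_big predT predT (fun a b => p a * eigval (sigma a) b * - ln (eigval (sigma a)
    b))) /=.
  apply: eq_bigr => a _; rewrite /lnH mulrN mulr_sumr -sumrN.
  by apply: eq_bigr => b _; rewrite mulrN mulrA.
have lge u : 0 <= - ln (eigval (sigma u.1) u.2) by rewrite oppr_ge0 ln_le0 // eigval_le1.
rewrite eH !mulr_sumr -!sumrN; apply/andP; split; apply: ler_sum => u _.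
  have /andP[_ h] := count_bounds u hc.
  rewrite -[leRHS]opprK lerN2 -mulrN.
  have -> : n%:R * ((1 + 8 * delta) * (pjoint u * - ln (eigval (sigma u.1) u.2))) =
    (1 + 8 * delta) * (n%:R * pjoint u) * - ln (eigval (sigma u.1) u.2) by ring.
  by rewrite ler_wpM2r.
have /andP[h _] := count_bounds u hc.
rewrite -[leLHS]opprK lerN2 -[leRHS]mulrN.
have -> : n%:R * ((1 - 8 * delta) * (pjoint u * - ln (eigval (sigma u.1) u.2))) =
  (1 - 8 * delta) * (n%:R * pjoint u) * - ln (eigval (sigma u.1) u.2) by ring.
by rewrite ler_wpM2r.
Qed.

Let P := typproj sigma w delta'.

(** On each typical eigenvector the state has at least the inverse of this factor as eigenvalue. A
    bound by the state itself, rather than by the identity, can later be averaged over codewords. *)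
Lemma typproj_le : P ⪯ expR (n%:R * ((1 + 8 * delta) * condH)) *: tensor sigma w.
Proof.
have hU := tbasis_unitary w; rewrite /P typprojE tensorE cdiagZ; apply: cdiag_le => s.
case hc: (typ_cond _ _ _ _); last by rewrite mulr_ge0 ?expR_ge0 ?teigval_ge0.
have /andP[h _] := teigval_bounds hc.
by rewrite -ler_pdivrMl ?expR_gt0 // mulr1 -expRN.
Qed.

Lemma rtr_typproj : rtr P <= expR (n%:R * ((1 + 8 * delta) * condH)).
Proof. by have := lea_rtr typproj_le; rewrite rtrZ rtr_tensor mulr1. Qed.

Lemma typproj_sandwich :
  P * tensor sigma w * P ⪯ expR (- (n%:R * ((1 - 8 * delta) * condH))) *: (1 : op R (wseq n B)).
Proof.
have hU := tbasis_unitary w.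
rewrite /P typprojE tensorE -(cdiag1 hU) cdiagZ !cdiagM //; apply: cdiag_le => s.
case hc: (typ_cond _ _ _ _); rewrite ?mul1r ?mul0r ?mulr1 ?expR_ge0 //.
by have /andP[] := teigval_bounds hc.
Qed.
End AEP.
End TypicalProjector.

(** * Entropies of classical-quantum states *)

Section Entropy.
Variable R : realType.

Lemma xlog2M (x y : R) : 0 <= x -> 0 <= y -> xlog2 (x * y) = x * xlog2 y + y * xlog2 x.
Proof.
rewrite !le_eqVlt => /orP[/eqP <-|x0] /orP[/eqP <-|y0];
  rewrite /xlog2 ?mul0r ?mulr0 ?eqxx ?mul0r ?mulr0 ?addr0 //.
rewrite !gt_eqF ?mulr_gt0 // /log2 lnM ?posrE //.
by ring.
Qed.

Lemma lnH_vN (B : finType) (s : op R B) : lnH s = vN_entropy s * ln 2.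
Proof.
rewrite /lnH /vN_entropy mulNr mulr_suml; congr (- _); apply: eq_bigr => b _.
rewrite /xlog2; case: eqP => [->|_]; first by rewrite !mul0r.
by rewrite /log2 -!mulrA mulVf ?mulr1 // gt_eqF // ln_gt0 // ltr1n.
Qed.

Lemma vN_diag (T : finType) (p : T -> R) : vN_entropy (diagop p) = - \sum_t xlog2 (p t).
Proof.
apply: (vN_entropyE (d := (1, p))); apply/is_eigdecE; split=> /=.
  by rewrite /unitary mulopE adj1 mulr1.
by rewrite /cdiag adj1 mulr1 mul1r.
Qed.

(** The eigenbasis is assembled blockwise from those of the states [s a]. The coordinates [w], [b]
    with inverse [g] make the lemma applicable to registers in any order. *)
Lemma vN_cq (T W B : finType) (w : T -> W) (b : T -> B) (g : W * B -> T)
    (p : W -> R) (s : W -> op R B) (om : op R T) :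
  cancel (fun t => (w t, b t)) g -> cancel g (fun t => (w t, b t)) ->
  (forall a, 0 <= p a) -> (forall a, density (s a)) ->
  (forall t t', om t t' = (w t == w t')%:R * (p (w t))%:C * s (w t) (b t) (b t')) ->
  vN_entropy om = - \sum_a xlog2 (p a) + \sum_a p a * vN_entropy (s a).
Proof.
move=> gK Kg p0 hs hom.
have hE a := eigdecP (density_herm (hs a)).
have sumg (M : nmodType) (F : W -> B -> M) : \sum_t F (w t) (b t) = \sum_a \sum_c F a c.
  rewrite pair_big /= (reindex g) /=; last by exists (fun t => (w t, b t)) => ? _; rewrite ?gK ?Kg.
  by apply: eq_bigr => u _; have := Kg u; case: u => a c [-> ->].
have pick (a a' : W) (F : W -> R[i]) :
    \sum_e (a == e)%:R * ((a' == e)%:R * F e) = (a == a')%:R * F a.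
  rewrite (bigD1 a) //= eqxx mul1r big1 ?addr0 => [|e /negPf ea].
    by case: eqP => [->|h]; rewrite ?eqxx ?mul1r // eq_sym; case: eqP => // h';
      rewrite ?mul0r //; case: h.
  by rewrite eq_sym ea mul0r.
pose U : op R T := fun t u => (w t == w u)%:R * eigbasis (s (w t)) (b t) (b u).
pose q t := p (w t) * eigval (s (w t)) (b t).
have entry (r : W -> B -> R) t t' : cdiag U (fun u => r (w u) (b u)) t t' =
    (w t == w t')%:R * \sum_c (r (w t) c)%:C *
      (eigbasis (s (w t)) (b t) c * conjc (eigbasis (s (w t)) (b t') c)).
  rewrite cdiag_entry /U.
  rewrite (sumg _ (fun a c => (r a c)%:C * ((w t == a)%:R * eigbasis (s (w t)) (b t) c *
      conjc ((w t' == a)%:R * eigbasis (s (w t')) (b t') c)))).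
  pose F a := \sum_c (r a c)%:C *
    (eigbasis (s (w t)) (b t) c * conjc (eigbasis (s (w t')) (b t') c)).
  transitivity ((w t == w t')%:R * F (w t)); last first.
    by rewrite /F; case: eqP => [->|_]; rewrite ?mul0r.
  rewrite -pick; apply: eq_bigr => a _; rewrite !mulr_sumr; apply: eq_bigr => c _.
  case: eqP => [<-|_]; last by rewrite !mul0r mulr0.
  by rewrite conjcM conjc_nat; case: (w t' == w t); rewrite /= ?mulr1n ?mulr0n; ring.
rewrite (vN_entropyE (d := (U, q))) /=.
  have -> : \sum_t xlog2 (q t) = \sum_a \sum_c xlog2 (p a * eigval (s a) c).
    exact: (sumg _ (fun a c => xlog2 (p a * eigval (s a) c))).
  rewrite -!sumrN -big_split /=; apply: eq_bigr => a _.
  have [e0 e1] := density_eigval (hs a).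
  rewrite (eq_bigr (fun c => p a * xlog2 (eigval (s a) c) + eigval (s a) c * xlog2 (p a))).
    by rewrite big_split /= -mulr_suml -mulr_sumr e1 mul1r opprD addrC /vN_entropy mulrN.
  by move=> c _; rewrite xlog2M.
apply/is_eigdecE; split=> /=.
  rewrite /unitary mulopE -{1}(mulr1 U) -diagop1; apply: op_ext => t t'.
  apply: (etrans (entry (fun _ _ => 1) t t')).
  have [hU _] := hE (w t).
  have := congr1 (fun A : op R B => A (b t) (b t')) hU.
  rewrite mulopE mulE => h.
  rewrite (eq_bigr (fun c => eigbasis (s (w t)) (b t) c * adj (eigbasis (s (w t))) c (b t')));
    last first.
    by move=> c _; rewrite mul1r.
  have -> : idop R t t' = ((w t == w t') && (b t == b t'))%:R.
    by rewrite idopE oneE -[t in LHS]gK -[t' in LHS]gK (can_eq Kg).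
  rewrite h idopE oneE.
  by case: (w t == w t'); case: (b t == b t'); rewrite /= ?mulr1n ?mulr0n ?mul1r ?mul0r.
apply: op_ext => t t'; apply/esym; apply: (etrans (entry (fun a c => p a * eigval (s a) c) t t')).
rewrite hom -mulrA; congr (_ * _).
rewrite [in RHS](hE (w t)).2 cdiag_entry mulr_sumr; apply: eq_bigr => c _.
by rewrite (rmorphM (real_complex R)) -mulrA.
Qed.

Lemma density_mix (I T : finType) (q : I -> R) (s : I -> op R T) :
  distr q -> (forall i, density (s i)) ->
  density (fun a b => \sum_i (q i)%:C * s i a b).
Proof.
move=> [q0 q1] hs; split=> [v|].
  rewrite innerE; have -> : \sum_a conjc (v a) * apply (fun a b => \sum_i (q i)%:C * s i a b) v a =
     \sum_i (q i)%:C * inner v (apply (s i) v).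
    rewrite (eq_bigr (fun a => \sum_i (q i)%:C * (conjc (v a) * apply (s i) v a))) => [|a _].
      by rewrite exchange_big; apply: eq_bigr => i _ /=; rewrite innerE mulr_sumr.
    rewrite /apply; under eq_bigr do rewrite mulr_suml.
    rewrite exchange_big mulr_sumr; apply: eq_bigr => i _ /=.
    by rewrite !mulr_sumr; apply: eq_bigr => b _; ring.
  by apply: sumr_ge0 => i _; rewrite mulr_ge0 ?ler0c //; exact: (hs i).1.
rewrite /trace exchange_big /= (eq_bigr (fun i => (q i)%:C)) => [|i _].
  by rewrite -(rmorph_sum (real_complex R)) q1.
by rewrite -mulr_sumr -/(trace (s i)) (hs i).2 mulr1.
Qed.

(** With [A] and [Cs] classical, the Shannon terms of the four entropies cancel. The averaged states
    [sC] are supplied by the caller, which avoids dividing by a probability [pC c] that may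
    vanish. *)
Lemma qcmi_cq (A B Cs : finType) (p : A * Cs -> R) (s : A * Cs -> op R B)
    (pC : Cs -> R) (sC : Cs -> op R B) (om : op R (A * B * Cs)%type) :
  (forall u, 0 <= p u) -> (forall u, density (s u)) -> (forall c, density (sC c)) ->
  (forall a b c a' b' c', om (a, b, c) (a', b', c') =
     ((a, c) == (a', c'))%:R * (p (a, c))%:C * s (a, c) b b') ->
  (forall c b b', \sum_a (p (a, c))%:C * s (a, c) b b' = (pC c)%:C * sC c b b') ->
  qcmi om = \sum_c pC c * vN_entropy (sC c) - \sum_u p u * vN_entropy (s u).
Proof.
move=> p0 hs hsC hom hC.
have pCE c : pC c = \sum_a p (a, c).
  apply: (@complexI R); rewrite -[LHS]mulr1 -(hsC c).2 /trace mulr_sumr.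
  under eq_bigr do rewrite -hC.
  rewrite exchange_big (rmorph_sum (real_complex R)) /=; apply: eq_bigr => a _.
  by rewrite -mulr_sumr -/(trace _) (hs (a, c)).2 mulr1.
have pC0 c : 0 <= pC c by rewrite pCE sumr_ge0.
rewrite /qcmi; set rAC := ptr _; set rBC := ptr _; set rC := ptr _.
have -> : rAC = diagop p.
  apply: op_ext => -[a c] [a' c']; rewrite /rAC /ptr /relabel /diagop.
  rewrite (eq_bigr (fun b => ((a, c) == (a', c'))%:R * (p (a, c))%:C * s (a, c) b b)) => [|b _].
    by rewrite -mulr_sumr -/(trace _) (hs (a, c)).2 mulr1.
  by rewrite hom.
have hBC (b b' : B) (c c' : Cs) : rBC (b, c) (b', c') = (c == c')%:R * (pC c)%:C * sC c b b'.
  rewrite /rBC /ptr /relabel.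
  rewrite (eq_bigr (fun a => (c == c')%:R * ((p (a, c))%:C * s (a, c) b b'))) => [|a _].
    by rewrite -mulr_sumr hC mulrA.
  by rewrite hom xpair_eqE eqxx /= mulrA.
have -> : rC = diagop pC.
  apply: op_ext => c c'; rewrite /rC /ptr /relabel /diagop.
  rewrite (eq_bigr (fun v : A * B => (c == c')%:R * ((p (v.1, c))%:C * s (v.1, c) v.2 v.2))) =>
    [|[a b] _].
    rewrite -(pair_big predT predT (fun a b => (c == c')%:R * ((p (a, c))%:C * s (a, c) b b))) /=.
    rewrite pCE (rmorph_sum (real_complex R)) mulr_sumr; apply: eq_bigr => a _.
    by rewrite -!mulr_sumr -/(trace _) (hs (a, c)).2 mulr1.
  by rewrite hom xpair_eqE eqxx /= mulrA.
rewrite !vN_diag.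
rewrite (vN_cq (w := snd) (b := fst) (g := fun u => (u.2, u.1)) (p := pC) (s := sC)) //; first last.
- by move=> [b c] [b' c']; rewrite hBC.
- by case.
- by case.
rewrite (vN_cq (w := fun t : A * B * Cs => (t.1.1, t.2)) (b := fun t => t.1.2)
  (g := fun u => (u.1.1, u.2, u.1.2)) (p := p) (s := s)) //; first last.
- by move=> [[a b] c] [[a' b'] c']; rewrite hom.
- by case=> [[]].
- by case=> [[]].
by ring.
Qed.
End Entropy.

Lemma distr_prod (R : realType) (U V : finType) (p : U -> R) (q : U -> V -> R) :
  distr p -> (forall u, distr (q u)) -> distr (fun w : U * V => p w.1 * q w.1 w.2).
Proof.
move=> [p0 p1] hq; split=> [w|]; first by rewrite mulr_ge0 //; exact: (hq _).1.
rewrite -(pair_big predT predT (fun a b => p a * q a b)) /= -[RHS]p1.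
by apply: eq_bigr => a _; rewrite -mulr_sumr (hq a).2 mulr1.
Qed.

(** * The mutual informations as differences of conditional entropies *)

Section Channel.
Variables (R : realType) (X Z Y B : finType).
Variables (rho : Z -> Y -> op R B) (pX : X -> R) (pZX : X -> Z -> R) (pY : Y -> R).
Hypotheses (hrho : forall z y, density (rho z y)) (hX : distr pX)
  (hZX : forall x, distr (pZX x)) (hY : distr pY).

Local Notation pZ := (pZ pX pZX).
Local Notation rho_z := (rho_z rho pY).
Local Notation rho_xy := (rho_xy rho pZX).
Local Notation rho_y := (rho_y rho pX pZX).
Local Notation rho_zy := (rho_zy rho).

Definition pZY (u : Z * Y) : R := pZ u.1 * pY u.2.
Definition pXY (u : X * Y) : R := pX u.1 * pY u.2.
(** A one-letter ensemble, so that the overall average state is covered by the results on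
    conditionally typical projectors. *)
Definition pU (_ : unit) : R := 1.
Definition avg_rho_x (x : X) : op R B :=
  fun b b' => \sum_(u : Z * Y) (pZX x u.1 * pY u.2)%:C * rho u.1 u.2 b b'.
Definition avg_rho_u (_ : unit) : op R B :=
  fun b b' => \sum_(u : Z * Y) (pZY u)%:C * rho u.1 u.2 b b'.

Lemma pZ_distr : distr pZ.
Proof.
split=> [z|]; first by apply: sumr_ge0 => x _; rewrite mulr_ge0 ?hX.1 ?(hZX x).1.
rewrite exchange_big /= -[RHS]hX.2; apply: eq_bigr => x _.
by rewrite -mulr_sumr (hZX x).2 mulr1.
Qed.
Lemma pZY_distr : distr pZY. Proof. exact: distr_prod pZ_distr (fun=> hY). Qed.
Lemma pXY_distr : distr pXY. Proof. exact: distr_prod hX (fun=> hY). Qed.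
Lemma pU_distr : distr pU.
Proof. by split=> [u|]; rewrite /pU ?ler01 // sumr_const card_unit. Qed.

Lemma rho_zy_density u : density (rho_zy u). Proof. exact: hrho. Qed.
Lemma rho_z_density z : density (rho_z z).
Proof. exact: (density_mix (s := rho z)). Qed.
Lemma rho_xy_density u : density (rho_xy u).
Proof. exact: (density_mix (s := fun z => rho z u.2)). Qed.
Lemma rho_y_density y : density (rho_y y).
Proof. exact: (density_mix (s := fun z => rho z y)) pZ_distr _. Qed.
Lemma rho_x_density x : density (avg_rho_x x).
Proof.
exact: (density_mix (s := fun u => rho u.1 u.2)) (distr_prod (hZX x) (fun=> hY)) _.
Qed.
Lemma rho_u_density u : density (avg_rho_u u).
Proof. exact: (density_mix (s := fun u => rho u.1 u.2)) pZY_distr _. Qed.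

Definition condH_zy := condH pZY rho_zy.
Definition condH_xy := condH pXY rho_xy.
Definition condH_y := condH pY rho_y.
Definition condH_z := condH pZ rho_z.
Definition condH_x := condH pX avg_rho_x.
Definition condH_u := condH pU avg_rho_u.

Lemma condH_vN (W : finType) (p : W -> R) (s : W -> op R B) :
  (\sum_w p w * vN_entropy (s w)) * ln 2 = condH p s.
Proof. by rewrite mulr_suml; apply: eq_bigr => w _; rewrite lnH_vN mulrA. Qed.

(** In this and the next six identities the subtracted entropy is the one that bounds the decoder's
    trace: [condH_zy] for the first region, [condH_z] for the second. The other one belongs to the
    state averaged over the wrongly decoded codewords. *)
Lemma I_Y_B_gZE : I_Y_B_gZ rho pX pZX pY * ln 2 = condH_z - condH_zy.
Proof.
rewrite /I_Y_B_gZ (qcmi_cq (p := fun u => pZ u.2 * pY u.1) (s := fun u => rho u.2 u.1) (pC := pZ)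
  (sC := rho_z)).
- rewrite mulrBl condH_vN; congr (_ - _); rewrite /condH_zy -condH_vN; congr (_ * _).
  by rewrite (reindex (fun u : Z * Y => (u.2, u.1))) //=; exists (fun u => (u.2, u.1)); case.
- by move=> u; rewrite mulr_ge0 ?hY.1 ?pZ_distr.1.
- by move=> u; exact: hrho.
- exact: rho_z_density.
- move=> y b z y' b' z'; rewrite /ptr /relabel /cq_state /=.
  rewrite (eq_bigr (fun x => ((y, z) == (y', z'))%:R * (pX x * pZX x z * pY y)%:C * rho z y b b')).
    by rewrite -!mulr_suml -mulr_sumr -rmorph_sum /= -mulr_suml.
  by move=> x _; rewrite eqxx /= xpair_eqE andbC.
- by move=> z b b'; rewrite /Defs.rho_z mulr_sumr; apply: eq_bigr => y _; rewrite rmorphM mulrA.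
Qed.

Lemma I_Z_B_gXYE : I_Z_B_gXY rho pX pZX pY * ln 2 = condH_xy - condH_zy.
Proof.
rewrite /I_Z_B_gXY (qcmi_cq (p := fun u => pX u.2.1 * pZX u.2.1 u.1 * pY u.2.2)
  (s := fun u => rho u.1 u.2.2) (pC := pXY) (sC := rho_xy)).
- rewrite mulrBl condH_vN; congr (_ - _); rewrite /condH_zy -condH_vN; congr (_ * _).
  rewrite -(pair_big predT predT (fun z u => pX u.1 * pZX u.1 z * pY u.2 * vN_entropy (rho z
    u.2))) /=.
  rewrite -(pair_big predT predT (fun z y => pZ z * pY y * vN_entropy (rho z y))) /=.
  apply: eq_bigr => z _.
  rewrite -(pair_big predT predT (fun x y => pX x * pZX x z * pY y * vN_entropy (rho z y)))
    exchange_big /=.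
  by apply: eq_bigr => y _; rewrite -!mulr_suml.
- by move=> u; rewrite !mulr_ge0 ?hY.1 ?hX.1 ?(hZX _).1.
- by move=> u; exact: hrho.
- exact: rho_xy_density.
- move=> z b [x y] z' b' [x' y']; rewrite /relabel /cq_state /= !xpair_eqE.
  by rewrite andbCA andbA.
- move=> [x y] b b'; rewrite /Defs.rho_xy mulr_sumr; apply: eq_bigr => z _ /=.
  by rewrite mulrA -rmorphM /pXY /=; congr (_%:C * _); ring.
Qed.

Lemma I_Z_B_gYE : I_Z_B_gY rho pX pZX pY * ln 2 = condH_y - condH_zy.
Proof.
rewrite /I_Z_B_gY (qcmi_cq (p := pZY) (s := rho_zy) (pC := pY) (sC := rho_y)).
- by rewrite mulrBl !condH_vN.
- exact: pZY_distr.1.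
- exact: rho_zy_density.
- exact: rho_y_density.
- move=> z b y z' b' y'; rewrite /ptr /relabel /cq_state /=.
  rewrite (eq_bigr (fun x => ((z, y) == (z', y'))%:R * (pX x * pZX x z * pY y)%:C * rho z y b b')).
    by rewrite -!mulr_suml -mulr_sumr -rmorph_sum /= -mulr_suml.
  by move=> x _; rewrite eqxx /= xpair_eqE.
- move=> y b b'; rewrite /Defs.rho_y mulr_sumr; apply: eq_bigr => z _.
  by rewrite mulrA -rmorphM /pZY /=; congr (_%:C * _); ring.
Qed.

Lemma I_ZY_B_gXE : I_ZY_B_gX rho pX pZX pY * ln 2 = condH_x - condH_zy.
Proof.
rewrite /I_ZY_B_gX (qcmi_cq (p := fun u => pX u.2 * pZX u.2 u.1.1 * pY u.1.2)
  (s := fun u => rho u.1.1 u.1.2) (pC := pX) (sC := avg_rho_x)).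
- rewrite mulrBl condH_vN; congr (_ - _); rewrite /condH_zy -condH_vN; congr (_ * _).
  rewrite -(pair_big predT predT (fun u x => pX x * pZX x u.1 * pY u.2 * vN_entropy (rho u.1
    u.2))) /=.
  by apply: eq_bigr => u _; rewrite -!mulr_suml.
- by move=> u; rewrite !mulr_ge0 ?hY.1 ?hX.1 ?(hZX _).1.
- by move=> u; exact: hrho.
- exact: rho_x_density.
- move=> [z y] b x [z' y'] b' x'; rewrite /relabel /cq_state /= !xpair_eqE.
  by case: (x == x'); case: (z == z'); case: (y == y').
- move=> x b b'; rewrite /avg_rho_x mulr_sumr; apply: eq_bigr => u _ /=.
  by rewrite mulrA -rmorphM /=; congr (_%:C * _); ring.
Qed.

Lemma I_ZY_BE : I_ZY_B rho pX pZX pY * ln 2 = condH_u - condH_zy.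
Proof.
rewrite /I_ZY_B (qcmi_cq (p := fun u => pZY u.1) (s := fun u => rho_zy u.1) (pC := pU) (sC :=
  avg_rho_u)).
- rewrite mulrBl condH_vN; congr (_ - _); rewrite /condH_zy -condH_vN; congr (_ * _).
  by rewrite (reindex (fun u : Z * Y => (u, tt))) //=; exists fst => [|[? []]].
- by move=> u; exact: pZY_distr.1.
- by move=> u; exact: rho_zy_density.
- exact: rho_u_density.
- move=> [z y] b [] [z' y'] b' []; rewrite /ptr /relabel /cq_state /=.
  rewrite (eq_bigr (fun x => ((z, y, tt) == (z', y', tt))%:R * (pX x * pZX x z * pY y)%:C * rho z
    y b b')).
    by rewrite -!mulr_suml -mulr_sumr -rmorph_sum /= -mulr_suml.
  by move=> x _; rewrite !xpair_eqE !eqxx /= !andbT.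
- by move=> u b b'; rewrite /pU mul1r.
Qed.

Lemma I_Z_B_gXE : I_Z_B_gX rho pX pZX pY * ln 2 = condH_x - condH_z.
Proof.
rewrite /I_Z_B_gX (qcmi_cq (p := fun u => pX u.2 * pZX u.2 u.1)
  (s := fun u => rho_z u.1) (pC := pX) (sC := avg_rho_x)).
- rewrite mulrBl condH_vN; congr (_ - _); rewrite /condH_z -condH_vN; congr (_ * _).
  rewrite -(pair_big predT predT (fun z x => pX x * pZX x z * vN_entropy (rho_z z))) /=.
  by apply: eq_bigr => u _; rewrite -!mulr_suml.
- by move=> u; rewrite !mulr_ge0 ?hX.1 ?(hZX _).1.
- by move=> u; exact: rho_z_density.
- exact: rho_x_density.
- move=> z b x z' b' x'; rewrite /ptr /relabel /cq_state /= /Defs.rho_z mulr_sumr.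
  apply: eq_bigr => y _; rewrite eqxx andbT !xpair_eqE [RHS]mulrA; congr (_ * _).
  by rewrite -[RHS]mulrA -rmorphM andbC.
- move=> x b b'; rewrite /avg_rho_x mulr_sumr /Defs.rho_z.
  rewrite -(pair_big predT predT (fun z y => (pX x)%:C * ((pZX x z * pY y)%:C * rho z y b b'))) /=.
  apply: eq_bigr => z _; rewrite mulr_sumr; apply: eq_bigr => y _.
  by rewrite !mulrA -!rmorphM mulrA.
Qed.

Lemma I_Z_BE : I_Z_B rho pX pZX pY * ln 2 = condH_u - condH_z.
Proof.
rewrite /I_Z_B (qcmi_cq (p := fun u => pZ u.1) (s := fun u => rho_z u.1) (pC := pU) (sC :=
  avg_rho_u)).
- rewrite mulrBl condH_vN; congr (_ - _); rewrite /condH_z -condH_vN; congr (_ * _).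
  by rewrite (reindex (fun z : Z => (z, tt))) //=; exists fst => [|[? []]].
- by move=> u; exact: pZ_distr.1.
- by move=> u; exact: rho_z_density.
- exact: rho_u_density.
- move=> z b [] z' b' []; rewrite /ptr /relabel /cq_state /=.
  rewrite (eq_bigr (fun v : X * Y => ((z, tt) == (z', tt))%:R * (pX v.1 * pZX v.1 z * pY v.2)%:C *
      rho z v.2 b b')) => [|[x y] _]; last by rewrite !xpair_eqE !eqxx /= !andbT.
  rewrite -(pair_big predT predT (fun x y => ((z, tt) == (z', tt))%:R *
    (pX x * pZX x z * pY y)%:C * rho z y b b')) exchange_big /= /Defs.rho_z mulr_sumr.
  apply: eq_bigr => y _.
  by rewrite -!mulr_suml -mulr_sumr -rmorph_sum /= -mulr_suml rmorphM !mulrA.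
- move=> u b b'; rewrite /pU mul1r /avg_rho_u /Defs.rho_z.
  rewrite -(pair_big predT predT (fun z y => (pZ z * pY y)%:C * rho z y b b')) /=.
  apply: eq_bigr => z _; rewrite mulr_sumr; apply: eq_bigr => y _.
  by rewrite mulrA -rmorphM.
Qed.
End Channel.

(** * Random codewords *)

Section TensorAverage.
Variables (R : realType) (B V : finType) (n : nat).

Lemma tens_avg (q : 'I_n -> V -> R) (A : 'I_n -> V -> op R B) :
  \sum_(v : {ffun 'I_n -> V}) (\prod_i q i (v i)) *: tens (fun i => A i (v i)) =
  tens (fun i => \sum_v q i v *: A i v).
Proof.
apply: op_ext => a b; rewrite sumE /tens.
rewrite [RHS](eq_bigr (fun i => \sum_v (q i v)%:C * A i v (a i) (b i))) => [|i _]; last first.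
  by rewrite sumE; apply: eq_bigr => v _; rewrite scaleE.
rewrite bigA_distr_bigA; apply: eq_bigr => v _.
by rewrite scaleE (rmorph_prod (real_complex R)) big_split.
Qed.

Lemma rtr_avg (T I : finType) (q : I -> R) (A : op R T) (S : I -> op R T) :
  \sum_i q i * rtr (A * S i) = rtr (A * \sum_i q i *: S i).
Proof.
rewrite mulr_sumr rtr_sum; apply: eq_bigr => i _.
by rewrite -op_scalerAr rtrZ.
Qed.

Lemma conj_avg (T I : finType) (q : I -> R) (A A' : op R T) (S : I -> op R T) :
  \sum_i q i *: (A * S i * A') = A * (\sum_i q i *: S i) * A'.
Proof.
rewrite mulr_sumr mulr_suml; apply: eq_bigr => i _.
by rewrite -op_scalerAr -op_scalerAl.
Qed.
End TensorAverage.

(** * Codeword states of length n and their averages *)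

Section NLetter.
Variables (R : realType) (X Z Y B : finType).
Variables (rho : Z -> Y -> op R B) (pX : X -> R) (pZX : X -> Z -> R) (pY : Y -> R).
Hypotheses (hrho : forall z y, density (rho z y)) (hX : distr pX)
  (hZX : forall x, distr (pZX x)) (hY : distr pY).

Local Notation pZ := (pZ pX pZX).
Local Notation rho_z := (rho_z rho pY).
Local Notation rho_xy := (rho_xy rho pZX).
Local Notation rho_y := (rho_y rho pX pZX).
Local Notation rho_zy := (rho_zy rho).
Local Notation rho_x := (avg_rho_x rho pZX pY).
Local Notation rho_u := (avg_rho_u rho pX pZX pY).
Local Notation pXZY := (pXZY pX pZX pY).

Section FixedLength.
Variable n : nat.
Local Notation seqX := (wseq n X).
Local Notation seqZ := (wseq n Z).
Local Notation seqY := (wseq n Y).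
Implicit Types (x : seqX) (z : seqZ) (y : seqY).

Definition probX x : R := \prod_i pX (x i).
Definition probZ x z : R := \prod_i pZX (x i) (z i).
Definition probY y : R := \prod_i pY (y i).

Lemma PX_ge0 x : 0 <= probX x. Proof. by apply: prodr_ge0 => i _; exact: hX.1. Qed.
Lemma PZ_ge0 x z : 0 <= probZ x z. Proof. by apply: prodr_ge0 => i _; exact: (hZX _).1. Qed.
Lemma PY_ge0 y : 0 <= probY y. Proof. by apply: prodr_ge0 => i _; exact: hY.1. Qed.
Lemma sum_PX : \sum_x probX x = 1.
Proof. exact: (prod_distr_sum1 (p := fun _ : 'I_n => pX)) (fun=> hX.2). Qed.
Lemma sum_PZ x : \sum_z probZ x z = 1.
Proof. exact: (prod_distr_sum1 (p := fun i : 'I_n => pZX (x i))) (fun i => (hZX _).2). Qed.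
Lemma sum_PY : \sum_y probY y = 1.
Proof. exact: (prod_distr_sum1 (p := fun _ : 'I_n => pY)) (fun=> hY.2). Qed.

Definition state_zy z y := tensor rho_zy (fun i => (z i, y i)).
Definition state_xy x y := tensor rho_xy (fun i => (x i, y i)).
Definition state_z z := tensor rho_z z.
Definition state_y y := tensor rho_y y.
Definition state_x x := tensor rho_x x.
Definition state_u := tensor rho_u (fun _ : 'I_n => tt).

Lemma avg_z_xy x y : \sum_z probZ x z *: state_zy z y = state_xy x y.
Proof.
rewrite (tens_avg (fun i => pZX (x i)) (fun i v => rho_zy (v, y i))).
apply: op_ext => a b; apply: eq_bigr => i _; rewrite sumE /Defs.rho_xy.
by apply: eq_bigr => z _; rewrite scaleE.
Qed.
Lemma avg_y_z z : \sum_y probY y *: state_zy z y = state_z z.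
Proof.
rewrite (tens_avg (fun=> pY) (fun i v => rho_zy (z i, v))).
apply: op_ext => a b; apply: eq_bigr => i _; rewrite sumE /Defs.rho_z.
by apply: eq_bigr => y _; rewrite scaleE.
Qed.
Lemma avg_x_y y : \sum_x probX x *: state_xy x y = state_y y.
Proof.
rewrite (tens_avg (fun=> pX) (fun i v => rho_xy (v, y i))).
apply: op_ext => a b; apply: eq_bigr => i _; rewrite sumE /Defs.rho_y /Defs.pZ.
under [RHS]eq_bigr do rewrite (rmorph_sum (real_complex R)) mulr_suml.
rewrite exchange_big; apply: eq_bigr => x _ /=; rewrite scaleE /Defs.rho_xy mulr_sumr.
by apply: eq_bigr => z _; rewrite (rmorphM (real_complex R)) mulrA.
Qed.
Lemma avg_z_x x : \sum_z probZ x z *: state_z z = state_x x.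
Proof.
rewrite (tens_avg (fun i => pZX (x i)) (fun i v => rho_z v)).
apply: op_ext => a b; apply: eq_bigr => i _; rewrite sumE /avg_rho_x.
rewrite -(pair_big predT predT (fun c d => (pZX (x i) c * pY d)%:C * rho c d (a i) (b i))) /=.
apply: eq_bigr => z _; rewrite scaleE /Defs.rho_z mulr_sumr.
by apply: eq_bigr => y _; rewrite (rmorphM (real_complex R)) mulrA.
Qed.
Lemma avg_x_u : \sum_x probX x *: state_x x = state_u.
Proof.
rewrite (tens_avg (fun=> pX) (fun i v => rho_x v)).
apply: op_ext => a b; apply: eq_bigr => i _; rewrite sumE /avg_rho_u.
rewrite (eq_bigr (fun c => \sum_(u : Z * Y) (pX c * pZX c u.1 * pY u.2)%:C * rho u.1 u.2 (a i) (b
  i))).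
  rewrite exchange_big; apply: eq_bigr => u _ /=.
  by rewrite -mulr_suml -(rmorph_sum (real_complex R)) -mulr_suml.
move=> x _; rewrite scaleE /avg_rho_x mulr_sumr; apply: eq_bigr => u _.
by rewrite mulrA -(rmorphM (real_complex R)) mulrA.
Qed.

Lemma avg_x_PZ z : \sum_x probX x * probZ x z = \prod_i pZ (z i).
Proof. by rewrite bigA_distr_bigA; apply: eq_bigr => x _; rewrite big_split. Qed.

Lemma exchange_weighted (I J : finType) (a : I -> R) (b : J -> R) (F : I -> J -> R) :
  \sum_i a i * \sum_j b j * F i j = \sum_j b j * \sum_i a i * F i j.
Proof.
under eq_bigr do rewrite mulr_sumr; rewrite exchange_big; apply: eq_bigr => j _ /=.
by rewrite mulr_sumr; apply: eq_bigr => i _; rewrite mulrCA.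
Qed.

(** The sums are nested in sampling order, so that averages over the codewords an observable ignores
    can be moved onto the state from the inside out. *)
Definition expect3 (F : seqX -> seqZ -> seqY -> R) : R :=
  \sum_x probX x * \sum_z probZ x z * \sum_y probY y * F x z y.

Lemma E3_le F G : (forall x z y, F x z y <= G x z y) -> expect3 F <= expect3 G.
Proof.
move=> h; apply: ler_sum => x _; rewrite ler_wpM2l ?PX_ge0 //.
apply: ler_sum => z _; rewrite ler_wpM2l ?PZ_ge0 //.
by apply: ler_sum => y _; rewrite ler_wpM2l ?PY_ge0.
Qed.
Lemma E3D F G : expect3 (fun x z y => F x z y + G x z y) = expect3 F + expect3 G.
Proof.
rewrite /expect3 -big_split; apply: eq_bigr => x _; rewrite /= -mulrDr -big_split.
congr (_ * _); apply: eq_bigr => z _; rewrite /= -mulrDr -big_split.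
by congr (_ * _); apply: eq_bigr => y _; rewrite mulrDr.
Qed.
Lemma E3_cst c : expect3 (fun _ _ _ => c) = c.
Proof.
rewrite /expect3 -[RHS]mul1r -sum_PX mulr_suml; apply: eq_bigr => x _; congr (_ * _).
rewrite -[RHS]mul1r -(sum_PZ x) mulr_suml; apply: eq_bigr => z _; congr (_ * _).
by rewrite -mulr_suml sum_PY mul1r.
Qed.

Definition tproj_zy (delta : R) z y := typproj rho_zy (fun i => (z i, y i)) delta.
Definition tproj_xy (delta : R) x y := typproj rho_xy (fun i => (x i, y i)) (6 * delta).
Definition tproj_y (delta : R) y := typproj rho_y y (6 * delta).
Definition tproj_z (delta : R) z := typproj rho_z z delta.
Definition tproj_x (delta : R) x := typproj rho_x x delta.
Definition tproj_u (delta : R) := typproj rho_u (fun _ : 'I_n => tt) delta.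
Definition typical_xzy (delta : R) x z y := typical pXZY (fun i => (x i, z i, y i)) delta.

Lemma E3_zy (A : seqZ -> seqY -> op R (wseq n B)) :
  expect3 (fun _ z y => rtr (A z y * state_zy z y)) =
  \sum_(z : seqZ) (\prod_i pZ (z i)) * \sum_y probY y * rtr (A z y * state_zy z y).
Proof.
rewrite /expect3; under eq_bigr do rewrite mulr_sumr.
rewrite exchange_big; apply: eq_bigr => z _ /=.
by under eq_bigr do rewrite mulrA; rewrite -mulr_suml avg_x_PZ.
Qed.
Lemma E3_xy (A : seqX -> seqY -> op R (wseq n B)) :
  expect3 (fun x z y => rtr (A x y * state_zy z y)) =
  \sum_x probX x * \sum_y probY y * rtr (A x y * state_xy x y).
Proof.
apply: eq_bigr => x _; rewrite exchange_weighted; congr (_ * _); apply: eq_bigr => y _.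
by rewrite rtr_avg avg_z_xy.
Qed.
Lemma E3_y (A : seqY -> op R (wseq n B)) :
  expect3 (fun x z y => rtr (A y * state_zy z y)) = \sum_y probY y * rtr (A y * state_y y).
Proof.
rewrite (E3_xy (fun _ => A)) exchange_weighted; apply: eq_bigr => y _.
by rewrite rtr_avg avg_x_y.
Qed.
Lemma E3_xz (A : seqX -> seqZ -> op R (wseq n B)) :
  expect3 (fun x z y => rtr (A x z * state_zy z y)) =
  \sum_x probX x * \sum_z probZ x z * rtr (A x z * state_z z).
Proof.
apply: eq_bigr => x _; congr (_ * _); apply: eq_bigr => z _.
by rewrite rtr_avg avg_y_z.
Qed.
Lemma E3_z (A : seqZ -> op R (wseq n B)) :
  expect3 (fun x z y => rtr (A z * state_zy z y)) = \sum_(z : seqZ) (\prod_i pZ (z i)) * rtr (A z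
    * state_z z).
Proof.
rewrite (E3_zy (fun z _ => A z)); apply: eq_bigr => z _.
by rewrite rtr_avg avg_y_z.
Qed.
Lemma E3_x (A : seqX -> op R (wseq n B)) :
  expect3 (fun x z y => rtr (A x * state_zy z y)) = \sum_x probX x * rtr (A x * state_x x).
Proof.
rewrite (E3_xz (fun x _ => A x)); apply: eq_bigr => x _.
by rewrite rtr_avg avg_z_x.
Qed.
Lemma E3_u (A : op R (wseq n B)) :
  expect3 (fun x z y => rtr (A * state_zy z y)) = rtr (A * state_u).
Proof. by rewrite (E3_x (fun _ => A)) rtr_avg avg_x_u. Qed.

(** Collects every failure not caused by a wrong codeword. It dominates both the cost of smoothing
    and, up to a constant, the deficit of either decoder, so only its O(1/n) average has to be
    controlled. *)
Definition codeword_defect (delta : R) x z y : R :=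
  (~~ typical_xzy delta x z y)%:R + rtr ((1 - tproj_zy delta z y) * state_zy z y)
  + rtr ((1 - tproj_xy delta x y) * state_zy z y) + rtr ((1 - tproj_y delta y) * state_zy z y)
  + rtr ((1 - tproj_z delta z) * state_zy z y) + rtr ((1 - tproj_x delta x) * state_zy z y)
  + rtr ((1 - tproj_u delta) * state_zy z y).
End FixedLength.

Lemma pXZY_distr : distr pXZY.
Proof.
have hXZ := distr_prod hX hZX; have := distr_prod hXZ (fun=> hY).
by rewrite (_ : (fun _ => _) = pXZY) //; apply/funext => -[[x z] y].
Qed.

Lemma defect_avg (delta : R) : 0 < delta < 1/64 -> exists2 C : R, 0 <= C &
  forall n, (0 < n)%N -> expect3 (@codeword_defect n delta) <= C / n%:R.
Proof.
move=> /andP[d0 d1].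
have dd : 0 < delta < 1 by apply/andP; split; lra.
have dd6 : 0 < 6 * delta < 1 by apply/andP; split; lra.
have [C1 C10 h1] := typical_LLN pXZY_distr d0.
have [C2 C20 h2] := typproj_deficit_avg (pZY_distr hX hZX hY) (rho_zy_density hrho) dd.
have [C3 C30 h3] := typproj_deficit_avg (pXY_distr hX hY) (rho_xy_density hrho hZX) dd6.
have [C4 C40 h4] := typproj_deficit_avg hY (rho_y_density hrho hX hZX) dd6.
have [C5 C50 h5] := typproj_deficit_avg (pZ_distr hX hZX) (rho_z_density hrho hY) dd.
have [C6 C60 h6] := typproj_deficit_avg hX (rho_x_density hrho hZX hY) dd.
have [C7 C70 h7] := typproj_deficit_avg (pU_distr R) (rho_u_density hrho hX hZX hY) dd.
exists (C1 + C2 + C3 + C4 + C5 + C6 + C7) => [|n n0]; first by rewrite !addr_ge0.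
rewrite /codeword_defect !E3D !mulrDl; apply: lerD; first (apply: lerD; first (apply: lerD;
  first (apply: lerD; first (apply: lerD; first apply: lerD)))).
- apply: le_trans (h1 n n0); rewrite sum_ffun_pair sum_ffun_pair /expect3.
  rewrite le_eqVlt; apply/orP; left; apply/eqP.
  apply: eq_bigr => x _; rewrite mulr_sumr; apply: eq_bigr => z _; rewrite mulrA mulr_sumr.
  apply: eq_bigr => y _; rewrite mulrA; congr (_ * _).
    by rewrite -!big_split; apply: eq_bigr => i _; rewrite !ffunE.
  by rewrite /typical_xzy -ffun_pairE; congr ((~~ typical _ _ _)%:R); apply/funext => i;
    rewrite ffunE.
- apply: le_trans (h2 n n0); rewrite E3_zy sum_ffun_pair le_eqVlt; apply/orP; left; apply/eqP.
  apply: eq_bigr => z _; rewrite mulr_sumr; apply: eq_bigr => y _; rewrite mulrA; congr (_ * _).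
    by rewrite -!big_split; apply: eq_bigr => i _; rewrite !ffunE.
  by rewrite /tproj_zy /state_zy ffun_pairE.
- apply: le_trans (h3 n n0); rewrite E3_xy sum_ffun_pair le_eqVlt; apply/orP; left; apply/eqP.
  apply: eq_bigr => x _; rewrite mulr_sumr; apply: eq_bigr => y _; rewrite mulrA; congr (_ * _).
    by rewrite -!big_split; apply: eq_bigr => i _; rewrite !ffunE.
  by rewrite /tproj_xy /state_xy ffun_pairE.
- by rewrite E3_y; exact: h4.
- by rewrite E3_z; exact: h5.
- by rewrite E3_x; exact: h6.
(* Only one sequence over [unit] exists and it has weight 1, so the averaged deficit is that of the
   overall state itself. *)
rewrite E3_u; apply: le_trans (h7 n n0); rewrite (bigD1 [ffun=> tt]) //= (_ : \prod_i _ = 1);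
  last by rewrite big1.
rewrite mul1r [X in _ <= _ + X]big1 => [|w /eqP []]; last by apply/ffunP => i; case: (w i);
  rewrite ffunE.
rewrite addr0 /tproj_u /state_u.
have -> : (fun _ : 'I_n => tt) = [ffun=> tt] by apply/funext => i; rewrite ffunE.
by [].
Qed.
End NLetter.

(** * Smoothed states and the two decoders *)

Section Smoothing.
Variables (R : realType) (X Z Y B : finType).
Variables (rho : Z -> Y -> op R B) (pX : X -> R) (pZX : X -> Z -> R) (pY : Y -> R).
Hypotheses (hrho : forall z y, density (rho z y)) (hX : distr pX)
  (hZX : forall x, distr (pZX x)) (hY : distr pY).
Variables (n : nat) (delta eps : R).
Hypotheses (n0 : (0 < n)%N) (d0 : 0 < delta) (d1 : delta < 1/64).

Local Notation seqX := (wseq n X).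
Local Notation seqZ := (wseq n Z).
Local Notation seqY := (wseq n Y).
Implicit Types (x : seqX) (z : seqZ) (y : seqY).
Local Notation PX := (probX pX).
Local Notation PZ := (probZ pZX).
Local Notation PY := (probY pY).
Local Notation st_zy := (state_zy rho).
Local Notation st_xy := (state_xy rho pZX).
Local Notation st_z := (state_z rho pY).
Local Notation st_y := (state_y rho pX pZX).
Local Notation st_x := (state_x rho pZX pY).
Local Notation st_u := (state_u rho pX pZX pY (n := n)).
Local Notation Tzy := (tproj_zy rho delta).
Local Notation Txy := (tproj_xy rho pZX delta).
Local Notation Ty := (tproj_y rho pX pZX delta).
Local Notation Tz := (tproj_z rho pY delta).
Local Notation Tx := (tproj_x rho pZX pY delta).
Local Notation Tu := (tproj_u rho pX pZX pY (n := n) delta).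
Local Notation typ_xzy := (typical_xzy pX pZX pY delta).
Local Notation defect := (codeword_defect rho pX pZX pY delta).
Local Notation dec1 := (dec1_proj rho pX pZX pY delta eps).
Local Notation dec2 := (dec2_proj rho pX pZX pY delta).

Let Tzy_proj z y : projector (Tzy z y).
Proof. exact: (typproj_projector (rho_zy_density hrho) _ _). Qed.
Let Txy_proj x y : projector (Txy x y).
Proof. exact: (typproj_projector (rho_xy_density hrho hZX) _ _). Qed.
Let Ty_proj y : projector (Ty y).
Proof. exact: (typproj_projector (rho_y_density hrho hX hZX) _ _). Qed.
Let Tz_proj z : projector (Tz z).
Proof. exact: (typproj_projector (rho_z_density hrho hY) _ _). Qed.
Let Tx_proj x : projector (Tx x).
Proof. exact: (typproj_projector (rho_x_density hrho hZX hY) _ _). Qed.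
Let Tu_proj : projector Tu.
Proof. exact: (typproj_projector (rho_u_density hrho hX hZX hY) _ _). Qed.

Lemma st_zy_ge0 z y : 0 ⪯ st_zy z y.
Proof. exact: (tensor_ge0 (rho_zy_density hrho) _). Qed.

Lemma rtr_proj_st (P : op R (wseq n B)) z y : projector P -> 0 <= rtr (P * st_zy z y).
Proof.
rewrite /state_zy => hP; have [S -> _] := tensor_sqrt (rho_zy_density hrho) (fun i => (z i, y i)).
by rewrite mulrA rtrC mulrA -nrm2_proj // nrm2_ge0.
Qed.

Lemma rtr_st z y : rtr (st_zy z y) = 1.
Proof. exact: (rtr_tensor (rho_zy_density hrho) _). Qed.

(* Conjugation by a typical projector of a state does not increase that state,
   so the averages over y, then z, then x can be taken from the inside out and
   each of them meets the projector that bounds it. *)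
Definition smoother x z : op R (wseq n B) := Tu * (Tx x * Tz z).
(** Vanishing on atypical triples makes the averaged norm bounds hold for every [x] and [z]: if one
    of these is atypical, all terms are zero. *)
Definition smooth x z y : op R (wseq n B) :=
  if typ_xzy x z y then smoother x z * st_zy z y * adj (smoother x z) else 0.

Lemma defect_ge0 x z y : 0 <= defect x z y.
Proof.
have h P : projector P -> 0 <= rtr ((1 - P) * st_zy z y).
  by move=> hP; exact/rtr_proj_st/projector_compl.
by rewrite /codeword_defect !addr_ge0 ?ler0n // h.
Qed.

(** Gentle measurement for the square root: each of the three projectors adds its deficit on [S] by
    [nrm2_proj_step]. For an atypical triple [S'] is 0, and the distance 1 is paid by the indicator
    in the defect. *)
Lemma smooth_sqrt x z y : exists S S', [/\ st_zy z y = S * adj S, nrm2 S = 1,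
  smooth x z y = S' * adj S' & nrm2 (S - S') <= defect x z y].
Proof.
have [S eS S1] := tensor_sqrt (rho_zy_density hrho) (fun i => (z i, y i)).
have h P : projector P -> nrm2 ((1 - P) * S) = rtr ((1 - P) * st_zy z y).
  move=> hP; rewrite nrm2_proj; last exact: projector_compl.
  by rewrite /state_zy eS mulrA [RHS]rtrC mulrA.
exists S, (if typ_xzy x z y then smoother x z * S else 0); split=> //.
  rewrite /smooth; case: typ_xzy; last by rewrite mul0r.
  by rewrite adjM /state_zy eS !mulrA.
have g1 : 0 <= rtr ((1 - Tzy z y) * st_zy z y) by exact/rtr_proj_st/projector_compl.
have g2 : 0 <= rtr ((1 - Txy x y) * st_zy z y) by exact/rtr_proj_st/projector_compl.
have g3 : 0 <= rtr ((1 - Ty y) * st_zy z y) by exact/rtr_proj_st/projector_compl.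
have g4 : 0 <= rtr ((1 - Tz z) * st_zy z y) by exact/rtr_proj_st/projector_compl.
have g5 : 0 <= rtr ((1 - Tx x) * st_zy z y) by exact/rtr_proj_st/projector_compl.
have g6 : 0 <= rtr ((1 - Tu) * st_zy z y) by exact/rtr_proj_st/projector_compl.
rewrite /codeword_defect; case: (typ_xzy x z y) => /=; last first.
  by rewrite subr0 S1; lra.
rewrite /smoother -!mulrA.
have := nrm2_proj_step S (Tx x * (Tz z * S)) Tu_proj.
have := nrm2_proj_step S (Tz z * S) (Tx_proj x).
have -> : S - Tz z * S = (1 - Tz z) * S by rewrite mulrBl mul1r.
by rewrite !h //; lra.
Qed.

Lemma seq_error_smooth (I : eqType) (ks : seq I) (k0 : I) (P : I -> op R (wseq n B))
    (g : I -> bool) (t : R) x z y :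
  uniq ks -> k0 \in ks -> g k0 -> (forall k, projector (P k)) -> 0 < t ->
  seq_error (st_zy z y) [seq (P k, g k) | k <- ks] <=
    t + t^-1 * (12 * defect x z y + 6 * rtr ((1 - P k0) * st_zy z y) +
                3 * \sum_(k <- ks | k != k0) rtr (P k * smooth x z y)).
Proof.
move=> uks kks gk hP t0; have [S [S' [eS S1 eS' hd]]] := smooth_sqrt x z y.
rewrite eS; apply: le_trans (seq_error_le S' uks kks gk hP S1 t0) _.
rewrite lerD2l ler_wpM2l ?invr_ge0 ?(ltW t0) //.
have -> : nrm2 ((1 - P k0) * S) = rtr ((1 - P k0) * (S * adj S)).
  by rewrite nrm2_proj; [rewrite mulrA [RHS]rtrC mulrA | exact: projector_compl].
have -> : \sum_(k <- ks | k != k0) nrm2 (P k * S') = \sum_(k <- ks | k != k0) rtr (P k * smooth x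
  z y).
  by apply: eq_bigr => k _; rewrite nrm2_proj // eS' mulrA [RHS]rtrC mulrA.
by lra.
Qed.

Lemma rtr_smooth_le (P : op R (wseq n B)) (b : R) x z y :
  0 <= b -> P ⪯ b *: (1 : op R (wseq n B)) -> rtr (P * smooth x z y) <= b.
Proof.
move=> b0 hP; have [S [S' [eS S1 eS' hd]]] := smooth_sqrt x z y.
rewrite eS' mulrA rtrC mulrA; apply: le_trans (hP S') _.
rewrite -op_scalerAr -op_scalerAl rtrZ mulr1 -/(nrm2 S') ler_piMr //.
have -> : nrm2 S' = rtr (smooth x z y) by rewrite eS' rtrC.
rewrite /smooth; case: typ_xzy; last by rewrite rtr0 ler01.
have [a1 a2] := Tu_proj; have [b1 b2] := Tx_proj x; have [c1 c2] := Tz_proj z.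
have -> : smoother x z * st_zy z y * adj (smoother x z) = Tu * (Tx x * (Tz z * st_zy z y * Tz z)
  * Tx x) * Tu.
  by rewrite /smoother !adjM a1 b1 c1 !mulrA.
have h0 := st_zy_ge0 z y.
have h1 := lea0_conj (Tz z) h0; rewrite c1 in h1.
have h2 := lea0_conj (Tx x) h1; rewrite b1 in h2.
apply: le_trans (proj_conj_le Tu_proj h2) _; apply: le_trans (proj_conj_le (Tx_proj x) h1) _.
by apply: le_trans (proj_conj_le (Tz_proj z) h0) _; rewrite rtr_st.
Qed.

(** * Marginals of a typical triple *)

Section TypicalMarginals.
Variables (x : seqX) (z : seqZ) (y : seqY).
Hypothesis ht : typ_xzy x z y.

Let sum3 (F : X -> Z -> Y -> R) (P : pred (X * Z * Y)) :
  (forall a b c, F a b c = if P (a, b, c) then pX a * pZX a b * pY c else 0) ->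
  \sum_(u | P u) pXZY pX pZX pY u = \sum_a \sum_b \sum_c F a b c.
Proof.
move=> h; rewrite big_mkcond pair_big pair_big /=; apply: eq_bigr => -[[a b] c] _.
by rewrite h.
Qed.
Let pick1 (T : finType) (F : T -> R) (t0 : T) : \sum_t (if t == t0 then F t else 0) = F t0.
Proof. by rewrite -big_mkcond big_pred1_eq. Qed.

Lemma typical_zy : typical (pZY pX pZX pY) (fun i => (z i, y i)) delta.
Proof.
apply: (typical_marg (f := fun t : X * Z * Y => (t.1.2, t.2)) _ ht) => -[z0 y0].
rewrite (sum3 (F := fun a b c => if b == z0 then if c == y0 then pX a * pZX a b * pY c else 0
  else 0)).
  rewrite /pZY /= mulr_suml; apply: eq_bigr => a _.
  rewrite -[LHS](pick1 (fun c => pX a * pZX a z0 * pY c)).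
  rewrite -[LHS](pick1 (fun b => \sum_c if c == y0 then pX a * pZX a b * pY c else 0)).
  by apply: eq_bigr => b _; case: eqP => // _; rewrite big1.
by move=> a b c; rewrite /= xpair_eqE; do 2!case: eqP.
Qed.

Lemma typical_xz : typical (pXZ pX pZX) (fun i => (x i, z i)) delta.
Proof.
apply: (typical_marg (f := fun t : X * Z * Y => t.1) _ ht) => -[x0 z0].
rewrite (sum3 (F := fun a b c => if a == x0 then if b == z0 then pX a * pZX a b * pY c else 0
  else 0)).
  rewrite /pXZ -[LHS]mulr1 -hY.2 mulr_sumr.
  rewrite -[LHS](pick1 (fun b => \sum_c pX x0 * pZX x0 b * pY c)).
  rewrite -[LHS](pick1 (fun a => \sum_b if b == z0 then \sum_c pX a * pZX a b * pY c else 0)).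
  apply: eq_bigr => a _; case: eqP => _; last by rewrite big1 // => b _; rewrite big1.
  by apply: eq_bigr => b _; case: eqP => // _; rewrite big1.
by move=> a b c; rewrite /= xpair_eqE; do 2!case: eqP.
Qed.

Lemma typical_xy : typical (pXY pX pY) (fun i => (x i, y i)) delta.
Proof.
apply: (typical_marg (f := fun t : X * Z * Y => (t.1.1, t.2)) _ ht) => -[x0 y0].
rewrite (sum3 (F := fun a b c => if a == x0 then if c == y0 then pX a * pZX a b * pY c else 0
  else 0)).
  transitivity (\sum_a if a == x0 then pX x0 * pY y0 else 0); first by rewrite pick1.
  apply: eq_bigr => a _; case: eqP => [->|_]; last by rewrite big1 // => b _; rewrite big1.
  under eq_bigr do rewrite pick1.
  by rewrite -mulr_suml -mulr_sumr (hZX x0).2 mulr1.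
by move=> a b c; rewrite /= xpair_eqE; do 2!case: eqP.
Qed.

Lemma typical_x : typical pX x delta.
Proof.
have e a : pX a = \sum_(u : X * Z | u.1 == a) pXZ pX pZX u.
  rewrite (eq_bigl (fun u : X * Z => (u.1 == a) && true)) => [|u]; last by rewrite andbT.
  rewrite (eq_bigr (fun u => pX u.1 * pZX u.1 u.2)) => [|[] //].
  rewrite -(pair_big (pred1 a) predT (fun a b => pX a * pZX a b)) /=.
  by rewrite big_pred1_eq -mulr_sumr (hZX a).2 mulr1.
exact: (typical_marg (f := fst) e typical_xz).
Qed.

Lemma typical_z : typical (pZ pX pZX) z delta.
Proof.
have e a : pZ pX pZX a = \sum_(u : X * Z | u.2 == a) pXZ pX pZX u.
  rewrite (eq_bigl (fun u : X * Z => true && (u.2 == a))) //.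
  rewrite (eq_bigr (fun u => pX u.1 * pZX u.1 u.2)) => [|[] //].
  rewrite -(pair_big predT (pred1 a) (fun a b => pX a * pZX a b)) /=.
  by apply: eq_bigr => b _; rewrite big_pred1_eq.
exact: (typical_marg (f := snd) e typical_xz).
Qed.

Lemma typical_y : typical pY y delta.
Proof.
have e a : pY a = \sum_(u : X * Y | u.2 == a) pXY pX pY u.
  rewrite (eq_bigl (fun u : X * Y => true && (u.2 == a))) //.
  rewrite -(pair_big predT (pred1 a) (fun a b => pX a * pY b)) /=.
  by under eq_bigr do rewrite big_pred1_eq; rewrite -mulr_suml hX.2 mul1r.
exact: (typical_marg (f := snd) e typical_xy).
Qed.

Lemma typical_u : typical (pU R) (fun _ : 'I_n => tt) delta.
Proof.
have e a : pU R a = \sum_(u : X | tt == a) pX u by case: a; rewrite hX.2.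
exact: (typical_marg (f := fun=> tt) e typical_x).
Qed.
End TypicalMarginals.

(** This puts [eps] below 1/64, keeps [(1 - sqrt eps)^-2] below 2 for the two nested constructions,
    and makes the constant [3 * (1 + 2 / sqrt eps)] of [Ceps_deficit] equal to 63. *)
Hypothesis heps : Num.sqrt eps = 1 / 10.

Let eps0 : 0 < Num.sqrt eps. Proof. by rewrite heps; lra. Qed.
Let eps1 : Num.sqrt eps < 1. Proof. by rewrite heps; lra. Qed.

Lemma dec1_projector x z y : projector (dec1 x z y).
Proof.
rewrite /dec1_proj; case: typical; last exact: projector0.
exact: (Ceps_projector (Ceps_projector (Tzy_proj z y) (Txy_proj x y) eps0 eps1) (Ty_proj y) eps0
  eps1).
Qed.

Lemma dec2_projector x z : projector (dec2 x z).
Proof. by rewrite /dec2_proj; case: typical; [exact: Tz_proj | exact: projector0]. Qed.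

Lemma dec1_le x z y : typ_xzy x z y ->
  dec1 x z y ⪯ 2 *: (Ty y * Txy x y * Tzy z y * Txy x y * Ty y).
Proof.
move=> ht; rewrite /dec1_proj (_ : typical _ _ _ = true) //.
rewrite -/(Tzy z y) -/(Txy x y) -/(Ty y).
have h1 := Ceps_le (Tzy_proj z y) (Txy_proj x y) eps0 eps1.
have hP := Ceps_projector (Tzy_proj z y) (Txy_proj x y) eps0 eps1.
have h2 := Ceps_le hP (Ty_proj y) eps0 eps1.
have h3 := lea_conj (Ty y) h1; rewrite (Ty_proj y).1 in h3.
have c0 : 0 <= (1 - Num.sqrt eps)^-1 by rewrite invr_ge0 heps; lra.
apply: (lea_trans h2); apply: (lea_trans (leaZ c0 h3)).
rewrite -op_scalerAr -op_scalerAl scalerA !mulrA; apply: leaZr.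
  by rewrite heps -invfM -[leRHS]invrK lef_pV2 ?posrE; lra.
have := lea0_conj (Txy x y * Ty y) (projector_ge0 (Tzy_proj z y)).
by rewrite adjM (Txy_proj x y).1 (Ty_proj y).1 !mulrA.
Qed.

(** The nested constructions give 63 times the deficit for [rho_y] plus [63 ^+ 2] times those for
    [rho_zy] and [rho_xy]. An atypical triple has decoder 0 and defect at least 1. *)
Lemma dec1_deficit x z y : rtr ((1 - dec1 x z y) * st_zy z y) <= 63 ^+ 2 * defect x z y.
Proof.
have g1 : 0 <= rtr ((1 - Tzy z y) * st_zy z y) by exact/rtr_proj_st/projector_compl.
have g2 : 0 <= rtr ((1 - Txy x y) * st_zy z y) by exact/rtr_proj_st/projector_compl.
have g3 : 0 <= rtr ((1 - Ty y) * st_zy z y) by exact/rtr_proj_st/projector_compl.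
have g4 : 0 <= rtr ((1 - Tz z) * st_zy z y) by exact/rtr_proj_st/projector_compl.
have g5 : 0 <= rtr ((1 - Tx x) * st_zy z y) by exact/rtr_proj_st/projector_compl.
have g6 : 0 <= rtr ((1 - Tu) * st_zy z y) by exact/rtr_proj_st/projector_compl.
rewrite /codeword_defect; case ht: (typ_xzy x z y) => /=; last first.
  have -> : dec1 x z y = 0 by rewrite /dec1_proj; move: ht; rewrite /typical_xzy => ->.
  by rewrite subr0 mul1r rtr_st; lra.
have [S eS S1] := tensor_sqrt (rho_zy_density hrho) (fun i => (z i, y i)).
have h P : projector P -> nrm2 ((1 - P) * S) = rtr ((1 - P) * st_zy z y).
  move=> hP; rewrite nrm2_proj; last exact: projector_compl.
  by rewrite /state_zy eS mulrA [RHS]rtrC mulrA.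
rewrite -h; last exact: dec1_projector.
rewrite /dec1_proj (_ : typical _ _ _ = true) //.
rewrite -/(Tzy z y) -/(Txy x y) -/(Ty y).
have hP := Ceps_projector (Tzy_proj z y) (Txy_proj x y) eps0 eps1.
have h1 := Ceps_deficit (Tzy_proj z y) (Txy_proj x y) eps0 eps1 S.
have h2 := Ceps_deficit hP (Ty_proj y) eps0 eps1 S.
have e : 3 * (1 + 2 / Num.sqrt eps) = 63 by rewrite heps; field.
move: h1 h2; rewrite e (h _ (Tzy_proj z y)) (h _ (Txy_proj x y)) (h _ (Ty_proj y)).
by lra.
Qed.

Lemma dec2_deficit x z y : rtr ((1 - dec2 x z) * st_zy z y) <= defect x z y.
Proof.
have g1 : 0 <= rtr ((1 - Tzy z y) * st_zy z y) by exact/rtr_proj_st/projector_compl.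
have g2 : 0 <= rtr ((1 - Txy x y) * st_zy z y) by exact/rtr_proj_st/projector_compl.
have g3 : 0 <= rtr ((1 - Ty y) * st_zy z y) by exact/rtr_proj_st/projector_compl.
have g4 : 0 <= rtr ((1 - Tz z) * st_zy z y) by exact/rtr_proj_st/projector_compl.
have g5 : 0 <= rtr ((1 - Tx x) * st_zy z y) by exact/rtr_proj_st/projector_compl.
have g6 : 0 <= rtr ((1 - Tu) * st_zy z y) by exact/rtr_proj_st/projector_compl.
have hn : (0 : R) <= (~~ typ_xzy x z y)%:R by rewrite ler0n.
rewrite /codeword_defect /dec2_proj; case hxz: typical; first by rewrite -/(Tz z); lra.
case ht: (typ_xzy x z y) => /=; first by rewrite (typical_xz ht) in hxz.
by rewrite subr0 mul1r rtr_st; lra.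
Qed.
(** [Up] bounds the rank of a typical projector and [Lo] the norm of a sandwiched state; their
    product decays at the rate of an entropy difference, up to the [8 * delta] slack. *)
Let Up (H : R) : R := expR (n%:R * ((1 + 8 * delta) * H)).
Let Lo (H : R) : R := expR (- (n%:R * ((1 - 8 * delta) * H))).
Local Notation one := (1 : op R (wseq n B)).
Local Notation Hzy := (condH_zy rho pX pZX pY).
Local Notation Hxy := (condH_xy rho pX pZX pY).
Local Notation Hy := (condH_y rho pX pZX pY).
Local Notation Hz := (condH_z rho pX pZX pY).
Local Notation Hx := (condH_x rho pX pZX pY).
Local Notation Hu := (condH_u rho pX pZX pY).
Local Notation E3 := (expect3 pX pZX pY).

Let ddle : delta <= 6 * delta. Proof. by move: d0; lra. Qed.
Let Up0 H : 0 <= Up H. Proof. exact: expR_ge0. Qed.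
Let Lo0 H : 0 <= Lo H. Proof. exact: expR_ge0. Qed.

Lemma conj_proj_le1 (P A : op R (wseq n B)) (b : R) : projector P -> 0 <= b ->
  A ⪯ b *: one -> P * A * P ⪯ b *: one.
Proof.
move=> hP b0 hA; have := lea_conj P hA; rewrite hP.1 => h; apply: (lea_trans h).
rewrite -op_scalerAr -op_scalerAl mulr1 hP.2; apply: leaZ => //.
exact: projector_le1.
Qed.

Lemma lea0_scale_one (b : R) : 0 <= b -> 0 ⪯ b *: one.
Proof. by move=> b0; apply: lea0Z => //; apply: projector_ge0; split; rewrite ?adj1 ?mulr1. Qed.

Lemma rtr_proj_le (P A : op R (wseq n B)) (b : R) : projector P -> A ⪯ b *: one ->
  rtr (P * A) <= b * rtr P.
Proof.
move=> [h1 h2] hA; have := hA P; rewrite h1 -op_scalerAr -op_scalerAl rtrZ mulr1 h2.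
by rewrite rtrC mulrA h2.
Qed.

Lemma dec1_eq0 x z y : ~~ typ_xzy x z y -> dec1 x z y = 0.
Proof. by rewrite /dec1_proj /typical_xzy => /negPf ->. Qed.

(** The innermost typical projector is traded for a multiple of its state, which averages over [z]
    to exactly the state that [Txy] is adapted to. *)
Lemma dec1_le_st x z y :
  dec1 x z y ⪯ (2 * Up Hzy) *: (Ty y * (Txy x y * st_zy z y * Txy x y) * Ty y).
Proof.
have h0 : 0 ⪯ Ty y * (Txy x y * st_zy z y * Txy x y) * Ty y.
  have := lea0_conj (Ty y) (lea0_conj (Txy x y) (st_zy_ge0 z y)).
  by rewrite (Ty_proj y).1 (Txy_proj x y).1.
case: (boolP (typ_xzy x z y)) => ht; last by rewrite dec1_eq0 //; apply: lea0Z; rewrite ?mulr_ge0.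
apply: (lea_trans (dec1_le ht)).
rewrite -scalerA; apply: leaZ => //.
have h : Tzy z y ⪯ Up Hzy *: st_zy z y.
  exact: (typproj_le (pZY_distr hX hZX hY) (rho_zy_density hrho) d0 d1 ddle n0 (typical_zy ht)).
have := lea_conj (Txy x y * Ty y) h.
by rewrite adjM (Ty_proj y).1 (Txy_proj x y).1 -op_scalerAr -op_scalerAl !mulrA.
Qed.

Lemma avg_dec1_z x y :
  \sum_z PZ x z *: dec1 x z y ⪯ (2 * Up Hzy) *: (Ty y * (Txy x y * st_xy x y * Txy x y) * Ty y).
Proof.
rewrite -avg_z_xy -conj_avg -conj_avg scaler_sumr; apply: lea_sum => z _.
by rewrite scalerA mulrC -scalerA; apply: leaZ; [exact: PZ_ge0 | exact: dec1_le_st].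
Qed.

Lemma avg_dec1_z_le x y : \sum_z PZ x z *: dec1 x z y ⪯ (2 * Up Hzy * Lo Hxy) *: one.
Proof.
have b0 : 0 <= 2 * Up Hzy by rewrite mulr_ge0.
case: (boolP (typical (pXY pX pY) (fun i => (x i, y i)) delta)) => ht; last first.
  rewrite big1 => [|z _]; first by apply: lea0_scale_one; rewrite mulr_ge0.
  by rewrite dec1_eq0 ?scaler0 //; apply: contra ht; exact: typical_xy.
apply: (lea_trans (avg_dec1_z x y)); rewrite -(scalerA (2 * Up Hzy)); apply: leaZ => //.
apply: conj_proj_le1 => //.
exact: (typproj_sandwich (pXY_distr hX hY) (rho_xy_density hrho hZX) d0 d1 (lexx _) n0 ht).
Qed.

(** After the average over [z], the inner sandwich is dropped, since [Txy] does not increase its own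
    state; the average over [x] then yields the state of [y], which meets [Ty]. This is why [rho_y]
    must be the outer projector. *)
Lemma avg_dec1_xz_le y :
  \sum_x PX x *: \sum_z PZ x z *: dec1 x z y ⪯ (2 * Up Hzy * Lo Hy) *: one.
Proof.
have b0 : 0 <= 2 * Up Hzy by rewrite mulr_ge0.
case: (boolP (typical pY y delta)) => ht; last first.
  rewrite big1 => [|x _]; first by apply: lea0_scale_one; rewrite mulr_ge0.
  rewrite big1 ?scaler0 // => z _.
  by rewrite dec1_eq0 ?scaler0 //; apply: contra ht; exact: typical_y.
have h : \sum_x PX x *: \sum_z PZ x z *: dec1 x z y ⪯ (2 * Up Hzy) *: (Ty y * st_y y * Ty y).
  rewrite -avg_x_y -conj_avg scaler_sumr; apply: lea_sum => x _.
  rewrite scalerA mulrC -scalerA; apply: leaZ; first exact: PX_ge0.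
  apply: (lea_trans (avg_dec1_z x y)); apply: leaZ => //.
  have := lea_conj (Ty y) (typproj_sandwich_le (rho_xy_density hrho hZX) (fun i => (x i, y i)) (6
    * delta)).
  by rewrite (Ty_proj y).1.
apply: (lea_trans h); rewrite -(scalerA (2 * Up Hzy)); apply: leaZ => //.
exact: (typproj_sandwich hY (rho_y_density hrho hX hZX) d0 d1 (lexx _) n0 ht).
Qed.

Lemma rtr_dec1 x z y : rtr (dec1 x z y) <= 2 * Up Hzy.
Proof.
case: (boolP (typ_xzy x z y)) => ht; last by rewrite dec1_eq0 // rtr0 mulr_ge0.
apply: le_trans (lea_rtr (dec1_le ht)) _; rewrite rtrZ ler_wpM2l //.
have h1 := projector_ge0 (Tzy_proj z y).
have h2 := lea0_conj (Txy x y) h1; rewrite (Txy_proj x y).1 in h2.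
rewrite -(mulrA (Ty y)) -(mulrA (Ty y)); apply: le_trans (proj_conj_le (Ty_proj y) h2) _.
apply: le_trans (proj_conj_le (Txy_proj x y) h1) _.
exact: (rtr_typproj (pZY_distr hX hZX hY) (rho_zy_density hrho) d0 d1 ddle n0 (typical_zy ht)).
Qed.

Lemma rtr_dec2 x z : rtr (dec2 x z) <= Up Hz.
Proof.
rewrite /dec2_proj; case: (boolP (typical _ _ _)) => ht; last by rewrite rtr0.
have e a : pZ pX pZX a = \sum_(u : X * Z | u.2 == a) pXZ pX pZX u.
  rewrite (eq_bigl (fun u : X * Z => true && (u.2 == a))) //.
  rewrite (eq_bigr (fun u => pX u.1 * pZX u.1 u.2)) => [|[] //].
  rewrite -(pair_big predT (pred1 a) (fun a b => pX a * pZX a b)) /=.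
  by apply: eq_bigr => b _; rewrite big_pred1_eq.
have hz : typical (pZ pX pZX) z delta := typical_marg (f := snd) e ht.
exact: (rtr_typproj (pZ_distr hX hZX) (rho_z_density hrho hY) d0 d1 ddle n0 hz).
Qed.

Lemma smooth_le x z y :
  smooth x z y ⪯ Tu * (Tx x * (Tz z * st_zy z y * Tz z) * Tx x) * Tu.
Proof.
have h0 := lea0_conj (Tu) (lea0_conj (Tx x) (lea0_conj (Tz z) (st_zy_ge0 z y))).
rewrite Tu_proj.1 (Tx_proj x).1 (Tz_proj z).1 in h0.
rewrite /smooth; case: ifP => // _.
by rewrite /smoother !adjM Tu_proj.1 (Tx_proj x).1 (Tz_proj z).1 !mulrA; exact: lea_refl.
Qed.

Lemma smooth_eq0 x z y : ~~ typ_xzy x z y -> smooth x z y = 0.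
Proof. by rewrite /smooth => /negPf ->. Qed.

Lemma avg_smooth_y x z :
  \sum_y PY y *: smooth x z y ⪯ Tu * (Tx x * (Tz z * st_z z * Tz z) * Tx x) * Tu.
Proof.
rewrite -avg_y_z -!conj_avg; apply: lea_sum => y _.
by apply: leaZ; [exact: PY_ge0 | exact: smooth_le].
Qed.

Lemma avg_smooth_zy x :
  \sum_z PZ x z *: \sum_y PY y *: smooth x z y ⪯ Tu * (Tx x * st_x x * Tx x) * Tu.
Proof.
rewrite -avg_z_x -!conj_avg; apply: lea_sum => z _; apply: leaZ; first exact: PZ_ge0.
apply: (lea_trans (avg_smooth_y x z)).
have := lea_conj Tu (lea_conj (Tx x) (typproj_sandwich_le (rho_z_density hrho hY) z delta)).
by rewrite Tu_proj.1 (Tx_proj x).1.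
Qed.

Lemma avg_smooth_y_le x z : \sum_y PY y *: smooth x z y ⪯ Lo Hz *: one.
Proof.
case: (boolP (typical (pZ pX pZX) z delta)) => ht; last first.
  rewrite big1 => [|y _]; first exact: lea0_scale_one.
  by rewrite smooth_eq0 ?scaler0 //; apply: contra ht; exact: typical_z.
apply: (lea_trans (avg_smooth_y x z)); do 2![apply: conj_proj_le1 => //].
exact: (typproj_sandwich (pZ_distr hX hZX) (rho_z_density hrho hY) d0 d1 ddle n0 ht).
Qed.

Lemma avg_smooth_zy_le x : \sum_z PZ x z *: \sum_y PY y *: smooth x z y ⪯ Lo Hx *: one.
Proof.
case: (boolP (typical pX x delta)) => ht; last first.
  rewrite big1 => [|z _]; first exact: lea0_scale_one.
  rewrite big1 ?scaler0 // => y _.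
  by rewrite smooth_eq0 ?scaler0 //; apply: contra ht; exact: typical_x.
apply: (lea_trans (avg_smooth_zy x)); apply: conj_proj_le1 => //.
exact: (typproj_sandwich hX (rho_x_density hrho hZX hY) d0 d1 ddle n0 ht).
Qed.

Lemma avg_smooth_xzy_le :
  \sum_x PX x *: \sum_z PZ x z *: \sum_y PY y *: smooth x z y ⪯ Lo Hu *: one.
Proof.
case: (boolP (typical (pU R) (fun _ : 'I_n => tt) delta)) => ht; last first.
  rewrite big1 => [|x _]; first exact: lea0_scale_one.
  rewrite big1 ?scaler0 // => z _; rewrite big1 ?scaler0 // => y _.
  by rewrite smooth_eq0 ?scaler0 //; apply: contra ht; exact: typical_u.
have h : \sum_x PX x *: \sum_z PZ x z *: \sum_y PY y *: smooth x z y ⪯ Tu * st_u * Tu.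
  rewrite -avg_x_u -conj_avg; apply: lea_sum => x _; apply: leaZ; first exact: PX_ge0.
  apply: (lea_trans (avg_smooth_zy x)).
  have := lea_conj Tu (typproj_sandwich_le (rho_x_density hrho hZX hY) x delta).
  by rewrite Tu_proj.1.
apply: (lea_trans h).
exact: (typproj_sandwich (pU_distr R) (rho_u_density hrho hX hZX hY) d0 d1 ddle n0 ht).
Qed.

(* The digits list the messages decoded wrongly.  A wrong m1 makes the whole pair
   (x', z') fresh, whatever the decoded m2 is.  In [dec1_wrong2] and
   [dec1_wrong12] the average over the wrong codewords bounds the decoder, in the
   other cases the average over the transmitted ones bounds the state. *)
Lemma dec1_wrong2 : E3 (fun x z y => \sum_z' PZ x z' * rtr (dec1 x z' y * smooth x z y))
  <= 2 * Up Hzy * Lo Hxy.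
Proof.
rewrite -[leRHS](E3_cst hX hZX hY n); apply: E3_le => // x z y.
have -> : \sum_z' PZ x z' * rtr (dec1 x z' y * smooth x z y) =
  rtr ((\sum_z' PZ x z' *: dec1 x z' y) * smooth x z y).
  by rewrite mulr_suml rtr_sum; apply: eq_bigr => z' _; rewrite -op_scalerAl rtrZ.
by apply: rtr_smooth_le => //; [rewrite !mulr_ge0 | exact: avg_dec1_z_le].
Qed.

Lemma dec1_wrong12 : E3 (fun x z y => \sum_x' PX x' * \sum_z' PZ x' z' *
  rtr (dec1 x' z' y * smooth x z y)) <= 2 * Up Hzy * Lo Hy.
Proof.
rewrite -[leRHS](E3_cst hX hZX hY n); apply: E3_le => // x z y.
have -> : \sum_x' PX x' * (\sum_z' PZ x' z' * rtr (dec1 x' z' y * smooth x z y)) =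
  rtr ((\sum_x' PX x' *: \sum_z' PZ x' z' *: dec1 x' z' y) * smooth x z y).
  rewrite mulr_suml rtr_sum; apply: eq_bigr => x' _; rewrite -op_scalerAl rtrZ.
  rewrite mulr_suml rtr_sum; congr (_ * _); apply: eq_bigr => z' _.
  by rewrite -op_scalerAl rtrZ.
by apply: rtr_smooth_le => //; [rewrite !mulr_ge0 | exact: avg_dec1_xz_le].
Qed.

Lemma dec1_wrong3 : E3 (fun x z y' => \sum_y PY y * rtr (dec1 x z y' * smooth x z y))
  <= 2 * Up Hzy * Lo Hz.
Proof.
rewrite -[leRHS](E3_cst hX hZX hY n); apply: E3_le => // x z y'.
rewrite rtr_avg; apply: le_trans (rtr_proj_le _ (avg_smooth_y_le x z)) _.
  exact: dec1_projector.
by rewrite mulrC ler_wpM2r // rtr_dec1.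
Qed.

Lemma dec1_wrong23 : E3 (fun x z' y' => \sum_z PZ x z * \sum_y PY y *
  rtr (dec1 x z' y' * smooth x z y)) <= 2 * Up Hzy * Lo Hx.
Proof.
rewrite -[leRHS](E3_cst hX hZX hY n); apply: E3_le => // x z' y'.
under eq_bigr do rewrite rtr_avg.
rewrite rtr_avg; apply: le_trans (rtr_proj_le _ (avg_smooth_zy_le x)) _.
  exact: dec1_projector.
by rewrite mulrC ler_wpM2r // rtr_dec1.
Qed.

Lemma dec1_wrong123 : E3 (fun x' z' y' => E3 (fun x z y => rtr (dec1 x' z' y' * smooth x z y)))
  <= 2 * Up Hzy * Lo Hu.
Proof.
rewrite -[leRHS](E3_cst hX hZX hY n); apply: E3_le => // x' z' y'; rewrite /expect3.
under eq_bigr do [under eq_bigr do rewrite rtr_avg; rewrite rtr_avg].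
rewrite rtr_avg; apply: le_trans (rtr_proj_le _ avg_smooth_xzy_le) _.
  exact: dec1_projector.
by rewrite mulrC ler_wpM2r // rtr_dec1.
Qed.

Lemma dec2_wrong2 : E3 (fun x z' y' => \sum_z PZ x z * \sum_y PY y *
  rtr (dec2 x z' * smooth x z y)) <= Up Hz * Lo Hx.
Proof.
rewrite -[leRHS](E3_cst hX hZX hY n); apply: E3_le => // x z' y'.
under eq_bigr do rewrite rtr_avg.
rewrite rtr_avg; apply: le_trans (rtr_proj_le _ (avg_smooth_zy_le x)) _.
  exact: dec2_projector.
by rewrite mulrC ler_wpM2r // rtr_dec2.
Qed.

Lemma dec2_wrong12 : E3 (fun x' z' y' => E3 (fun x z y => rtr (dec2 x' z' * smooth x z y)))
  <= Up Hz * Lo Hu.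
Proof.
rewrite -[leRHS](E3_cst hX hZX hY n); apply: E3_le => // x' z' y'; rewrite /expect3.
under eq_bigr do [under eq_bigr do rewrite rtr_avg; rewrite rtr_avg].
rewrite rtr_avg; apply: le_trans (rtr_proj_le _ avg_smooth_xzy_le) _.
  exact: dec2_projector.
by rewrite mulrC ler_wpM2r // rtr_dec2.
Qed.
End Smoothing.

(** * Codebook averages *)

Section Codebook.
Variables (R : realType) (X Z Y : finType) (n M1 M2 M3 : nat).
Variables (pX : X -> R) (pZX : X -> Z -> R) (pY : Y -> R).
Hypotheses (hX : distr pX) (hZX : forall x, distr (pZX x)) (hY : distr pY).
Local Notation seqX := (wseq n X).
Local Notation seqZ := (wseq n Z).
Local Notation seqY := (wseq n Y).
Local Notation PX := (@probX R X pX n).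
Local Notation PZ := (@probZ R X Z pZX n).
Local Notation PY := (@probY R Y pY n).
Local Notation E3 := (expect3 pX pZX pY).
Local Notation cX := {ffun 'I_M1 -> seqX}.
Local Notation cZ := {ffun 'I_M1 -> {ffun 'I_M2 -> seqZ}}.
Local Notation cY := {ffun 'I_M3 -> seqY}.

Definition expectC (F : cX -> cZ -> cY -> R) : R :=
  \sum_(cx : cX) \sum_(cz : cZ) \sum_(cy : cY) codebook_prob pX pZX pY cx cz cy * F cx cz cy.

Lemma codebook_prob_ge0 cx cz cy : 0 <= codebook_prob (n := n) (M1 := M1) (M2 := M2) (M3 := M3)
  pX pZX pY cx cz cy.
Proof.
by rewrite !mulr_ge0 // !(prodr_ge0, hX.1, hY.1) // => *; rewrite ?prodr_ge0 // => *;
  rewrite ?prodr_ge0 // => *;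
  rewrite ?hX.1 ?hY.1 ?(hZX _).1.
Qed.

Lemma EC_le F G : (forall cx cz cy, F cx cz cy <= G cx cz cy) -> expectC F <= expectC G.
Proof.
by move=> h; do 3!(apply: ler_sum => ? _); rewrite ler_wpM2l // codebook_prob_ge0.
Qed.

Lemma EC_sum (I : Type) (r : seq I) (P : pred I) (F : I -> cX -> cZ -> cY -> R) :
  expectC (fun cx cz cy => \sum_(i <- r | P i) F i cx cz cy) = \sum_(i <- r | P i) expectC (F i).
Proof.
rewrite /expectC; under eq_bigr do under eq_bigr do under eq_bigr do rewrite mulr_sumr.
under eq_bigr do under eq_bigr do rewrite exchange_big.
by under eq_bigr do rewrite exchange_big; rewrite exchange_big.
Qed.

Lemma ECD F G : expectC (fun cx cz cy => F cx cz cy + G cx cz cy) = expectC F + expectC G.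
Proof.
rewrite /expectC -big_split; apply: eq_bigr => cx _; rewrite /= -big_split; apply: eq_bigr => cz _.
by rewrite /= -big_split; apply: eq_bigr => cy _; rewrite /= mulrDr.
Qed.

Lemma ECZ c F : expectC (fun cx cz cy => c * F cx cz cy) = c * expectC F.
Proof.
rewrite /expectC mulr_sumr; apply: eq_bigr => cx _; rewrite mulr_sumr; apply: eq_bigr => cz _.
by rewrite mulr_sumr; apply: eq_bigr => cy _; rewrite mulrCA.
Qed.

Lemma EC_nested F : expectC F = \sum_(cx : cX) (\prod_i PX (cx i)) *
  \sum_(cz : cZ) (\prod_i \prod_j PZ (cx i) (cz i j)) *
  \sum_(cy : cY) (\prod_k PY (cy k)) * F cx cz cy.
Proof.
apply: eq_bigr => cx _; rewrite mulr_sumr; apply: eq_bigr => cz _.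
by rewrite mulrA mulr_sumr; apply: eq_bigr => cy _; rewrite mulrA.
Qed.

Lemma prod_distr_marg2_nested (I T : finType) (p : I -> T -> R) (i0 i1 : I) (G : T -> T -> R) :
  (forall i, \sum_t p i t = 1) -> i0 != i1 ->
  \sum_(f : {ffun I -> T}) (\prod_i p i (f i)) * G (f i0) (f i1) =
  \sum_t p i0 t * \sum_u p i1 u * G t u.
Proof.
move=> h i01; rewrite prod_distr_marg2 //; apply: eq_bigr => t _.
by rewrite mulr_sumr; apply: eq_bigr => u _; rewrite mulrA.
Qed.

Let sX (i : 'I_M1) : \sum_(x : seqX) PX x = 1. Proof. exact: sum_PX. Qed.
Let sY (i : 'I_M3) : \sum_(y : seqY) PY y = 1. Proof. exact: sum_PY. Qed.
Let sZ x (i : 'I_M2) : \sum_(z : seqZ) PZ x z = 1. Proof. exact: sum_PZ. Qed.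
Let sZZ (cx : cX) (i : 'I_M1) :
  \sum_(t : {ffun 'I_M2 -> seqZ}) \prod_j PZ (cx i) (t j) = 1.
Proof. exact: (prod_distr_sum1 (p := fun _ => PZ (cx i))) (sZ _). Qed.

Variables (m1 : 'I_M1) (m2 : 'I_M2) (m3 : 'I_M3).

Lemma EC_same12 (G : seqX -> seqZ -> cY -> R) :
  expectC (fun cx cz cy => G (cx m1) (cz m1 m2) cy) =
  \sum_(x : seqX) PX x * \sum_(z : seqZ) PZ x z * \sum_(cy : cY) (\prod_k PY (cy k)) * G x z cy.
Proof.
rewrite EC_nested -(prod_distr_marg1 (p := fun _ => PX) m1 (fun x => \sum_(z : seqZ) PZ x z *
  \sum_(cy : cY) (\prod_k PY (cy k)) * G x z cy) sX).
apply: eq_bigr => cx _; congr (_ * _).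
rewrite (prod_distr_marg1 m1 (fun t : {ffun 'I_M2 -> seqZ} => \sum_(cy : cY) (\prod_k PY (cy k))
  * G (cx m1) (t m2) cy) (sZZ cx)).
exact: (prod_distr_marg1 (p := fun _ => PZ (cx m1)) m2 (fun z => \sum_(cy : cY) (\prod_k PY (cy
  k)) * G (cx m1) z cy) (sZ _)).
Qed.

Lemma EC_diff2 (k2 : 'I_M2) (G : seqX -> seqZ -> seqZ -> cY -> R) : k2 != m2 ->
  expectC (fun cx cz cy => G (cx m1) (cz m1 m2) (cz m1 k2) cy) =
  \sum_(x : seqX) PX x * \sum_(z : seqZ) PZ x z * \sum_(z' : seqZ) PZ x z' *
    \sum_(cy : cY) (\prod_k PY (cy k)) * G x z z' cy.
Proof.
move=> k2m2; rewrite EC_nested.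
rewrite -(prod_distr_marg1 (p := fun _ => PX) m1 (fun x => \sum_(z : seqZ) PZ x z * \sum_(z' :
  seqZ) PZ x z' * \sum_(cy : cY) (\prod_k PY (cy k)) * G x z z' cy) sX).
apply: eq_bigr => cx _; congr (_ * _).
rewrite (prod_distr_marg1 m1 (fun t : {ffun 'I_M2 -> seqZ} => \sum_(cy : cY) (\prod_k PY (cy k))
  * G (cx m1) (t m2) (t k2) cy) (sZZ cx)).
by rewrite (prod_distr_marg2_nested (p := fun _ => PZ (cx m1)) (fun z z' => \sum_(cy : cY)
  (\prod_k PY (cy k)) * G (cx m1) z z' cy) (sZ _)) // eq_sym.
Qed.

(** Rows with different first message are independent, so [k2] is arbitrary and may equal [m2]. *)
Lemma EC_diff1 (k1 : 'I_M1) (k2 : 'I_M2) (G : seqX -> seqZ -> seqX -> seqZ -> cY -> R) : k1 != m1 ->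
  expectC (fun cx cz cy => G (cx m1) (cz m1 m2) (cx k1) (cz k1 k2) cy) =
  \sum_(x : seqX) PX x * \sum_(x' : seqX) PX x' * \sum_(z : seqZ) PZ x z * \sum_(z' : seqZ) PZ x'
    z' *
    \sum_(cy : cY) (\prod_k PY (cy k)) * G x z x' z' cy.
Proof.
move=> k1m1; have m1k1 : m1 != k1 by rewrite eq_sym.
rewrite EC_nested.
rewrite -(prod_distr_marg2_nested (p := fun _ => PX) (i0 := m1) (i1 := k1) (fun x x' => \sum_(z :
  seqZ) PZ x z * \sum_(z' : seqZ) PZ x' z' * \sum_(cy : cY) (\prod_k PY (cy k)) * G x z x' z' cy)
  sX) //.
apply: eq_bigr => cx _; congr (_ * _).
rewrite (prod_distr_marg2_nested (i0 := m1) (i1 := k1) (fun t u : {ffun 'I_M2 -> seqZ} =>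
  \sum_(cy : cY) (\prod_k PY (cy k)) * G (cx m1) (t m2) (cx k1) (u k2) cy) (sZZ cx)) //.
rewrite -(prod_distr_marg1 (p := fun _ => PZ (cx m1)) m2 (fun z => \sum_(z' : seqZ) PZ (cx k1) z'
  * \sum_(cy : cY) (\prod_k PY (cy k)) * G (cx m1) z (cx k1) z' cy) (sZ _)).
apply: eq_bigr => t _; congr (_ * _).
exact: (prod_distr_marg1 (p := fun _ => PZ (cx k1)) k2 (fun z' => \sum_(cy : cY) (\prod_k PY (cy
  k)) * G (cx m1) (t m2) (cx k1) z' cy) (sZ _)).
Qed.

Lemma cY_same (G : seqY -> R) : \sum_(cy : cY) (\prod_k PY (cy k)) * G (cy m3) = \sum_(y : seqY)
  PY y * G y.
Proof. exact: (prod_distr_marg1 (p := fun _ => PY) m3 G sY). Qed.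

Lemma cY_diff (k3 : 'I_M3) (G : seqY -> seqY -> R) : k3 != m3 ->
  \sum_(cy : cY) (\prod_k PY (cy k)) * G (cy m3) (cy k3) = \sum_(y : seqY) PY y * \sum_(y' :
    seqY) PY y' * G y y'.
Proof. by move=> h; apply: (prod_distr_marg2_nested (p := fun _ => PY) G sY); rewrite eq_sym. Qed.

Lemma EC_correct (G : seqX -> seqZ -> seqY -> R) :
  expectC (fun cx cz cy => G (cx m1) (cz m1 m2) (cy m3)) = E3 G.
Proof.
rewrite (EC_same12 (fun x z cy => G x z (cy m3))); apply: eq_bigr => x _; congr (_ * _).
by apply: eq_bigr => z _; rewrite cY_same.
Qed.

(** The first three arguments are the transmitted codewords, the last three those being tested. *)
Variable F : seqX -> seqZ -> seqY -> seqX -> seqZ -> seqY -> R.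
Variables (k1 : 'I_M1) (k2 : 'I_M2) (k3 : 'I_M3).

(** In each of these identities the innermost sums run over the codewords whose average gives the
    bound: the transmitted ones when [y] is wrong, the tested ones when it is right. *)
Lemma EC_wrong3 : k3 != m3 ->
  expectC (fun cx cz cy => F (cx m1) (cz m1 m2) (cy m3) (cx m1) (cz m1 m2) (cy k3)) =
  E3 (fun x z y' => \sum_(y : seqY) PY y * F x z y x z y').
Proof.
move=> h; rewrite (EC_same12 (fun x z cy => F x z (cy m3) x z (cy k3))).
apply: eq_bigr => x _; congr (_ * _); apply: eq_bigr => z _; congr (_ * _).
by rewrite (cY_diff (fun y y' => F x z y x z y') h) exchange_weighted.
Qed.

Lemma EC_wrong2 : k2 != m2 ->
  expectC (fun cx cz cy => F (cx m1) (cz m1 m2) (cy m3) (cx m1) (cz m1 k2) (cy m3)) =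
  E3 (fun x z y => \sum_(z' : seqZ) PZ x z' * F x z y x z' y).
Proof.
move=> h; rewrite (EC_diff2 (fun x z z' cy => F x z (cy m3) x z' (cy m3)) h).
apply: eq_bigr => x _; congr (_ * _); apply: eq_bigr => z _; congr (_ * _).
by rewrite [RHS]exchange_weighted; apply: eq_bigr => z' _;
  rewrite (cY_same (fun y => F x z y x z' y)).
Qed.

Lemma EC_wrong12 : k1 != m1 ->
  expectC (fun cx cz cy => F (cx m1) (cz m1 m2) (cy m3) (cx k1) (cz k1 k2) (cy m3)) =
  E3 (fun x z y => \sum_(x' : seqX) PX x' * \sum_(z' : seqZ) PZ x' z' * F x z y x' z' y).
Proof.
move=> h; rewrite (EC_diff1 k2 (fun x z x' z' cy => F x z (cy m3) x' z' (cy m3)) h).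
apply: eq_bigr => x _; congr (_ * _); rewrite [LHS]exchange_weighted; apply: eq_bigr => z _;
  congr (_ * _).
rewrite [RHS]exchange_weighted; apply: eq_bigr => x' _; congr (_ * _);
  rewrite [RHS]exchange_weighted; apply: eq_bigr => z' _; congr (_ * _).
by rewrite (cY_same (fun y => F x z y x' z' y)).
Qed.

Lemma EC_wrong23 : k2 != m2 -> k3 != m3 ->
  expectC (fun cx cz cy => F (cx m1) (cz m1 m2) (cy m3) (cx m1) (cz m1 k2) (cy k3)) =
  E3 (fun x z' y' => \sum_(z : seqZ) PZ x z * \sum_(y : seqY) PY y * F x z y x z' y').
Proof.
move=> h h'; rewrite (EC_diff2 (fun x z z' cy => F x z (cy m3) x z' (cy k3)) h).
apply: eq_bigr => x _; congr (_ * _); rewrite [LHS]exchange_weighted; apply: eq_bigr => z' _;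
  congr (_ * _).
rewrite [RHS]exchange_weighted; apply: eq_bigr => z _; congr (_ * _).
by rewrite (cY_diff (fun y y' => F x z y x z' y') h') exchange_weighted.
Qed.

Lemma EC_wrong123 : k1 != m1 -> k3 != m3 ->
  expectC (fun cx cz cy => F (cx m1) (cz m1 m2) (cy m3) (cx k1) (cz k1 k2) (cy k3)) =
  E3 (fun x' z' y' => E3 (fun x z y => F x z y x' z' y')).
Proof.
move=> h h'; rewrite (EC_diff1 k2 (fun x z x' z' cy => F x z (cy m3) x' z' (cy k3)) h).
rewrite [LHS]exchange_weighted; apply: eq_bigr => x' _; congr (_ * _).
transitivity (\sum_(x : seqX) PX x * \sum_(z' : seqZ) PZ x' z' * \sum_(z : seqZ) PZ x z *
  \sum_(y' : seqY) PY y' * \sum_(y : seqY) PY y * F x z y x' z' y').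
  apply: eq_bigr => x _; congr (_ * _); rewrite [LHS]exchange_weighted; apply: eq_bigr => z' _;
    congr (_ * _).
  apply: eq_bigr => z _; congr (_ * _).
  by rewrite (cY_diff (fun y y' => F x z y x' z' y') h') exchange_weighted.
rewrite [LHS]exchange_weighted; apply: eq_bigr => z' _; congr (_ * _).
rewrite /expect3 [RHS]exchange_weighted; apply: eq_bigr => x _; congr (_ * _).
by rewrite [RHS]exchange_weighted.
Qed.

Lemma E3_y_cst (G : seqX -> seqZ -> R) : E3 (fun x z _ => G x z) = \sum_(x : seqX) PX x * \sum_(z
  : seqZ) PZ x z * G x z.
Proof.
apply: eq_bigr => x _; congr (_ * _); apply: eq_bigr => z _; congr (_ * _).
by rewrite -mulr_suml sum_PY // mul1r.
Qed.

Variable F2 : seqX -> seqZ -> seqY -> seqX -> seqZ -> R.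

Lemma EC_pair_wrong2 : k2 != m2 ->
  expectC (fun cx cz cy => F2 (cx m1) (cz m1 m2) (cy m3) (cx m1) (cz m1 k2)) =
  E3 (fun x z' _ => \sum_(z : seqZ) PZ x z * \sum_(y : seqY) PY y * F2 x z y x z').
Proof.
move=> h; rewrite (EC_diff2 (fun x z z' cy => F2 x z (cy m3) x z') h) E3_y_cst.
apply: eq_bigr => x _; congr (_ * _); rewrite [LHS]exchange_weighted; apply: eq_bigr => z' _;
  congr (_ * _).
by apply: eq_bigr => z _; congr (_ * _); rewrite (cY_same (fun y => F2 x z y x z')).
Qed.

Lemma EC_pair_wrong12 : k1 != m1 ->
  expectC (fun cx cz cy => F2 (cx m1) (cz m1 m2) (cy m3) (cx k1) (cz k1 k2)) =
  E3 (fun x' z' _ => E3 (fun x z y => F2 x z y x' z')).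
Proof.
move=> h; rewrite (EC_diff1 k2 (fun x z x' z' cy => F2 x z (cy m3) x' z') h) E3_y_cst.
rewrite [LHS]exchange_weighted; apply: eq_bigr => x' _; congr (_ * _).
rewrite /expect3 [RHS]exchange_weighted; apply: eq_bigr => x _; congr (_ * _);
  rewrite [LHS]exchange_weighted.
apply: eq_bigr => z' _; congr (_ * _); apply: eq_bigr => z _; congr (_ * _).
by rewrite (cY_same (fun y => F2 x z y x' z')).
Qed.
End Codebook.

(** * Achievability *)

Section Rates.
Variable R : realType.

Lemma nmsg_le n (r : R) : (nmsg n r)%:R <= expR (n%:R * (r * ln 2)) :> R.
Proof.
rewrite /nmsg; apply: (@le_trans _ _ (2 `^ (n%:R * r))); first by rewrite truncn_le ?powR_ge0.
by rewrite /powR pnatr_eq0 /= mulrA.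
Qed.

(** Half of the rate gap [g] absorbs the [8 * delta] slack and the other half gives decay
    [expR (- n g / 2)], relaxed to [2 / (g n)] through [1 + x <= expR x]. *)
Lemma rate_bound n (delta g s Hs H M : R) : (0 < n)%N -> 0 < g -> s + g <= H - Hs ->
  8 * delta * (Hs + H) <= g / 2 -> M <= expR (n%:R * s) ->
  M * (expR (n%:R * ((1 + 8 * delta) * Hs)) * expR (- (n%:R * ((1 - 8 * delta) * H)))) <=
  2 / g / n%:R.
Proof.
move=> n0 g0 hg hd hM; have nR : 0 < n%:R :> R by rewrite ltr0n.
apply: (@le_trans _ _ (expR (- (n%:R * (g / 2))))).
  apply: (le_trans (ler_wpM2r _ hM)); first by rewrite mulr_ge0 // expR_ge0.
  have h : s + ((1 + 8 * delta) * Hs - (1 - 8 * delta) * H) <= - (g / 2) by lra.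
  by rewrite -!expRD ler_expR; have := ler_wpM2l (ltW nR) h; lra.
rewrite expRN -[leRHS]invrK lef_pV2 ?posrE ?expR_gt0 ?invr_gt0 ?divr_gt0 //.
have -> : (2 / g / n%:R)^-1 = n%:R * (g / 2) by field; rewrite !gt_eqF.
by apply: le_trans (expR_ge1Dx _); rewrite lerDr.
Qed.

Lemma small_delta (l : seq (R * R)) : (forall u, u \in l -> 0 < u.1 /\ 0 <= u.2) ->
  exists2 delta : R, 0 < delta < 1 / 64 & forall u, u \in l -> 8 * delta * u.2 <= u.1 / 2.
Proof.
elim: l => [_|[g h] l IH hl]; first by exists (1 / 65) => //; apply/andP; split; lra.
have [|d /andP[d0 d1] hd] := IH; first by move=> u ul; apply: hl; rewrite inE ul orbT.
have [g0 h0] := hl (g, h) (mem_head _ _); rewrite /= in g0 h0.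
(* With this [delta], [8 * delta * h] is [g / 2 * (h / (h + 1))]; the summand 1 avoids division by
   zero when [h = 0]. *)
have e0 : 0 < g / (16 * (h + 1)) by rewrite divr_gt0 // mulr_gt0 //; lra.
exists (Num.min d (g / (16 * (h + 1)))).
  by rewrite lt_min d0 e0 gt_min d1.
move=> u; rewrite inE => /predU1P[->|ul] /=.
  apply: (@le_trans _ _ (8 * (g / (16 * (h + 1))) * h)).
    by rewrite ler_wpM2r // ler_wpM2l // ge_min lexx orbT.
  have -> : 8 * (g / (16 * (h + 1))) * h = g / 2 * (h / (h + 1)) by field; lra.
  by rewrite ler_piMr ?divr_ge0 ?ler_pdivrMr ?(ltW g0) //; lra.
have [|_ u2] := hl u; first by rewrite inE ul orbT.
by apply: le_trans (hd u ul); rewrite ler_wpM2r // ler_wpM2l // ge_min lexx.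
Qed.

(** For an empty message set the prefactor is the default [0^-1 = 0], so the average is 0; this case
    rests on [0 <= b]. *)
Lemma avg3_le (M1 M2 M3 : nat) (a : 'I_M1 -> 'I_M2 -> 'I_M3 -> R) (b : R) :
  0 <= b -> (forall i j k, a i j k <= b) ->
  ((M1 * M2 * M3)%:R)^-1 * \sum_(i < M1) \sum_(j < M2) \sum_(k < M3) a i j k <= b.
Proof.
move=> b0 hab; apply: (@le_trans _ _ (((M1 * M2 * M3)%:R)^-1 * ((M1 * M2 * M3)%:R * b))).
  rewrite ler_wpM2l ?invr_ge0 ?ler0n //.
  apply: (@le_trans _ _ (\sum_(i < M1) \sum_(j < M2) \sum_(k < M3) b)).
    by do 3!(apply: ler_sum => ? _); exact: hab.
  rewrite !sumr_const !card_ord -!mulrnA mulr_natl.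
  have -> : (M1 * M2 * M3 = M3 * M2 * M1)%N by rewrite mulnC (mulnC M1) mulnA.
  by rewrite mulnA.
have [->|h] := eqVneq ((M1 * M2 * M3)%:R : R) 0; first by rewrite mul0r mulr0.
by rewrite mulKf.
Qed.

Lemma sum_prod3 (I J K : finType) (a : I -> R) (b : J -> R) (c : K -> R) (v : R) :
  \sum_i \sum_j \sum_k a i * b j * c k * v = (\sum_i a i) * (\sum_j b j) * (\sum_k c k) * v.
Proof.
transitivity (\sum_i a i * ((\sum_j b j) * ((\sum_k c k) * v))); last by rewrite -mulr_suml !mulrA.
apply: eq_bigr => i _; rewrite mulr_suml mulr_sumr; apply: eq_bigr => j _.
rewrite mulr_suml !mulr_sumr; apply: eq_bigr => k _.
by rewrite !mulrA.
Qed.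

Lemma sum_eq1 (I : finType) (i0 : I) : \sum_i (i == i0)%:R = 1 :> R.
Proof. by rewrite (bigD1 i0) //= eqxx big1 ?addr0 // => i /negPf ->. Qed.

Lemma sum_one (M : nat) : \sum_(i < M) (1 : R) = M%:R.
Proof. by rewrite sumr_const card_ord. Qed.

Lemma choose_n (C eta : R) : 0 <= C -> 0 < eta -> exists2 n : nat, (0 < n)%N & C / n%:R <= eta.
Proof.
move=> C0 e0; exists (Num.truncn (C / eta)).+1 => //.
rewrite ler_pdivrMr ?ltr0n // mulrC -ler_pdivrMr //; apply/ltW/truncnS_gt.
Qed.
End Rates.

(** * Union bound over the wrong messages *)

Section Assembly.
Variables (R : realType) (X Z Y B : finType).
Variables (rho : Z -> Y -> op R B) (pX : X -> R) (pZX : X -> Z -> R) (pY : Y -> R).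
Hypotheses (hrho : forall z y, density (rho z y)) (hX : distr pX)
  (hZX : forall x, distr (pZX x)) (hY : distr pY).
Local Notation Hzy := (condH_zy rho pX pZX pY).
Local Notation Hxy := (condH_xy rho pX pZX pY).
Local Notation Hy := (condH_y rho pX pZX pY).
Local Notation Hz := (condH_z rho pX pZX pY).
Local Notation Hx := (condH_x rho pX pZX pY).
Local Notation Hu := (condH_u rho pX pZX pY).
Local Notation E3 := (expect3 pX pZX pY).

Section Fixed.
Variables (n M1 M2 M3 : nat) (delta eps t : R).
Hypotheses (n0 : (0 < n)%N) (d0 : 0 < delta) (d1 : delta < 1/64) (t0 : 0 < t).
Hypothesis heps : Num.sqrt eps = 1 / 10.
Let Up (H : R) : R := expR (n%:R * ((1 + 8 * delta) * H)).
Let Lo (H : R) : R := expR (- (n%:R * ((1 - 8 * delta) * H))).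
Local Notation smooth := (smooth rho pX pZX pY delta).
Local Notation defect := (@codeword_defect R X Z Y B rho pX pZX pY n delta).
Local Notation EC := (@expectC R X Z Y n M1 M2 M3 pX pZX pY).
Let Up0 H : 0 <= Up H. Proof. exact: expR_ge0. Qed.
Let Lo0 H : 0 <= Lo H. Proof. exact: expR_ge0. Qed.

Lemma E3_defect_ge0 : 0 <= E3 defect.
Proof.
rewrite -[leLHS](E3_cst hX hZX hY n 0); apply: E3_le => // x z y.
exact: defect_ge0.
Qed.

Lemma EC_cst c : EC (fun _ _ _ => c) = c.
Proof.
rewrite EC_nested.
rewrite (eq_bigr (fun cx : {ffun 'I_M1 -> wseq n X} => (\prod_i probX pX (cx i)) * c)) => [|cx _].
  rewrite -mulr_suml (prod_distr_sum1 (p := fun _ : 'I_M1 => @probX R X pX n)) ?mul1r // => _.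
  exact: sum_PX.
congr (_ * _); rewrite (eq_bigr (fun cz : {ffun 'I_M1 -> {ffun 'I_M2 -> wseq n Z}} =>
   (\prod_i \prod_j probZ pZX (cx i) (cz i j)) * c)) => [|cz _].
  rewrite -mulr_suml (prod_distr_sum1 (p := fun i (t : {ffun 'I_M2 -> wseq n Z}) => \prod_j probZ
    pZX (cx i) (t j))) ?mul1r // => i.
  apply: (prod_distr_sum1 (p := fun _ : 'I_M2 => @probZ R X Z pZX n (cx i))) => _.
  exact: sum_PZ.
congr (_ * _); rewrite -mulr_suml (prod_distr_sum1 (p := fun _ : 'I_M3 => @probY R Y pY n))
  ?mul1r // => _.
exact: sum_PY.
Qed.

Definition wrong_sum1 : R := 2 * (M3%:R * (Up Hzy * Lo Hz) + M2%:R * (Up Hzy * Lo Hxy) +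
   (M1 * M2)%:R * (Up Hzy * Lo Hy) + (M2 * M3)%:R * (Up Hzy * Lo Hx) +
   (M1 * M2 * M3)%:R * (Up Hzy * Lo Hu)).

Lemma wrong_sum1_ge (m1 : 'I_M1) (m2 : 'I_M2) (m3 : 'I_M3) :
  \sum_(k <- [seq (k12, k3) | k12 <- [seq (k1, k2) | k1 <- enum 'I_M1, k2 <- enum 'I_M2], k3 <-
    enum 'I_M3]
     | k != ((m1, m2), m3))
    EC (fun cx cz cy => rtr (dec1_proj rho pX pZX pY delta eps (cx k.1.1) (cz k.1.1 k.1.2) (cy k.2)
         * smooth (cx m1) (cz m1 m2) (cy m3))) <= wrong_sum1.
Proof.
(* Each error pattern is enlarged to a product set: indicators fix the messages that are right,
   while the wrong ones range over all values. The sums then factor and give the counts in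
   [wrong_sum1]. *)
pose bnd (k : 'I_M1 * 'I_M2 * 'I_M3) : R := 2 * (
  (k.1.1 == m1)%:R * (k.1.2 == m2)%:R * 1 * (Up Hzy * Lo Hz) +
  (k.1.1 == m1)%:R * 1 * (k.2 == m3)%:R * (Up Hzy * Lo Hxy) +
  1 * 1 * (k.2 == m3)%:R * (Up Hzy * Lo Hy) +
  (k.1.1 == m1)%:R * 1 * 1 * (Up Hzy * Lo Hx) +
  1 * 1 * 1 * (Up Hzy * Lo Hu)).
have hUL H H' : 0 <= Up H * Lo H' by rewrite mulr_ge0.
have bnd0 k : 0 <= bnd k.
  by rewrite /bnd mulr_ge0 // !addr_ge0 // ?mul1r ?mulr1 ?mulr_ge0 ?ler0n.
apply: (@le_trans _ _ (\sum_(k <- [seq (k12, k3) | k12 <- [seq (k1, k2) | k1 <- enum 'I_M1, k2 <-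
  enum 'I_M2], k3 <- enum 'I_M3]) bnd k)).
  rewrite big_mkcond; apply: ler_sum => -[[k1 k2] k3] _.
  case: ifP => // hk; rewrite /bnd /=.
  pose F (x : wseq n X) (z : wseq n Z) (y : wseq n Y) (x' : wseq n X) (z' : wseq n Z) (y' : wseq
    n Y) :=
     rtr (dec1_proj rho pX pZX pY delta eps x' z' y' * smooth x z y).
  have h1 := hUL Hzy Hz; have h2 := hUL Hzy Hxy; have h3 := hUL Hzy Hy.
  have h4 := hUL Hzy Hx; have h5 := hUL Hzy Hu.
  case: (eqVneq k1 m1) hk => [->|k1m1] hk.
    case: (eqVneq k2 m2) hk => [->|k2m2] hk.
      have k3m3 : k3 != m3 by apply: contraTneq hk => ->; rewrite eqxx.
      rewrite (EC_wrong3 hX hZX hY m1 m2 F k3m3) (negPf k3m3).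
      apply: le_trans (dec1_wrong3 hrho hX hZX hY n0 d0 d1 heps) _.
      by rewrite /= ?mulr1n ?mulr0n -/(Up _) -/(Lo _); lra.
    case: (eqVneq k3 m3) hk => [->|k3m3] hk.
      rewrite (EC_wrong2 hX hZX hY m1 m3 F k2m2).
      apply: le_trans (dec1_wrong2 hrho hX hZX hY n0 d0 d1 heps) _.
      by rewrite /= ?mulr1n ?mulr0n -/(Up _) -/(Lo _); lra.
    rewrite (EC_wrong23 hX hZX hY m1 F k2m2 k3m3).
    apply: le_trans (dec1_wrong23 hrho hX hZX hY n0 d0 d1 heps) _.
    by rewrite /= ?mulr1n ?mulr0n -/(Up _) -/(Lo _); lra.
  case: (eqVneq k3 m3) hk => [->|k3m3] hk.
    rewrite (EC_wrong12 hX hZX hY m2 m3 F k2 k1m1).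
    apply: le_trans (dec1_wrong12 hrho hX hZX hY n0 d0 d1 heps) _.
    by rewrite /= ?mulr1n ?mulr0n -/(Up _) -/(Lo _); lra.
  rewrite (EC_wrong123 hX hZX hY m2 F k2 k1m1 k3m3).
  apply: le_trans (dec1_wrong123 hrho hX hZX hY n0 d0 d1 heps) _.
  by rewrite /= ?mulr1n ?mulr0n -/(Up _) -/(Lo _); lra.
rewrite big_allpairs_dep big_allpairs_dep /= big_enum /=.
under eq_bigr do [rewrite big_enum /=; under eq_bigr do rewrite big_enum /=].
rewrite /bnd /=.
under eq_bigr do under eq_bigr do rewrite -mulr_sumr !big_split /=.
under eq_bigr do rewrite -mulr_sumr !big_split /=.
rewrite -mulr_sumr !big_split /= /wrong_sum1 ler_wpM2l //.
rewrite !sum_prod3 !sum_eq1 !sum_one !mul1r !mulr1 !natrM.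
by rewrite lexx.
Qed.

(** The bound is the same for every transmitted triple, so the average over messages disappears. In
    the constant, 12 pays for smoothing and [6 * 63 ^+ 2] for the deficit of the right projector. *)
Lemma exp_err1_le : exp_err1 rho pX pZX pY n M1 M2 M3 delta eps <=
  t + t^-1 * ((12 + 6 * 63 ^+ 2) * E3 defect + 3 * wrong_sum1).
Proof.
have hE := E3_defect_ge0.
have w0 : 0 <= wrong_sum1.
  by rewrite /wrong_sum1 mulr_ge0 // !addr_ge0 // mulr_ge0 ?ler0n // mulr_ge0.
set b := leRHS.
have b0 : 0 <= b.
  apply: addr_ge0; first exact: ltW.
  apply: mulr_ge0; first by rewrite invr_ge0 ltW.
  by apply: addr_ge0; apply: mulr_ge0 => //; lra.
pose ks : seq ('I_M1 * 'I_M2 * 'I_M3) :=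
  [seq (k12, k3) | k12 <- [seq (k1, k2) | k1 <- enum 'I_M1, k2 <- enum 'I_M2], k3 <- enum 'I_M3].
pose err (cx : {ffun 'I_M1 -> wseq n X}) (cz : {ffun 'I_M1 -> {ffun 'I_M2 -> wseq n Z}}) (cy :
  {ffun 'I_M3 -> wseq n Y})
    (m1 : 'I_M1) (m2 : 'I_M2) (m3 : 'I_M3) := seq_error (received rho (cz m1 m2) (cy m3))
  [seq (dec1_proj rho pX pZX pY delta eps (cx k.1.1) (cz k.1.1 k.1.2) (cy k.2),
               (k.1.1 == m1) && (k.1.2 == m2)) | k <- ks].
have -> : exp_err1 rho pX pZX pY n M1 M2 M3 delta eps =
  EC (fun cx cz cy => ((M1 * M2 * M3)%:R)^-1 * \sum_m1 \sum_m2 \sum_m3 err cx cz cy m1 m2 m3) by [].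
rewrite ECZ EC_sum; under eq_bigr do rewrite EC_sum.
under eq_bigr do under eq_bigr do rewrite EC_sum.
apply: avg3_le => // m1 m2 m3.
have uks : uniq ks.
  apply: allpairs_uniq; [|exact: enum_uniq|by move=> [? ?] [? ?] _ _].
  by apply: allpairs_uniq; [exact: enum_uniq|exact: enum_uniq|move=> [? ?] [? ?] _ _].
have kks : ((m1, m2), m3) \in ks.
  by apply: allpairs_f; rewrite ?mem_enum //; apply: allpairs_f; rewrite mem_enum.
pose P (cx : {ffun 'I_M1 -> wseq n X}) (cz : {ffun 'I_M1 -> {ffun 'I_M2 -> wseq n Z}}) (cy :
  {ffun 'I_M3 -> wseq n Y})
    (k : 'I_M1 * 'I_M2 * 'I_M3) :=
  dec1_proj rho pX pZX pY delta eps (cx k.1.1) (cz k.1.1 k.1.2) (cy k.2).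
apply: (@le_trans _ _ (EC (fun cx cz cy => t + t^-1 * ((12 + 6 * 63 ^+ 2) * defect (cx m1) (cz m1
  m2) (cy m3) +
   3 * \sum_(k <- ks | k != ((m1, m2), m3)) rtr (P cx cz cy k * smooth (cx m1) (cz m1 m2) (cy
     m3)))))).
  apply: EC_le => // cx cz cy.
  have h := seq_error_smooth hrho hX hZX hY delta (cx m1) (cz m1 m2) (cy m3) (P := P cx cz cy)
    (g := fun k => (k.1.1 == m1) && (k.1.2 == m2)) uks kks.
  have hg : (((m1, m2), m3).1.1 == m1) && (((m1, m2), m3).1.2 == m2) by rewrite /= !eqxx.
  have hP k : projector (P cx cz cy k) by exact: dec1_projector.
  rewrite /err /received; apply: (le_trans (h t hg hP t0)).
  rewrite lerD2l ler_wpM2l ?invr_ge0 ?(ltW t0) // lerD2r.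
  by have := dec1_deficit hrho hX hZX hY delta heps (cx m1) (cz m1 m2) (cy m3); rewrite /P /=; lra.
rewrite ECD EC_cst ECZ ECD !ECZ lerD2l ler_wpM2l ?invr_ge0 ?(ltW t0) //.
rewrite (EC_correct hX hZX hY m1 m2 m3 defect) lerD2l ler_wpM2l // EC_sum.
exact: wrong_sum1_ge.
Qed.

Definition wrong_sum2 : R := M2%:R * (Up Hz * Lo Hx) + (M1 * M2)%:R * (Up Hz * Lo Hu).

Lemma wrong_sum2_ge (m1 : 'I_M1) (m2 : 'I_M2) (m3 : 'I_M3) :
  \sum_(k <- [seq (k1, k2) | k1 <- enum 'I_M1, k2 <- enum 'I_M2] | k != (m1, m2))
    EC (fun cx cz cy => rtr (dec2_proj rho pX pZX pY delta (cx k.1) (cz k.1 k.2)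
         * smooth (cx m1) (cz m1 m2) (cy m3))) <= wrong_sum2.
Proof.
pose bnd (k : 'I_M1 * 'I_M2) : R :=
  (k.1 == m1)%:R * 1 * (Up Hz * Lo Hx) + 1 * 1 * (Up Hz * Lo Hu).
have hUL H H' : 0 <= Up H * Lo H' by rewrite mulr_ge0.
have bnd0 k : 0 <= bnd k.
  by rewrite /bnd addr_ge0 // ?mul1r ?mulr1 ?mulr_ge0 ?ler0n.
apply: (@le_trans _ _ (\sum_(k <- [seq (k1, k2) | k1 <- enum 'I_M1, k2 <- enum 'I_M2]) bnd k)).
  rewrite big_mkcond; apply: ler_sum => -[k1 k2] _.
  case: ifP => // hk; rewrite /bnd /=.
  pose F (x : wseq n X) (z : wseq n Z) (y : wseq n Y) (x' : wseq n X) (z' : wseq n Z) :=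
     rtr (dec2_proj rho pX pZX pY delta x' z' * smooth x z y).
  have h1 := hUL Hz Hx; have h2 := hUL Hz Hu.
  case: (eqVneq k1 m1) hk => [->|k1m1] hk.
    have k2m2 : k2 != m2 by apply: contraTneq hk => ->; rewrite eqxx.
    rewrite (EC_pair_wrong2 hX hZX hY m1 m3 F k2m2).
    apply: le_trans (dec2_wrong2 hrho hX hZX hY n0 d0 d1) _.
    by rewrite /= ?mulr1n ?mulr0n -/(Up _) -/(Lo _); lra.
  rewrite (EC_pair_wrong12 hX hZX hY m2 m3 k2 F k1m1).
  apply: le_trans (dec2_wrong12 hrho hX hZX hY n0 d0 d1) _.
  by rewrite /= ?mulr1n ?mulr0n -/(Up _) -/(Lo _); lra.
rewrite big_allpairs_dep /= big_enum /=.
under eq_bigr do rewrite big_enum /=.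
rewrite /bnd /=; under eq_bigr do rewrite big_split /=.
have e (a : 'I_M1 -> R) (b : 'I_M2 -> R) v :
    \sum_i \sum_j a i * b j * v = (\sum_i a i) * (\sum_j b j) * v.
  rewrite !mulr_suml; apply: eq_bigr => i _.
  by rewrite mulr_sumr mulr_suml.
rewrite big_split /= !e !sum_eq1 !sum_one !mul1r /wrong_sum2 natrM.
by rewrite lexx.
Qed.

(** Here the right projector's deficit is at most one defect, so the constant is 12 + 6. *)
Lemma exp_err2_le : exp_err2 rho pX pZX pY n M1 M2 M3 delta <=
  t + t^-1 * (18 * E3 defect + 3 * wrong_sum2).
Proof.
have hE := E3_defect_ge0.
have w0 : 0 <= wrong_sum2.
  by rewrite /wrong_sum2 addr_ge0 // mulr_ge0 ?ler0n // mulr_ge0.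
set b := leRHS.
have b0 : 0 <= b.
  apply: addr_ge0; first exact: ltW.
  apply: mulr_ge0; first by rewrite invr_ge0 ltW.
  by apply: addr_ge0; apply: mulr_ge0 => //; lra.
pose ks : seq ('I_M1 * 'I_M2) := [seq (k1, k2) | k1 <- enum 'I_M1, k2 <- enum 'I_M2].
pose err (cx : {ffun 'I_M1 -> wseq n X}) (cz : {ffun 'I_M1 -> {ffun 'I_M2 -> wseq n Z}}) (cy :
  {ffun 'I_M3 -> wseq n Y})
    (m1 : 'I_M1) (m2 : 'I_M2) (m3 : 'I_M3) := seq_error (received rho (cz m1 m2) (cy m3))
  [seq (dec2_proj rho pX pZX pY delta (cx k.1) (cz k.1 k.2),
               (k.1 == m1) && (k.2 == m2)) | k <- ks].
have -> : exp_err2 rho pX pZX pY n M1 M2 M3 delta =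
  EC (fun cx cz cy => ((M1 * M2 * M3)%:R)^-1 * \sum_m1 \sum_m2 \sum_m3 err cx cz cy m1 m2 m3) by [].
rewrite ECZ EC_sum; under eq_bigr do rewrite EC_sum.
under eq_bigr do under eq_bigr do rewrite EC_sum.
apply: avg3_le => // m1 m2 m3.
have uks : uniq ks.
  by apply: allpairs_uniq; [exact: enum_uniq|exact: enum_uniq|move=> [? ?] [? ?] _ _].
have kks : (m1, m2) \in ks by apply: allpairs_f; rewrite mem_enum.
pose P (cx : {ffun 'I_M1 -> wseq n X}) (cz : {ffun 'I_M1 -> {ffun 'I_M2 -> wseq n Z}})
    (k : 'I_M1 * 'I_M2) :=
  dec2_proj rho pX pZX pY delta (cx k.1) (cz k.1 k.2).
apply: (@le_trans _ _ (EC (fun cx cz cy => t + t^-1 * (18 * defect (cx m1) (cz m1 m2) (cy m3) +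
   3 * \sum_(k <- ks | k != (m1, m2)) rtr (P cx cz k * smooth (cx m1) (cz m1 m2) (cy m3)))))).
  apply: EC_le => // cx cz cy.
  have h := seq_error_smooth hrho hX hZX hY delta (cx m1) (cz m1 m2) (cy m3) (P := P cx cz)
    (g := fun k => (k.1 == m1) && (k.2 == m2)) uks kks.
  have hg : ((m1, m2).1 == m1) && ((m1, m2).2 == m2) by rewrite /= !eqxx.
  have hP k : projector (P cx cz k) by exact: dec2_projector.
  rewrite /err /received; apply: (le_trans (h t hg hP t0)).
  rewrite lerD2l ler_wpM2l ?invr_ge0 ?(ltW t0) // lerD2r.
  by have := dec2_deficit hrho hX hZX hY delta (cx m1) (cz m1 m2) (cy m3); rewrite /P /=; lra.
rewrite ECD EC_cst ECZ ECD !ECZ lerD2l ler_wpM2l ?invr_ge0 ?(ltW t0) //.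
rewrite (EC_correct hX hZX hY m1 m2 m3 defect) lerD2l ler_wpM2l // EC_sum.
exact: wrong_sum2_ge.
Qed.
End Fixed.
End Assembly.

Lemma nmsgM_le (R : realType) n (r s : R) :
  (nmsg n r * nmsg n s)%:R <= expR (n%:R * ((r + s) * ln 2)) :> R.
Proof. by rewrite mulrDl mulrDr expRD natrM ler_pM // nmsg_le. Qed.

Lemma nmsgMM_le (R : realType) n (r s u : R) :
  (nmsg n r * nmsg n s * nmsg n u)%:R <= expR (n%:R * ((r + s + u) * ln 2)) :> R.
Proof. by rewrite mulrDl mulrDr expRD natrM ler_pM // ?nmsgM_le // nmsg_le. Qed.

(** * The two rate regions *)

Section Regions.
Variables (R : realType) (X Z Y B : finType).
Variables (rho : Z -> Y -> op R B) (pX : X -> R) (pZX : X -> Z -> R) (pY : Y -> R).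
Hypotheses (hrho : forall z y, density (rho z y)) (hX : distr pX)
  (hZX : forall x, distr (pZX x)) (hY : distr pY).
Local Notation Hzy := (condH_zy rho pX pZX pY).
Local Notation Hxy := (condH_xy rho pX pZX pY).
Local Notation Hy := (condH_y rho pX pZX pY).
Local Notation Hz := (condH_z rho pX pZX pY).
Local Notation Hx := (condH_x rho pX pZX pY).
Local Notation Hu := (condH_u rho pX pZX pY).

Let Hzy0 : 0 <= Hzy. Proof. exact: (condH_ge0 (pZY_distr hX hZX hY) (rho_zy_density hrho)). Qed.
Let Hxy0 : 0 <= Hxy. Proof. exact: (condH_ge0 (pXY_distr hX hY) (rho_xy_density hrho hZX)). Qed.
Let Hy0 : 0 <= Hy. Proof. exact: (condH_ge0 hY (rho_y_density hrho hX hZX)). Qed.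
Let Hz0 : 0 <= Hz. Proof. exact: (condH_ge0 (pZ_distr hX hZX) (rho_z_density hrho hY)). Qed.
Let Hx0 : 0 <= Hx. Proof. exact: (condH_ge0 hX (rho_x_density hrho hZX hY)). Qed.
Let Hu0 : 0 <= Hu. Proof. exact: (condH_ge0 (pU_distr R) (rho_u_density hrho hX hZX hY)). Qed.

Let gap (r I D : R) : I * ln 2 = D -> r < I -> 0 < D - r * ln 2.
Proof.
move=> <- h; rewrite -mulrBl mulr_gt0 ?subr_gt0 //.
by rewrite ln_gt0 // ltr1n.
Qed.

(** Young's parameter is fixed at [eta / 2], independently of [n]; a large [n] pushes the remainder
    below the other half. *)
Lemma exists_small_error (eta C : R) (err : nat -> R) : 0 < eta -> 0 <= C ->
  (forall n, (0 < n)%N -> err n <= eta / 2 + (eta / 2)^-1 * (C / n%:R)) ->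
  exists2 n, (0 < n)%N & err n <= eta.
Proof.
move=> e0 C0 h; have e20 : 0 < eta / 2 by rewrite divr_gt0.
have [|n n0 hn] := choose_n (C := (eta / 2)^-1 * C) _ e20.
  by rewrite mulr_ge0 // invr_ge0 ltW.
exists n => //; apply: le_trans (h n n0) _; rewrite mulrA.
by move: hn; lra.
Qed.

Let eps0 : R := (1 / 10) ^+ 2.
Let heps : Num.sqrt eps0 = 1 / 10.
Proof. by rewrite sqrtr_sqr ger0_norm // divr_ge0. Qed.
Let eps01 : 0 < eps0 < 1 / 64.
Proof. by rewrite /eps0; apply/andP; split; lra. Qed.

Lemma region1 (r1 r2 r3 : R) :
  r3 < I_Y_B_gZ rho pX pZX pY -> r2 < I_Z_B_gXY rho pX pZX pY ->
  r1 + r2 < I_Z_B_gY rho pX pZX pY -> r2 + r3 < I_ZY_B_gX rho pX pZX pY ->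
  r1 + r2 + r3 < I_ZY_B rho pX pZX pY ->
  forall eta : R, 0 < eta -> exists (delta eps : R) (n : nat),
     [/\ 0 < delta < 1/64, 0 < eps < 1/64, (0 < n)%N &
       exp_err1 rho pX pZX pY n (nmsg n r1) (nmsg n r2) (nmsg n r3) delta eps <= eta].
Proof.
move=> i3 i2 i12 i23 i123 eta e0.
have g3 := gap (I_Y_B_gZE hrho hX hZX hY) i3; have g2 := gap (I_Z_B_gXYE hrho hX hZX hY) i2.
have g12 := gap (I_Z_B_gYE hrho hX hZX hY) i12; have g23 := gap (I_ZY_B_gXE hrho hX hZX hY) i23.
have g123 := gap (I_ZY_BE hrho hX hZX hY) i123.
set G3 := _ - _ in g3; set G2 := _ - _ in g2; set G12 := _ - _ in g12.
set G23 := _ - _ in g23; set G123 := _ - _ in g123.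
(* Each entry pairs a rate gap in nats with the entropies whose [8 * delta] slack must fit into half
   of it. *)
pose l := [:: (G3, Hzy + Hz); (G2, Hzy + Hxy); (G12, Hzy + Hy);
    (G23, Hzy + Hx); (G123, Hzy + Hu)].
have [|delta d01 hd] := small_delta (l := l).
  by move=> u; rewrite !inE => /or4P[/eqP->|/eqP->|/eqP->|/orP[/eqP->|/eqP->]] /=; split;
    rewrite ?addr_ge0.
have [d0 d1] := andP d01.
have [C C0 hC] := defect_avg hrho hX hZX hY d01.
(* [W / n] bounds [wrong_sum1]: the outer 2 is the operator factor of the two nested constructions,
   and each [2 / G] comes from [rate_bound]. *)
pose W := 2 * (2 / G3 + 2 / G2 + 2 / G12 + 2 / G23 + 2 / G123).
have W0 : 0 <= W by rewrite mulr_ge0 // !addr_ge0 // divr_ge0 // ltW.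
have [||n n0 hn] := @exists_small_error eta ((12 + 6 * 63 ^+ 2) * C + 3 * W)
   (fun n => exp_err1 rho pX pZX pY n (nmsg n r1) (nmsg n r2) (nmsg n r3) delta eps0) e0.
- by rewrite addr_ge0 // mulr_ge0 //; lra.
- move=> n n0; have e20 : 0 < eta / 2 by rewrite divr_gt0.
  apply: (le_trans (exp_err1_le hrho hX hZX hY _ _ _ n0 d0 d1 e20 heps)).
  rewrite lerD2l ler_wpM2l ?invr_ge0 ?(ltW e20) //.
  have hE := hC n n0.
  have rb s g H M : 0 < g -> g = H - Hzy - s * ln 2 ->
      (g, Hzy + H) \in l ->
      M <= expR (n%:R * (s * ln 2)) ->
      M * (expR (n%:R * ((1 + 8 * delta) * Hzy)) * expR (- (n%:R * ((1 - 8 * delta) * H)))) <= 2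
        / g / n%:R.
    move=> gp eg h hM; apply: (rate_bound (s := s * ln 2)) => //; first by rewrite eg; lra.
    exact: (hd _ h).
  have b3 := rb r3 G3 Hz _ g3 erefl _ (nmsg_le n r3).
  have b2 := rb r2 G2 Hxy _ g2 erefl _ (nmsg_le n r2).
  have b12 := rb (r1 + r2) G12 Hy _ g12 erefl _ (nmsgM_le n r1 r2).
  have b23 := rb (r2 + r3) G23 Hx _ g23 erefl _ (nmsgM_le n r2 r3).
  have b123 := rb (r1 + r2 + r3) G123 Hu _ g123 erefl _ (nmsgMM_le n r1 r2 r3).
  have eW : wrong_sum1 rho pX pZX pY n (nmsg n r1) (nmsg n r2) (nmsg n r3) delta <= W / n%:R.
    have -> : W / n%:R = 2 * (2 / G3 / n%:R + 2 / G2 / n%:R + 2 / G12 / n%:R + 2 / G23 / n%:R + 2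
      / G123 / n%:R).
      by rewrite /W -!mulrDl -mulrA.
    rewrite /wrong_sum1 ler_wpM2l //.
    by rewrite !lerD // ?(b3, b2, b12, b23, b123) ?inE ?eqxx ?orbT.
  have -> : ((12 + 6 * 63 ^+ 2) * C + 3 * W) / n%:R = (12 + 6 * 63 ^+ 2) * (C / n%:R) + 3 * (W /
    n%:R).
    by rewrite mulrDl -!(mulrA _ _ n%:R^-1).
  by rewrite lerD // ler_wpM2l //; lra.
by exists delta, eps0, n.
Qed.

Lemma region2 (r1 r2 r3 : R) :
  r2 < I_Z_B_gX rho pX pZX pY -> r1 + r2 < I_Z_B rho pX pZX pY ->
  forall eta : R, 0 < eta -> exists (delta eps : R) (n : nat),
     [/\ 0 < delta < 1/64, 0 < eps < 1/64, (0 < n)%N &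
       exp_err2 rho pX pZX pY n (nmsg n r1) (nmsg n r2) (nmsg n r3) delta <= eta].
Proof.
move=> i2 i12 eta e0.
have g2 := gap (I_Z_B_gXE hrho hX hZX hY) i2; have g12 := gap (I_Z_BE hrho hX hZX hY) i12.
set G2 := _ - _ in g2; set G12 := _ - _ in g12.
pose l := [:: (G2, Hz + Hx); (G12, Hz + Hu)].
have [|delta d01 hd] := small_delta (l := l).
  by move=> u; rewrite !inE => /orP[/eqP->|/eqP->] /=; split; rewrite ?addr_ge0.
have [d0 d1] := andP d01.
have [C C0 hC] := defect_avg hrho hX hZX hY d01.
pose W := 2 / G2 + 2 / G12.
have W0 : 0 <= W by rewrite addr_ge0 // divr_ge0 // ltW.
have [||n n0 hn] := @exists_small_error eta (18 * C + 3 * W)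
   (fun n => exp_err2 rho pX pZX pY n (nmsg n r1) (nmsg n r2) (nmsg n r3) delta) e0.
- by rewrite addr_ge0 // mulr_ge0 //; lra.
- move=> n n0; have e20 : 0 < eta / 2 by rewrite divr_gt0.
  apply: (le_trans (exp_err2_le hrho hX hZX hY _ _ _ n0 d0 d1 e20)).
  rewrite lerD2l ler_wpM2l ?invr_ge0 ?(ltW e20) //.
  have hE := hC n n0.
  have rb s g H M : 0 < g -> g = H - Hz - s * ln 2 -> (g, Hz + H) \in l ->
      M <= expR (n%:R * (s * ln 2)) ->
      M * (expR (n%:R * ((1 + 8 * delta) * Hz)) * expR (- (n%:R * ((1 - 8 * delta) * H)))) <= 2 /
        g / n%:R.
    move=> gp eg h hM; apply: (rate_bound (s := s * ln 2)) => //; first by rewrite eg; lra.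
    exact: (hd _ h).
  have b2 := rb r2 G2 Hx _ g2 erefl _ (nmsg_le n r2).
  have b12 := rb (r1 + r2) G12 Hu _ g12 erefl _ (nmsgM_le n r1 r2).
  have eW : wrong_sum2 rho pX pZX pY n (nmsg n r1) (nmsg n r2) delta <= W / n%:R.
    rewrite mulrDl /wrong_sum2.
    by rewrite !lerD // ?(b2, b12) ?inE ?eqxx ?orbT.
  have -> : (18 * C + 3 * W) / n%:R = 18 * (C / n%:R) + 3 * (W / n%:R).
    by rewrite mulrDl -!(mulrA _ _ n%:R^-1).
  by rewrite lerD // ler_wpM2l.
by exists delta, eps0, n.
Qed.
End Regions.

Theorem theorem3 (R : realType) (X Z Y B : finType)
  (rho : Z -> Y -> op R B) (pX : X -> R) (pZX : X -> Z -> R) (pY : Y -> R) :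
  (forall z y, density (rho z y)) ->
  distr pX -> (forall x, distr (pZX x)) -> distr pY ->
  forall r1 r2 r3 : R, 0 <= r1 -> 0 <= r2 -> 0 <= r3 ->
  ((r3 < I_Y_B_gZ rho pX pZX pY /\ r2 < I_Z_B_gXY rho pX pZX pY /\
    r1 + r2 < I_Z_B_gY rho pX pZX pY /\ r2 + r3 < I_ZY_B_gX rho pX pZX pY /\
    r1 + r2 + r3 < I_ZY_B rho pX pZX pY) ->
   forall eta : R, 0 < eta ->
   exists (delta eps : R) (n : nat),
     [/\ 0 < delta < 1/64, 0 < eps < 1/64, (0 < n)%N &
       exp_err1 rho pX pZX pY n (nmsg n r1) (nmsg n r2) (nmsg n r3) delta eps <= eta])
  /\
  ((I_Y_B_gZ rho pX pZX pY <= r3 /\ r2 < I_Z_B_gX rho pX pZX pY /\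
    r1 + r2 < I_Z_B rho pX pZX pY) ->
   forall eta : R, 0 < eta ->
   exists (delta eps : R) (n : nat),
     [/\ 0 < delta < 1/64, 0 < eps < 1/64, (0 < n)%N &
       exp_err2 rho pX pZX pY n (nmsg n r1) (nmsg n r2) (nmsg n r3) delta <= eta]).
Proof.
move=> hrho hX hZX hY r1 r2 r3 _ _ _; split.
  by case=> i3 [i2 [i12 [i23 i123]]]; exact: region1.
by case=> _ [i2 i12]; exact: region2.
Qed.
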